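(* Let $\alpha\in[-1/2,\infty)^d$ and $\varepsilon\in\{0,1\}^d$. (a) For $\eta$ a bounded measurable function on $(0,\infty)$, the kernel $K^{\alpha,\varepsilon}(x,y)=-\int_0^\infty\partial_tG^{\alpha,\varepsilon}_t(x,y)\eta(t)\,dt$ satisfies, for all $x,y\in\mathbb{R}^d_+$ with $x\ne y$, $|K^{\alpha,\varepsilon}(x,y)|\lesssim \dfrac{1}{w^+_\alpha(B(x,|y-x|))}$ and $|\nabla_{x,y}K^{\alpha,\varepsilon}(x,y)|\lesssim\dfrac{1}{|x-y|}\dfrac{1}{w^+_\alpha(B(x,|y-x|))}$. (b) For $\mu$ a signed or complex Borel measure on $(0,\infty)$ with $\int_0^\infty e^{-t\lambda_0^\alpha}d|\mu|(t)<\infty$, the kernel $\mathcal{K}^{\alpha,\varepsilon}(x,y)=\int_0^\infty G^{\alpha,\varepsilon}_t(x,y)\,d\mu(t)$ satisfies the same two estimates: for $x,y\in\mathbb{R}^d_+$, $x\ne y$, $|\mathcal K^{\alpha,\varepsilon}(x,y)|\lesssim 1/w^+_\alpha(B(x,|y-x|))$ and $|\nabla_{x,y}\mathcal K^{\alpha,\varepsilon}(x,y)|\lesssim |x-y|^{-1}/w^+_\alpha(B(x,|y-x|))$. The implicit constants are independent of $x,y$.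
   Context: Notation: $|\alpha|=\sum\alpha_i$; $dw_\alpha(x)=\prod_j|x_j|^{2\alpha_j+1}dx$; $\mathbb{R}^d_+=(0,\infty)^d$, $w^+_\alpha$ the restriction of $w_\alpha$ to $\mathbb{R}^d_+$; $B(x,r)=\{y\in\mathbb{R}^d_+:|y-x|<r\}$; $\lambda^\alpha_0=2|\alpha|+2d$. Heat kernel components: for $x,y\in\mathbb{R}^d_+$, $t>0$, $\varepsilon\in\{0,1\}^d$, $G^{\alpha,\varepsilon}_t(x,y)=(2\sinh 2t)^{-d}\exp\!\big(-\tfrac12\coth(2t)(|x|^2+|y|^2)\big)\prod_{i=1}^d(x_iy_i)^{\varepsilon_i}\frac{I_{\alpha_i+\varepsilon_i}(x_iy_i/\sinh 2t)}{(x_iy_i)^{\alpha_i+\varepsilon_i}}$, where $I_\nu$ is the modified Bessel function of the first kind. (This is the part, over multi-indices $k$ with $k_i\equiv\varepsilon_i\pmod 2$, of the heat kernel of the Dunkl harmonic oscillator associated with the reflection group $\mathbb{Z}_2^d$.) *)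

(* Defs.v *)
From HB Require Import structures.
From mathcomp Require Import all_boot all_order all_algebra.
From mathcomp Require Import all_classical all_reals all_analysis.
Set Implicit Arguments. Unset Strict Implicit. Unset Printing Implicit Defensive.
Import Order.TTheory GRing.Theory Num.Theory.
Import numFieldNormedType.Exports.
Local Open Scope classical_set_scope.
Local Open Scope ring_scope.

Section Defs.
Variable R : realType.

Definition Gamma (s : R) : R :=
  \int[@lebesgue_measure R]_(t in `]0, +oo[) (powR t (s - 1) * expR (- t)).

Definition BesselI (nu z : R) : R :=
  limn (fun n : nat => \sum_(0 <= m < n)
          (powR (z / 2) (2 * m%:R + nu) / (m`!%:R * Gamma (m%:R + nu + 1)))).

Definition sinh (t : R) : R := (expR t - expR (- t)) / 2.
Definition cosh (t : R) : R := (expR t + expR (- t)) / 2.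
Definition coth (t : R) : R := cosh t / sinh t.

Variable d : nat.

Definition sqnorm (x : 'I_d -> R) : R := \sum_(i < d) x i ^+ 2.
Definition enorm (x : 'I_d -> R) : R := Num.sqrt (sqnorm x).
Definition dist (x y : 'I_d -> R) : R := enorm (fun i => y i - x i).

Definition posR (x : 'I_d -> R) : Prop := forall i, 0 < x i.

Definition update (x : 'I_d -> R) (i : 'I_d) (t : R) : 'I_d -> R :=
  fun j => if j == i then t else x j.

(* Iterated Lebesgue integral over the coordinates listed in s
   (for nonnegative measurable f this is the Lebesgue integral on R^|s|,
   by Tonelli). *)
Fixpoint iter_integral (s : seq 'I_d) (f : ('I_d -> R) -> \bar R)
    (x : 'I_d -> R) : \bar R :=
  match s with
  | [::] => f x
  | i :: s' => (\int[@lebesgue_measure R]_(t in [set: R])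
                  iter_integral s' f (update x i t))%E
  end.

Definition integral_Rd (f : ('I_d -> R) -> \bar R) : \bar R :=
  iter_integral (enum 'I_d) f (fun _ => 0).

Definition ballp (x : 'I_d -> R) (r : R) : set ('I_d -> R) :=
  [set y | posR y /\ dist x y < r].

Definition wplus (alpha : 'I_d -> R) (A : set ('I_d -> R)) : \bar R :=
  integral_Rd (fun y => if `[< A y >]
                        then (\prod_(j < d) powR `|y j| (2 * alpha j + 1))%:E
                        else 0%E).

Definition lambda0 (alpha : 'I_d -> R) : R :=
  2 * (\sum_(i < d) alpha i) + 2 * d%:R.

Definition Gker (alpha : 'I_d -> R) (eps : 'I_d -> bool) (t : R)
    (x y : 'I_d -> R) : R :=
  (2 * sinh (2 * t)) ^- d
  * expR (- (1 / 2) * coth (2 * t) * (sqnorm x + sqnorm y))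
  * \prod_(i < d)
      ((x i * y i) ^+ eps i
       * (BesselI (alpha i + (eps i)%:R) (x i * y i / sinh (2 * t))
          / powR (x i * y i) (alpha i + (eps i)%:R))).

Definition dtGker alpha eps (t : R) x y : R :=
  derive1 (fun s => Gker alpha eps s x y) t.

Definition dx (K : ('I_d -> R) -> ('I_d -> R) -> R) j x y : R :=
  derive1 (fun s => K (update x j s) y) (x j).
Definition dy (K : ('I_d -> R) -> ('I_d -> R) -> R) j x y : R :=
  derive1 (fun s => K x (update y j s)) (y j).

Definition standard_estimates (alpha : 'I_d -> R)
    (Kre Kim : ('I_d -> R) -> ('I_d -> R) -> R) : Prop :=
  exists C : R, forall x y : 'I_d -> R, posR x -> posR y -> x <> y ->
    [/\ Num.sqrt (Kre x y ^+ 2 + Kim x y ^+ 2)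
          <= C / fine (wplus alpha (ballp x (dist x y))),
        (forall j, [/\ derivable (fun s => Kre (update x j s) y) (x j) 1,
                       derivable (fun s => Kim (update x j s) y) (x j) 1,
                       derivable (fun s => Kre x (update y j s)) (y j) 1 &
                       derivable (fun s => Kim x (update y j s)) (y j) 1]) &
        Num.sqrt (\sum_(j < d) (dx Kre j x y ^+ 2 + dx Kim j x y ^+ 2
                               + dy Kre j x y ^+ 2 + dy Kim j x y ^+ 2))
          <= C / (dist x y * fine (wplus alpha (ballp x (dist x y))))].

End Defs.

(* Main.v *)
Require Import Defs.
From HB Require Import structures.
From mathcomp Require Import all_boot all_order all_algebra.
From mathcomp Require Import all_classical all_reals all_analysis.
From mathcomp Require Import measurable_realfun ring lra.
Import Order.TTheory GRing.Theory Num.Theory.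
Import numFieldNormedType.Exports.
Set Implicit Arguments.
Unset Strict Implicit.
Unset Printing Implicit Defensive.
Local Open Scope classical_set_scope.
Local Open Scope ring_scope.

(** The kernel is the product over the coordinates of
    [1/2 e^B phi(x_i y_i / sinh 2t)], where [phi(z) = z^e e^-z I_(a+e)(z) / z^(a+e)]
    and [B] is the logarithm of a Gaussian factor times a power of [sinh 2t].

    The function [f_0 = e^-z I_nu(z) / z^nu] is completely monotone: up to sign,
    its derivatives satisfy [f_(k+1)^nu = 2 f_k^nu - (2 nu + 1) f_(k-1)^(nu+1)],
    so [e^(2z) f_k] is nondecreasing by induction, and the Bessel equation turns
    positivity into the decay [f_k <= C (1+z)^(-nu-1/2-k)].

    With [tau = tanh t], [r = |x-y|] and [Q = r^2/tau + tau (|x|^2 + |y|^2)], the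
    Gaussian factor is at most [e^(-Q/8)]; one derivative in [x] costs
    [tau^(-1/2)] and one in [t] costs [1/tau], up to powers of [1+Q], which the
    Gaussian absorbs. Writing [V] for the volume of the ball, this gives
    [|G| <= C e^(-t lambda_0) / V] and [|dG/dt| <= C r / (V sqrt t (t + r^2))], with an
    extra [1/r] for each derivative in [x]. The weight [r / (sqrt t (t + r^2))] is
    [d/dt (2 atan (sqrt t / r))], of integral at most [2 pi] whatever [r], so both
    parts follow by integrating the bounds and differentiating under the integral. *)

(** * Derivatives and integrals on the half-line *)

(** The hypothesis [alpha_i >= -1/2] is exactly the nonnegativity of [2 nu + 1], the coefficient of
    the shifted term in the recursion. It survives [nu -> nu + 1], so the induction on [k] treats
    all orders [nu] at once. The growth [e^z] of [I_nu(z)] has to be merged with the factor in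
    [coth]: only together do they decay in [x - y]. For the same reason the derivatives of the
    exponent are regrouped around [x - y] before absolute values are taken. Each derivative of [phi]
    gains [1/(1+z)], which pays for the derivative [y_i / sinh 2t] of its argument. In part (a),
    letting the Gaussian absorb every power of [r / sqrt tau] would leave [1/t], which is not
    integrable at [0]. One such factor is kept, and this needs [d >= 1]; for [d = 0] there are no
    distinct points. Ball measures occur only in denominators, so positivity and an upper bound by
    an explicit product [V] suffice. Derivatives in [y] come from [G_t(x,y) = G_t(y,x)] and from the
    comparability of [V] at [x] and at [y]. *)

Section has_derivative.
Variable R : realType.
Implicit Types (f g : R -> R) (x l : R).

(** Existence and value are carried together: a derivative is built by applying the rules along the
    shape of the function, and [has_deriv_eq] leaves an algebraic identity. *)
Definition has_deriv f x l := is_derive (x : R) (1 : R) f l.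

Lemma has_derivE f x l : has_deriv f x l -> derive1 f x = l.
Proof. by move=> [_ <-]; rewrite derive1E. Qed.

Lemma has_deriv_derivable f x l : has_deriv f x l -> derivable f x 1.
Proof. by case. Qed.

Lemma has_deriv_derive1 f x l : has_deriv f x l -> has_deriv f x (derive1 f x).
Proof. by move=> h; rewrite (has_derivE h). Qed.

Lemma has_deriv_continuous f x l : has_deriv f x l -> {for x, continuous f}.
Proof.
by move=> [h _]; apply: differentiable_continuous; apply/derivable1_diffP.
Qed.

Lemma has_deriv_eq f x l l' : has_deriv f x l -> l = l' -> has_deriv f x l'.
Proof. by move=> + <-. Qed.

Lemma near_has_deriv f g x l : (\near x, f x = g x) ->
  has_deriv f x l -> has_deriv g x l.
Proof. exact: near_eq_is_derive. Qed.

Lemma has_deriv_cst (c x : R) : has_deriv (fun=> c) x 0.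
Proof. exact: is_derive_cst. Qed.

Lemma has_deriv_id x : has_deriv (fun y => y) x 1.
Proof. exact: is_derive_id. Qed.

Lemma has_derivD f g x a b : has_deriv f x a -> has_deriv g x b ->
  has_deriv (fun y => f y + g y) x (a + b).
Proof. exact: is_deriveD. Qed.

Lemma has_derivN f x a : has_deriv f x a -> has_deriv (fun y => - f y) x (- a).
Proof. exact: is_deriveN. Qed.

Lemma has_derivB f g x a b : has_deriv f x a -> has_deriv g x b ->
  has_deriv (fun y => f y - g y) x (a - b).
Proof. exact: is_deriveB. Qed.

Lemma has_derivM f g x a b : has_deriv f x a -> has_deriv g x b ->
  has_deriv (fun y => f y * g y) x (a * g x + f x * b).
Proof.
move=> fa gb; apply: is_derive_eq; first exact: (is_deriveM fa gb).
by rewrite addrC /GRing.scale /= [g x * a]mulrC.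
Qed.

Lemma has_deriv_comp f g x a b : has_deriv f (g x) a -> has_deriv g x b ->
  has_deriv (fun y => f (g y)) x (a * b).
Proof. by move=> ? ?; exact: (@is_derive1_comp _ f g). Qed.

Lemma has_derivMl c f x a : has_deriv f x a -> has_deriv (fun y => c * f y) x (c * a).
Proof.
move=> h; apply: has_deriv_eq; first exact: has_derivM (has_deriv_cst c x) h.
by rewrite mul0r add0r.
Qed.

Lemma has_deriv_expR f x a : has_deriv f x a ->
  has_deriv (fun y => expR (f y)) x (expR (f x) * a).
Proof. by apply: has_deriv_comp; exact: is_derive_expR. Qed.

Lemma has_deriv_ln f x a : 0 < f x -> has_deriv f x a ->
  has_deriv (fun y => ln (f y)) x ((f x)^-1 * a).
Proof. by move=> fx; apply: has_deriv_comp; exact: is_derive1_ln. Qed.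

Lemma has_derivV f x a : f x != 0 -> has_deriv f x a ->
  has_deriv (fun y => (f y)^-1) x (- (f x) ^- 2 * a).
Proof.
move=> fx0 [h <-]; split; first exact: derivableV.
by rewrite deriveV.
Qed.

Lemma has_derivX n f x a : has_deriv f x a ->
  has_deriv (fun y => f y ^+ n) x (n%:R * f x ^+ n.-1 * a).
Proof.
have -> : (fun y => f y ^+ n) = f ^+ n by apply/funext => y; rewrite exprfctE.
by move=> h; exact: is_deriveX.
Qed.

Lemma powRE (x p : R) : 0 < x -> x `^ p = expR (p * ln x).
Proof. by move=> x0; rewrite /powR gt_eqF. Qed.

Lemma gt0_powRD (x p q : R) : 0 < x -> x `^ (p + q) = x `^ p * x `^ q.
Proof. by move=> x0; rewrite powRD// (gt_eqF x0) implybT. Qed.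

Lemma near_gt0 (x : R) : 0 < x -> \near x, 0 < x.
Proof. exact: lt_nbhsr. Qed.

Lemma has_deriv_powR p f x a : 0 < f x -> has_deriv f x a ->
  has_deriv (fun y => f y `^ p) x (p * f x `^ (p - 1) * a).
Proof.
move=> fx0; apply: (@has_deriv_comp (fun y => y `^ p)).
apply: (@near_has_deriv (fun y => expR (p * ln y))).
  near=> y; rewrite powRE//; near: y; exact: near_gt0.
apply: has_deriv_eq.
  by apply/has_deriv_expR/has_derivMl/has_deriv_ln; [exact: fx0|exact: has_deriv_id].
rewrite /= mulr1 -powRE// powRB; last by rewrite (gt_eqF fx0) implybT.
by rewrite powRr1 ?ltW//; ring.
Unshelve. all: by end_near. Qed.

Lemma has_deriv_sqrt x : 0 < x -> has_deriv Num.sqrt x (2 * Num.sqrt x)^-1.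
Proof. exact: is_derive1_sqrt. Qed.

Lemma has_deriv_ge0_le f (f' : R -> R) (a b : R) : a <= b ->
  (forall x, a <= x <= b -> has_deriv f x (f' x)) ->
  (forall x, a <= x <= b -> 0 <= f' x) -> f a <= f b.
Proof.
move=> ab df f'0; apply: (@ger0_derive1_ndecr _ f a b) => //.
- move=> x /[!in_itv]/= /andP[ax xb].
  by apply: (has_deriv_derivable (df x _)); rewrite !ltW.
- move=> x /[!in_itv]/= /andP[ax xb].
  by rewrite (has_derivE (df x _)) ?f'0 ?ltW.
- apply: continuous_in_subspaceT => x /[!inE]/= /[!in_itv]/= xab.
  exact: has_deriv_continuous (df x xab).
Qed.

Lemma has_deriv_le0_ge f (f' : R -> R) (a b : R) : a <= b ->
  (forall x, a <= x <= b -> has_deriv f x (f' x)) ->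
  (forall x, a <= x <= b -> f' x <= 0) -> f b <= f a.
Proof.
move=> ab df f'0; rewrite -lerN2.
apply: (@has_deriv_ge0_le (fun x => - f x) (fun x => - f' x)) => //.
  by move=> x xab; apply/has_derivN/df.
by move=> x xab; rewrite oppr_ge0 f'0.
Qed.

End has_derivative.

Section elementary_bounds.
Variable R : realType.
Implicit Types (b c q x y : R).

(** The tangent line of [ln] at [1/d]. Its slope [d] is free, so it can be made small enough to be
    beaten by a given exponential rate. *)
Lemma ln_le_linear (d u : R) : 0 < d -> 0 < u -> ln u <= d * u - 1 - ln d.
Proof.
move=> d0 u0; rewrite lerBrDr -lnM ?posrE// mulrC.
have du : -1 < d * u - 1 by have := mulr_gt0 d0 u0; lra.
by have := le_ln1Dx du; rewrite addrC subrK.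
Qed.

Lemma powR_expR_bounded b c : 0 <= b -> 0 < c ->
  exists2 C, 0 < C & forall q, 0 <= q -> (1 + q) `^ b * expR (- (c * q)) <= C.
Proof.
(* This slope gives [b * d <= c], so [b ln(1+q) - c q] is bounded by a constant; the [+ 1] allows
   [b = 0]. *)
move=> b0 c0; set d := c / (b + 1).
have b1 : 0 < b + 1 by lra.
have d0 : 0 < d by rewrite divr_gt0.
exists (expR (c + `|b * (1 + ln d)|)) => [|q q0]; first exact: expR_gt0.
rewrite powRE; last lra.
rewrite -expRD ler_expR.
have u0 : 0 < 1 + q by lra.
have h := ler_wpM2l b0 (ln_le_linear d0 u0).
have bd : b * d <= c by rewrite /d mulrA ler_pdivrMr//; nra.
have := ler_norm (- (b * (1 + ln d))); rewrite normrN.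
have := ler_wpM2r (ltW u0) bd.
move=> h1 h2; lra.
Qed.

Lemma powR_expR_bounded0 b c : 0 <= b -> 0 < c ->
  exists2 C, 0 < C & forall q, 0 <= q -> q `^ b * expR (- (c * q)) <= C.
Proof.
move=> b0 c0; have [C C0 CP] := powR_expR_bounded b0 c0.
exists C => // q q0; apply: le_trans (CP _ q0); rewrite ler_wpM2r ?expR_ge0//.
by apply: ge0_ler_powR; rewrite ?nnegrE//; lra.
Qed.

End elementary_bounds.

Section half_line.
Variable R : realType.
Let mu := @lebesgue_measure R.
Implicit Types (f F : R -> R).

(** An exhaustion of the half-line by compact intervals, on each of which the fundamental theorem of
    calculus applies without any condition at [0] or at infinity. *)
Let I_ (n : nat) : set R := `[n.+1%:R^-1, n.+1%:R].

Let I_nd : {homo I_ : n m / (n <= m)%N >-> (n <= m)%O}.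
Proof.
move=> n m nm; rewrite subsetEset; apply: subset_itv; rewrite bnd_simp.
  by rewrite lef_pV2 ?posrE ?ltr0n// ler_nat.
by rewrite ler_nat.
Qed.

Let I_bigcup : \bigcup_n I_ n = `]0, +oo[%classic.
Proof.
apply/seteqP; split => [x [n _]|x] /=; rewrite /I_/= !in_itv/= ?andbT.
  by move=> /andP[nx _]; rewrite (lt_le_trans _ nx)// invr_gt0 ltr0n.
move=> x0; have [n xn] : exists n : nat, Num.max x x^-1 <= n%:R.
  exists (Num.truncn (Num.max x x^-1)).+1.
  by rewrite ltW// truncnS_gt.
exists n => //=; rewrite /I_/= in_itv/=.
move: xn; rewrite ge_max => /andP[xn xVn].
have n1 : (n%:R : R) <= n.+1%:R by rewrite ler_nat.
rewrite (le_trans xn)// andbT -[leRHS]invrK lef_pV2 ?posrE ?invr_gt0 ?ltr0n//.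
exact: le_trans n1.
Qed.

Let I_gt0 n x : I_ n x -> 0 < x.
Proof.
by rewrite /I_/= in_itv/= => /andP[nx _]; rewrite (lt_le_trans _ nx)// invr_gt0 ltr0n.
Qed.

Lemma continuous_pos_measurable f : (forall x, 0 < x -> {for x, continuous f}) ->
  measurable_fun (`]0, +oo[ : set R) f.
Proof.
move=> cf; apply: open_continuous_measurable_fun => //.
by move=> x /[!inE]/=; rewrite in_itv/= andbT => /cf.
Qed.

Lemma continuous_pos_measurable_lebesgue f : (forall x, 0 < x -> {for x, continuous f}) ->
  measurable_fun (T := measurableTypeR R) (U := R) `]0, +oo[ f.
Proof. by move=> cf; have := continuous_pos_measurable cf. Qed.

Lemma continuous_pos_emeasurable f : (forall x, 0 < x -> {for x, continuous f}) ->
  measurable_fun (T := measurableTypeR R) `]0, +oo[ (EFin \o f).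
Proof.
by move=> cf; apply/measurable_EFinP; exact: (continuous_pos_measurable_lebesgue cf).
Qed.

Lemma measurable_pos_itv : measurable (`]0, +oo[%classic : set (measurableTypeR R)).
Proof. exact: measurable_itv. Qed.

Lemma FTC_pos f F a b : 0 < a -> a < b ->
  (forall x, 0 < x -> {for x, continuous f}) ->
  (forall x, 0 < x -> has_deriv F x (f x)) ->
  (\int[mu]_(x in `[a, b]) (f x)%:E = (F b - F a)%:E)%E.
Proof.
move=> a0 ab cf dF; have x0 x : a <= x -> 0 < x by exact: lt_le_trans.
rewrite EFinB; apply: continuous_FTC2 => //.
- apply: continuous_in_subspaceT => x /[!inE]/= /[!in_itv]/= /andP[ax _].
  exact/cf/x0.
- split.
  + move=> x /[!in_itv]/= /andP[ax _].
    exact: has_deriv_derivable (dF _ (lt_trans a0 ax)).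
  + apply: cvg_at_right_filter; exact: (has_deriv_continuous (dF a a0)).
  + apply: cvg_at_left_filter; exact: (has_deriv_continuous (dF b (lt_trans a0 ab))).
- move=> x /[!in_itv]/= /andP[ax _]; exact: has_derivE (dF _ (lt_trans a0 ax)).
Qed.

(** Monotone convergence along [I_]. A two-sided bound on the primitive replaces the computation of
    its limits. *)
Lemma bounded_primitive_integral_le f F (a b : R) :
  (forall x, 0 < x -> 0 <= f x) ->
  (forall x, 0 < x -> {for x, continuous f}) ->
  (forall x, 0 < x -> has_deriv F x (f x)) ->
  (forall x, 0 < x -> a <= F x <= b) ->
  (\int[mu]_(x in (`]0%R, +oo[ : set R)) (f x)%:E <= (b - a)%:E)%E.
Proof.
move=> f0 cf dF Fab.
have mf := continuous_pos_measurable cf.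
have : (\int[mu]_(x in I_ i) (f x)%:E)%E @[i --> \oo] --> 
   (\int[mu]_(x in `]0%R, +oo[) (f x)%:E)%E.
  rewrite -I_bigcup; apply: ge0_nondecreasing_set_cvg_integral => [|i|i|i x Ix].
  - exact: I_nd.
  - exact: measurable_itv.
  - apply/measurable_EFinP; move: mf; apply: measurable_funS; first exact: measurable_itv.
    by move=> x /I_gt0; rewrite /= in_itv/= andbT.
  - by rewrite lee_fin f0// (I_gt0 Ix).
move=> cvgI; apply: (cvge_le _ cvgI); apply: nearW => n.
(* [I_ 0] is the single point 1, while [FTC_pos] asks for an interval of positive length. *)
have [->|n0] := posnP n.
  rewrite /I_ invr1 set_itv1 integral_set1 lee_fin.
  by have := Fab 1 ltr01; lra.
rewrite /I_ (@FTC_pos f F)//.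
- rewrite lee_fin.
  have := Fab n.+1%:R (ltr0Sn _ _).
  have := Fab n.+1%:R^-1; rewrite invr_gt0 ltr0Sn => /(_ isT).
  by move=> /andP[? ?] /andP[? ?]; lra.
- by rewrite (@lt_trans _ _ 1)// ?invf_lt1 ?ltr0Sn// ltr1n ltnS.
Qed.

(** Here [f] may change sign, so the truncations to [I_ n] are handled by dominated convergence with
    [|f|] as the dominating function. *)
Lemma integral_pos_primitive f F (l0 l1 : R) :
  mu.-integrable `]0, +oo[ (EFin \o f) ->
  (forall x, 0 < x -> {for x, continuous f}) ->
  (forall x, 0 < x -> has_deriv F x (f x)) ->
  F n.+1%:R^-1 @[n --> \oo] --> l0 ->
  F n.+1%:R @[n --> \oo] --> l1 ->
  \int[mu]_(x in `]0, +oo[) f x = l1 - l0.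
Proof.
move=> intf cf dF F0 F1.
have mf := continuous_pos_measurable cf.
have Isub n : I_ n `<=` `]0, +oo[.
  by move=> x /I_gt0; rewrite /= in_itv/= andbT.
pose f_ n x := ((f \_ (I_ n)) x)%:E.
have mI i : measurable (I_ i) by exact: measurable_itv.
have D := @dominated_convergence _ _ _ mu `]0, +oo[ (measurable_itv _) f_
  (EFin \o f) (EFin \o (fun x => `|f x|)).
have [] := D.
- move=> n; apply/measurable_EFinP.
  apply/measurable_restrict; [exact: mI|exact: measurable_itv|].
  by move: mf; apply: measurable_funS => // x [].
- exact/measurable_EFinP.
- apply: aeW => x /=; rewrite in_itv/= andbT => x0.
  have : (\bigcup_n I_ n) x by rewrite I_bigcup /= in_itv/= andbT.
  move=> [N _ INx]; apply: cvg_near_cst; near=> n.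
  rewrite /f_ patchE mem_set//.
  have : (I_ N <= I_ n)%O by apply: I_nd; near: n; exact: nbhs_infty_ge.
  by rewrite subsetEset; apply.
- by move/integrable_norm: intf.
- apply: aeW => x n _ /=; rewrite lee_fin /f_ patchE.
  by case: ifPn => //; rewrite normr0.
move=> _ _ cvgI.
rewrite /Rintegral; apply: EFin_inj; rewrite fineK; last exact: integrable_fin_num.
apply: (cvg_unique _ cvgI); first exact: ereal_hausdorff.
suff -> : (fun n => \int[mu]_(x in `]0%R, +oo[) f_ n x)%E =
    (fun n => (F n.+1%:R - F n.+1%:R^-1)%:E) by apply: cvg_EFin; [exact: nearW|exact: cvgB].
apply/funext => n.
rewrite [LHS](_ : _ = \int[mu]_(x in I_ n) (f x)%:E)%E; last first.
  rewrite [RHS]integral_mkcond [LHS]integral_mkcond; apply: eq_integral => x _.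
  rewrite !patchE /f_; case: ifPn => xI.
    by rewrite patchE; case: ifPn.
  case: ifPn => // xIn; move: xI; rewrite notin_setE => /(_ _)[].
  by apply: (Isub n); rewrite inE in xIn.
have [->|n0] := posnP n; first by rewrite /I_ invr1 set_itv1 integral_set1 subrr.
rewrite /I_ (@FTC_pos f F)//.
by rewrite (@lt_trans _ _ 1)// ?invf_lt1 ?ltr0Sn// ltr1n ltnS.
Unshelve. all: by end_near. Qed.

End half_line.

(** * A weight in time whose integral is bounded uniformly in [r] *)

Section time_weight_integral.
Variable R : realType.
Local Notation mu := (@lebesgue_measure R).

(** Under [t = r^2 s] the measure [time_weight r t dt] becomes [ds / (sqrt s (1 + s))]; this scale
    invariance is why its mass does not depend on [r]. *)
Definition time_weight (r t : R) : R := r / (Num.sqrt t * (t + r ^+ 2)).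

Lemma time_weight_gt0 r t : 0 < r -> 0 < t -> 0 < time_weight r t.
Proof.
move=> r0 t0; rewrite /time_weight divr_gt0// mulr_gt0 ?sqrtr_gt0//.
by rewrite ltr_wpDr// exprn_ge0// ltW.
Qed.

Lemma time_weight_primitive r t : 0 < r -> 0 < t ->
  has_deriv (fun t => 2 * atan (Num.sqrt t / r)) t (time_weight r t).
Proof.
move=> r0 t0; apply: has_deriv_eq.
  apply: has_derivMl.
  apply: (@has_deriv_comp _ atan _ _ _ _ (is_derive1_atan _)).
  apply: has_derivM (has_deriv_cst _ _); exact: has_deriv_sqrt.
have s0 : 0 < Num.sqrt t by rewrite sqrtr_gt0.
rewrite mulr0 addr0 /time_weight; set s := Num.sqrt t.
have -> : t = s ^+ 2 by rewrite sqr_sqrtr// ltW.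
have r2 : s ^+ 2 + r ^+ 2 != 0.
  by rewrite gt_eqF// ltr_wpDr ?exprn_gt0// exprn_ge0// ltW.
have r3 : r ^+ 2 + s ^+ 2 != 0 by rewrite addrC.
have s1 : s != 0 by rewrite gt_eqF.
have r1 : r != 0 by rewrite gt_eqF.
by field; rewrite r2 s1 r1.
Qed.

Lemma continuous_time_weight r t : 0 < r -> 0 < t -> {for t, continuous (time_weight r)}.
Proof.
move=> r0 t0.
have h : Num.sqrt t * (t + r ^+ 2) != 0.
  by rewrite mulf_neq0 ?gt_eqF ?sqrtr_gt0// ltr_wpDr// exprn_ge0// ltW.
refine (@has_deriv_continuous _ (fun u => r * (Num.sqrt u * (u + r ^+ 2))^-1) t _
  (has_derivM (has_deriv_cst r t)
    (@has_derivV _ (fun u => Num.sqrt u * (u + r ^+ 2)) t _ h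
      (has_derivM (has_deriv_sqrt t0)
        (has_derivD (has_deriv_id t) (has_deriv_cst (r ^+ 2) t)))))).
Qed.

Lemma integral_time_weight_le r : 0 < r ->
  (\int[mu]_(t in (`]0%R, +oo[ : set R)) (time_weight r t)%:E <= (2 * pi)%:E)%E.
Proof.
(* The full range of [2 atan] is used. As [sqrt t / r] is positive the integral is in fact [pi], but
   any bound independent of [r] will do. *)
move=> r0; have -> : 2 * pi = pi - - pi :> R by ring.
apply: (@bounded_primitive_integral_le _ _ (fun t => 2 * atan (Num.sqrt t / r))).
- by move=> t t0; exact/ltW/time_weight_gt0.
- by move=> t t0; exact: continuous_time_weight.
- by move=> t t0; exact: time_weight_primitive.
- move=> t t0; have := atan_gtNpi2 (Num.sqrt t / r).
  by have := atan_ltpi2 (Num.sqrt t / r); lra.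
Qed.

Lemma measurable_time_weight r : 0 < r ->
  measurable_fun (T := measurableTypeR R) `]0, +oo[ (EFin \o time_weight r).
Proof.
by move=> r0; apply: continuous_pos_emeasurable => t; exact: continuous_time_weight.
Qed.

Lemma integrable_time_weight r : 0 < r -> mu.-integrable `]0, +oo[ (EFin \o time_weight r).
Proof.
move=> r0; apply/integrableP; split; first exact: measurable_time_weight.
apply: le_lt_trans (ltry (2 * pi)).
apply: le_trans (integral_time_weight_le r0); rewrite le_eqVlt; apply/orP; left; apply/eqP.
apply: eq_integral => t; rewrite inE /= in_itv/= andbT => t0.
by rewrite /= ger0_norm// ltW// time_weight_gt0.
Qed.

Lemma Rintegral_time_weight_le r : 0 < r -> \int[mu]_(t in `]0, +oo[) time_weight r t <= 2 * pi.
Proof.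
move=> r0; rewrite -lee_fin /Rintegral fineK; first exact: integral_time_weight_le.
by apply: integrable_fin_num => //; exact: integrable_time_weight.
Qed.

End time_weight_integral.

(** * The Gamma function on [[1/2, oo)] *)

Section Gamma_function.
Variable R : realType.
Implicit Type s t : R.
Local Notation mu := (@lebesgue_measure R).

Lemma has_deriv_powR_id p t : 0 < t -> has_deriv (fun t => t `^ p) t (p * t `^ (p - 1)).
Proof.
move=> t0; apply: has_deriv_eq.
  by apply: (has_deriv_powR p t0); exact: has_deriv_id.
by rewrite mulr1.
Qed.

Lemma has_deriv_expRN t : has_deriv (fun t => expR (- t)) t (- expR (- t)).
Proof.
apply: has_deriv_eq; first exact/has_deriv_expR/has_derivN/has_deriv_id.
by rewrite mulrN1.
Qed.

(** Comparison with [time_weight 1], already known to be integrable: the quotient is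
    [t^(s-1/2) (1+t) e^-t], bounded because [s >= 1/2]. The arguments [m + nu + 1] of the Bessel
    coefficients lie in this range. *)
Lemma integrable_Gamma s : 1 / 2 <= s ->
  mu.-integrable `]0, +oo[ (EFin \o (fun t => t `^ (s - 1) * expR (- t))).
Proof.
move=> s12.
have [|C C0 CP] := @powR_expR_bounded R (s + 1 / 2) 1 _ ltr01; first lra.
have := integrableZl (@measurable_pos_itv R) C (integrable_time_weight ltr01).
apply: le_integrable; first exact: measurable_pos_itv.
  apply: continuous_pos_emeasurable => t t0.
  apply: has_deriv_continuous.
  apply: has_derivM (has_deriv_expRN t); exact: has_deriv_powR_id.
move=> t; rewrite /= in_itv/= andbT => t0.
have e0 := @expR_gt0 R (- t).
have p0 := @powR_gt0 R t (s - 1) t0.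
have o0 := time_weight_gt0 ltr01 t0.
rewrite lee_fin ger0_norm; last by rewrite mulr_ge0// ltW.
rewrite ger0_norm; last by rewrite mulr_ge0// ltW.
have q0 : 0 < Num.sqrt t by rewrite sqrtr_gt0.
have t1 : 0 < t + 1 by lra.
rewrite /time_weight expr1n mulrA ler_pdivlMr ?mulr_gt0// mulr1.
apply: le_trans (CP t (ltW t0)); rewrite (mul1r t).
have -> : t `^ (s - 1) * expR (- t) * (Num.sqrt t * (t + 1)) =
   (t `^ (s - 1) * Num.sqrt t) * (1 + t) * expR (- t) by ring.
apply: ler_wpM2r; first exact: ltW.
rewrite -powR12_sqrt; last exact: ltW.
rewrite -gt0_powRD//.
have -> : s + 1 / 2 = (s - 1 / 2) + 1 by lra.
rewrite [leRHS]gt0_powRD; last lra.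
rewrite powRr1; last lra.
apply: ler_wpM2r; first lra.
have -> : s - 1 + 2^-1 = s - 1 / 2 by lra.
by apply: ge0_ler_powR; rewrite ?nnegrE; lra.
Qed.

Lemma Gamma_gt0 s : 1 / 2 <= s -> 0 < Gamma s.
Proof.
move=> s12; set f := fun t => t `^ (s - 1) * expR (- t).
have intf := integrable_Gamma s12.
have f0 t : 0 <= f t by rewrite mulr_ge0 ?powR_ge0 ?expR_ge0.
(* A lower bound of the integrand on [[1, 2]], an interval of length 1: there
   [t^(s-1) >= t^-1 >= 1/2] and [e^-t >= e^-2]. *)
have c0 : (0 : R) < expR (- 2) / 2 by rewrite divr_gt0 ?expR_gt0.
apply: (lt_le_trans c0).
rewrite -lee_fin /Gamma /Rintegral fineK; last exact: integrable_fin_num.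
have mf : measurable_fun (T := measurableTypeR R) `]0, +oo[ (EFin \o f) by case/integrableP : intf.
have sub : `[1, 2]%classic `<=` (`]0, +oo[%classic : set R).
  by move=> t; rewrite /= !in_itv/= andbT => /andP[t1 _]; lra.
apply: (@le_trans _ _ (\int[mu]_(t in `[1%R, 2%R]) (f t)%:E)%E); last first.
  apply: ge0_subset_integral => //.
  by move=> t _; rewrite lee_fin.
apply: (@le_trans _ _ (\int[mu]_(t in `[1%R, 2%R]) (expR (- 2) / 2)%:E)%E).
  rewrite integral_cst//= lebesgue_measure_itv/= lte_fin.
  have -> : (1 < 2 :> R) by lra.
  rewrite -EFinB -EFinM lee_fin.
  have -> : 2 - 1 = 1 :> R by lra.
  by rewrite mulr1.
apply: ge0_le_integral => //.
- by move: mf; apply: measurable_funS => //; exact: measurable_pos_itv.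
- move=> t; rewrite /= in_itv/= => /andP[t1 t2]; rewrite lee_fin /f mulrC.
  apply: ler_pM; rewrite ?expR_ge0 ?ler_expR//; last lra.
  apply: (@le_trans _ _ (t `^ (- 1))).
    by rewrite powR_inv1; [rewrite lef_pV2 ?posrE; lra|lra].
  by apply: ler_powR; lra.
Qed.

Lemma cvgn_invS : (n.+1%:R^-1 : R) @[n --> \oo] --> (0 : R).
Proof. exact: cvg_harmonic. Qed.

(** Integration by parts, written as one integral: [s t^(s-1) e^-t - t^s e^-t] is the derivative of
    [t^s e^-t], which vanishes at both ends. *)
Lemma GammaS s : 1 / 2 <= s -> Gamma (s + 1) = s * Gamma s.
Proof.
move=> s12.
have int1 := integrable_Gamma s12.
have s12' : 1 / 2 <= s + 1 by lra.
have int2 := integrable_Gamma s12'.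
have int1s : mu.-integrable `]0, +oo[ (EFin \o (fun t => s * (t `^ (s - 1) * expR (- t)))).
  by have := integrableZl (@measurable_pos_itv R) s int1.
(* One power more than needed for boundedness, so that [t^s e^-t <= C / t] tends to [0] at
   infinity. *)
have [|C C0 CP] := @powR_expR_bounded0 R (s + 1) 1 _ ltr01; first lra.
apply/esym/eqP; rewrite -subr_eq0; apply/eqP.
rewrite /Gamma -RintegralZl// -RintegralB//.
rewrite (@integral_pos_primitive _ _ (fun t => t `^ s * expR (- t)) 0 0) ?subrr//.
- by apply: eq_integrable (integrableB _ int1s int2).
- move=> t t0; apply: has_deriv_continuous; apply: has_derivB.
    apply: has_derivMl; apply: has_derivM (has_deriv_expRN t); exact: has_deriv_powR_id.
  apply: has_derivM (has_deriv_expRN t); exact: has_deriv_powR_id.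
- move=> t t0; apply: has_deriv_eq.
    apply: has_derivM (has_deriv_expRN t); exact: has_deriv_powR_id.
  by rewrite addrK; ring.
- have -> : (0 : R) = 0 * expR (- 0) by rewrite mul0r.
  apply: cvgM.
    have s0 : 0 < s by lra.
    move/cvg_at_rightP : (powR_cvg0 s0); apply; split; last exact: cvgn_invS.
    by move=> n; rewrite invr_gt0.
  apply: continuous_cvg; first exact: continuous_expR.
  by apply: cvgN; exact: cvgn_invS.
- apply: (@squeeze_cvgr _ _ _ _ (fun=> 0) (fun n => C * n.+1%:R^-1)).
  + near=> n; rewrite mulr_ge0 ?powR_ge0 ?expR_ge0//=.
    have := CP n.+1%:R (ler0n _ _); rewrite mul1r.
    rewrite powRD; last by rewrite pnatr_eq0 implybT.
    by rewrite powRr1// ler_pdivlMr ?ltr0Sn//; lra.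
  + exact: cvg_cst.
  + rewrite -[X in _ --> X](mulr0 C); apply: cvgM; [exact: cvg_cst|exact: cvgn_invS].
Unshelve. all: by end_near. Qed.

End Gamma_function.

(** * Modified Bessel functions *)

Section bessel_series.
Variable R : realType.
Implicit Types nu w z : R.

Definition bcoef nu (m : nat) : R := (m`!%:R * Gamma (m%:R + nu + 1))^-1.

Lemma bcoef_gt0 nu m : - (1 / 2) <= nu -> 0 < bcoef nu m.
Proof.
move=> nu0; rewrite invr_gt0 mulr_gt0 ?ltr0n ?fact_gt0// Gamma_gt0//.
by have := ler0n R m; lra.
Qed.

(** The factor [m + 1] produced by differentiation turns [(m+1)!] into [m!], and the shift of [m]
    inside Gamma becomes a shift of [nu]: the family of series is closed under differentiation. *)
Lemma bcoef_diffs nu : pseries_diffs (bcoef nu) = bcoef (nu + 1).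
Proof.
apply/funext => m; rewrite /pseries_diffs /bcoef factS natrM.
have -> : m%:R + (nu + 1) + 1 = m.+1%:R + nu + 1 by rewrite -natr1; ring.
by rewrite -mulrA invfM mulrA mulfV ?mul1r// pnatr_eq0.
Qed.

Lemma bcoef_rec nu m : - (1 / 2) <= nu ->
  bcoef nu m = (m%:R + nu + 1) * bcoef (nu + 1) m.
Proof.
move=> nu0; have m0 := ler0n R m.
have h : 1 / 2 <= m%:R + nu + 1 by lra.
rewrite /bcoef; have -> : m%:R + (nu + 1) + 1 = (m%:R + nu + 1) + 1 by ring.
rewrite (GammaS h).
have G0 : Gamma (m%:R + nu + 1) != 0 by rewrite gt_eqF// Gamma_gt0.
have f0 : (m`!%:R : R) != 0 by rewrite pnatr_eq0 -lt0n fact_gt0.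
have c0 : m%:R + nu + 1 != 0 by rewrite gt_eqF//; lra.
move: G0 f0 c0; move: (m%:R + nu + 1) (m`!%:R) (Gamma _) => c b a a0 b0 c0.
by field; rewrite a0 b0 c0.
Qed.

(** Only the first factor [nu + 1] of the functional equation can be below 1, and it is at least
    [1/2]. Hence [bcoef nu m] is at most a constant over [m!], and the exponential series
    dominates. *)
Lemma Gamma_shift_ge nu m : - (1 / 2) <= nu ->
  Gamma (nu + 1) / 2 <= Gamma (m%:R + nu + 1).
Proof.
move=> nu0; have h : 1 / 2 <= nu + 1 by lra.
have G0 := Gamma_gt0 h.
case: m => [|m]; first by rewrite add0r; lra.
elim: m => [|m IH].
  have -> : 1%:R + nu + 1 = (nu + 1) + 1 by ring.
  rewrite (GammaS h); set G := Gamma _; rewrite mulrC ler_pM2r//; lra.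
have -> : m.+2%:R + nu + 1 = (m.+1%:R + nu + 1) + 1 by rewrite -[m.+2%:R]natr1; ring.
have m0 := ler0n R m.
have -> : m.+1%:R + nu + 1 = m%:R + 1 + nu + 1 by rewrite -[m.+1%:R]natr1; ring.
have h1 : m.+1%:R + nu + 1 = m%:R + 1 + nu + 1 by rewrite -[m.+1%:R]natr1; ring.
rewrite h1 in IH.
have h2 : 1 / 2 <= m%:R + 1 + nu + 1 by lra.
have G2 := Gamma_gt0 h2.
rewrite (GammaS h2); apply: (le_trans IH); rewrite ler_peMl//; first exact: ltW.
lra.
Qed.

Lemma is_cvg_bcoef nu w : - (1 / 2) <= nu -> 0 <= w -> cvgn (pseries (bcoef nu) w).
Proof.
move=> nu0 w0; have h : 1 / 2 <= nu + 1 by lra.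
have G0 := Gamma_gt0 h.
pose K := 2 / Gamma (nu + 1).
have K0 : 0 <= K by rewrite divr_ge0// ltW.
apply: (@series_le_cvg _ _ (fun n => K * exp_coeff w n)).
- by move=> n; rewrite mulr_ge0 ?exprn_ge0// ltW// bcoef_gt0.
- by move=> n; rewrite mulr_ge0// /exp_coeff mulr_ge0 ?exprn_ge0// invr_ge0 ler0n.
- move=> n; have -> : K * exp_coeff w n = (K / n`!%:R) * w ^+ n.
    by rewrite /exp_coeff /= mulrA mulrAC.
  rewrite /= ler_wpM2r ?exprn_ge0//.
  rewrite /bcoef invfM mulrC ler_pM2r ?invr_gt0 ?ltr0n ?fact_gt0//.
  have g := Gamma_shift_ge n nu0.
  have g0 : 0 < Gamma (nu + 1) / 2 by rewrite divr_gt0.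
  have -> : K = (Gamma (nu + 1) / 2)^-1 by rewrite /K invfM invrK mulrC.
  move: g g0; move: (Gamma (nu + 1) / 2) (Gamma _) => a b ab a0.
  by rewrite lef_pV2// posrE (lt_le_trans a0).
- exact: (@is_cvg_seriesZ R (exp_coeff w) K (is_cvg_series_exp_coeff w)).
Qed.

Definition bessel_entire nu w : R := limn (pseries (bcoef nu) w).

Lemma has_deriv_bessel_entire nu w : - (1 / 2) <= nu ->
  has_deriv (bessel_entire nu) w (bessel_entire (nu + 1) w).
Proof.
move=> nu0; rewrite /bessel_entire -bcoef_diffs.
(* Termwise differentiation at [w] uses convergence at a point beyond [|w|]; this one is
   nonnegative, as [is_cvg_bcoef] requires. *)
have K0 : 0 <= `|w| + 1 by rewrite addr_ge0.
apply: (@pseries_snd_diffs _ _ (`|w| + 1)); rewrite ?bcoef_diffs.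
- exact: is_cvg_bcoef.
- by apply: is_cvg_bcoef => //; lra.
- by apply: is_cvg_bcoef => //; lra.
- by rewrite (ger0_norm K0); lra.
Qed.

(** By [bcoef_rec] each coefficient splits into an [nu + 1] part and an [m] part; the latter sums to
    [w] times the derivative of the series of order [nu + 1], which is the series of order
    [nu + 2]. *)
Lemma bessel_entire_rec nu w : - (1 / 2) <= nu -> 0 <= w ->
  bessel_entire nu w =
  (nu + 1) * bessel_entire (nu + 1) w + w * bessel_entire (nu + 2) w.
Proof.
move=> nu0 w0.
have n1 : - (1 / 2) <= nu + 1 by lra.
have n2 : - (1 / 2) <= nu + 2 by lra.
have c0 := is_cvg_bcoef nu0 w0.
have c1 := is_cvg_bcoef n1 w0.
have c2 := is_cvg_bcoef n2 w0.
(* Multiplication by [w] raises the degree by one, so the partial sum of order [nu + 2] stops one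
   term earlier. *)
suff E n : pseries (bcoef nu) w n.+1 =
    (nu + 1) * pseries (bcoef (nu + 1)) w n.+1 + w * pseries (bcoef (nu + 2)) w n.
  rewrite {1}/bessel_entire; apply: cvg_lim; first exact: Rhausdorff.
  rewrite -cvg_shiftS (_ : (fun n => _) = (fun n => (nu + 1) * pseries (bcoef (nu + 1)) w n.+1
    + w * pseries (bcoef (nu + 2)) w n)); last exact/funext.
  apply: cvgD; apply: cvgM; [exact: cvg_cst| |exact: cvg_cst|exact: c2].
  by move: c1; rewrite /bessel_entire; set u := pseries _ _ => c1; rewrite (cvg_shiftS u); exact: c1.
rewrite /pseries /series /=.
have -> : nu + 2 = nu + 1 + 1 by ring.
rewrite -(bcoef_diffs (nu + 1)) (eq_bigr (fun i => (nu + 1) * (bcoef (nu + 1) i * w ^+ i)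
   + i%:R * bcoef (nu + 1) i * w ^+ i)); last first.
  by move=> i _; rewrite (bcoef_rec i nu0); move: (bcoef _ _) => b; ring.
rewrite big_split/= -mulr_sumr; congr (_ + _).
rewrite big_nat_recl//= !mul0r add0r mulr_sumr; apply: eq_bigr => i _.
by rewrite /pseries_diffs exprS; move: (bcoef _ _) => b; ring.
Qed.

Lemma bessel_entire_gt0 nu w : - (1 / 2) <= nu -> 0 <= w -> 0 < bessel_entire nu w.
Proof.
move=> nu0 w0; apply: (lt_le_trans (bcoef_gt0 0 nu0)).
have <- : pseries (bcoef nu) w 1 = bcoef nu 0.
  by rewrite /pseries /series /= big_nat1 expr0 mulr1.
apply: nondecreasing_cvgn_le; last exact: is_cvg_bcoef.
apply: nondecreasing_series => n _ _.
by rewrite mulr_ge0 ?exprn_ge0// ltW// bcoef_gt0.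
Qed.

(* [bessel_norm nu z] is [I_nu(z) / z^nu]. *)
Definition bessel_norm nu z : R := 2 `^ (- nu) * bessel_entire nu (z ^+ 2 / 4).

Lemma BesselI_norm nu z : - (1 / 2) <= nu -> 0 < z ->
  BesselI nu z = z `^ nu * bessel_norm nu z.
Proof.
move=> nu0 z0; rewrite /BesselI /bessel_norm mulrA.
have -> : z `^ nu * 2 `^ (- nu) = (z / 2) `^ nu.
  rewrite powRM ?invr_ge0//; last exact: ltW.
  by rewrite -[2^-1]powR_inv1// -powRrM mulN1r.
have w0 : 0 <= z ^+ 2 / 4 by rewrite divr_ge0 ?exprn_ge0// ltW.
have z2 : 0 < z / 2 by lra.
apply: cvg_lim; first exact: Rhausdorff.
rewrite (_ : (fun n => _) =
  (fun n => (z / 2) `^ nu * pseries (bcoef nu) (z ^+ 2 / 4) n)); last first.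
  apply/funext => n; rewrite /pseries /series /= mulr_sumr; apply: eq_bigr => m _.
  rewrite gt0_powRD// -natrM powR_mulrn ?ltW// /bcoef exprM.
  have -> : (z / 2) ^+ 2 = z ^+ 2 / 4 by field.
  by move: (_ * Gamma _)^-1 (_ `^ _) (_ ^+ _) => g a b; ring.
by apply: cvgM; [exact: cvg_cst|exact: is_cvg_bcoef].
Qed.

(** The classical [(I_nu / z^nu)' = I_(nu+1) / z^nu]. Being a power series in [z^2], the normalised
    function is smooth through [z = 0], so no sign of [z] is required. *)
Lemma has_deriv_bessel_norm nu z : - (1 / 2) <= nu ->
  has_deriv (bessel_norm nu) z (z * bessel_norm (nu + 1) z).
Proof.
move=> nu0; apply: has_deriv_eq.
  apply: has_derivMl; apply: (@has_deriv_comp _ (bessel_entire nu) (fun z => z ^+ 2 / 4)).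
    exact: has_deriv_bessel_entire.
  apply: has_derivM (has_deriv_cst _ _); apply: has_derivX; exact: has_deriv_id.
rewrite /bessel_norm opprD gt0_powRD// powR_inv1//=.
move: (bessel_entire _ _) (_ `^ _) => a b; by field.
Qed.

Lemma bessel_norm_rec nu z : - (1 / 2) <= nu ->
  bessel_norm nu z =
  2 * (nu + 1) * bessel_norm (nu + 1) z + z ^+ 2 * bessel_norm (nu + 2) z.
Proof.
move=> nu0; rewrite /bessel_norm bessel_entire_rec// ?divr_ge0 ?sqr_ge0//.
have -> : nu + 2 = nu + 1 + 1 by ring.
rewrite !opprD !gt0_powRD// powR_inv1//.
by move: (bessel_entire _ _) (bessel_entire _ _) (_ `^ _) => a b c; field.
Qed.

Lemma bessel_norm_gt0 nu z : - (1 / 2) <= nu -> 0 < bessel_norm nu z.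
Proof.
move=> nu0; rewrite mulr_gt0 ?powR_gt0// bessel_entire_gt0//.
by rewrite divr_ge0// sqr_ge0.
Qed.

End bessel_series.

(** * Complete monotonicity and decay of [e^-z I_nu(z) / z^nu] *)

Section scaled_bessel.
Variable R : realType.
Implicit Types nu z : R.

(* [sbessel k nu] is [(-1)^k] times the k-th derivative of
   [e^-z I_nu(z) / z^nu]. The recursion, whose last term shifts nu, is what
   makes complete monotonicity provable by induction on k. *)
Fixpoint sbessel (k : nat) nu z : R :=
  match k with
  | 0 => expR (- z) * bessel_norm nu z
  | k'.+1 => match k' with
    | 0 => expR (- z) * (bessel_norm nu z - z * bessel_norm (nu + 1) z)
    | k''.+1 => 2 * sbessel k' nu z - (2 * nu + 1) * sbessel k'' (nu + 1) z
    end
  end.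

Lemma sbesselSS k nu z : sbessel k.+2 nu z =
  2 * sbessel k.+1 nu z - (2 * nu + 1) * sbessel k (nu + 1) z.
Proof. by []. Qed.

Lemma has_deriv_sbessel k nu z : - (1 / 2) <= nu ->
  has_deriv (sbessel k nu) z (- sbessel k.+1 nu z).
Proof.
(* The recursion reaches back two ranks and shifts [nu], so the induction carries two consecutive
   ranks, for every [nu]. *)
suff H : forall nu z, - (1 / 2) <= nu ->
  has_deriv (sbessel k nu) z (- sbessel k.+1 nu z) /\
  has_deriv (sbessel k.+1 nu) z (- sbessel k.+2 nu z) by move=> /(H nu z)[].
elim: k => [|k IH] {}nu {}z nu0; have n1 : - (1 / 2) <= nu + 1 by lra.
  have dN : has_deriv (fun z => expR (- z)) z (expR (- z) * -1).
    exact/has_deriv_expR/has_derivN/has_deriv_id.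
  split.
    apply: has_deriv_eq; first exact: has_derivM dN (has_deriv_bessel_norm z nu0).
    rewrite /=; move: (bessel_norm _ _) (bessel_norm _ _) (expR _) => a b c; ring.
  apply: has_deriv_eq.
    apply: has_derivM dN _; apply: has_derivB (has_deriv_bessel_norm z nu0) _.
    exact: has_derivM (has_deriv_id z) (has_deriv_bessel_norm z n1).
  have := bessel_norm_rec z nu0.
  have -> : nu + 2 = nu + 1 + 1 by ring.
  rewrite /=; move: (bessel_norm nu z) (bessel_norm (nu + 1) z).
  move: (bessel_norm (nu + 1 + 1) z) (expR _) => c e a b H.
  (* The three-term recurrence eliminates the order [nu + 2]; what remains is an identity in two
     Bessel functions. *)
  have -> : z * (z * c) = a - 2 * (nu + 1) * b by rewrite H; ring.
  by ring.
have [_ h2] := IH nu z nu0; split => //.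
have [h1 _] := IH (nu + 1) z n1.
have hB : has_deriv (fun z => 2 * sbessel k.+1 nu z - (2 * nu + 1) * sbessel k (nu + 1) z)
  z (2 * - sbessel k.+2 nu z - (2 * nu + 1) * - sbessel k.+1 (nu + 1) z).
  by apply: has_derivB; exact: has_derivMl.
apply: (has_deriv_eq hB); rewrite (sbesselSS k.+1).
move: (sbessel _ _ _) (sbessel _ _ _) => a b; ring.
Qed.

(** The Bessel equation, rewritten for [e^-z I_nu(z) / z^nu] and differentiated [k] times. The
    induction step differentiates the left side, which is identically zero. *)
Lemma sbessel_ode k nu z : - (1 / 2) <= nu ->
  z * sbessel k.+2 nu z - (2 * z + (2 * nu + 1) + k%:R) * sbessel k.+1 nu z
  + (2 * nu + 1 + 2 * k%:R) * sbessel k nu z = 0.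
Proof.
move=> nu0; elim: k z => [|k IH] z.
  rewrite /=; move: (bessel_norm _ _) (bessel_norm _ _) (expR _) => a b c; ring.
pose h z := z * sbessel k.+2 nu z - (2 * z + (2 * nu + 1) + k%:R) * sbessel k.+1 nu z
  + (2 * nu + 1 + 2 * k%:R) * sbessel k nu z.
have d1 := has_deriv_sbessel k z nu0.
have d2 := has_deriv_sbessel k.+1 z nu0.
have d3 := has_deriv_sbessel k.+2 z nu0.
have dh : has_deriv h z (1 * sbessel k.+2 nu z + z * - sbessel k.+3 nu z
  - ((2 * 1 + 0 + 0) * sbessel k.+1 nu z
     + (2 * z + (2 * nu + 1) + k%:R) * - sbessel k.+2 nu z)
  + (2 * nu + 1 + 2 * k%:R) * - sbessel k.+1 nu z).
  apply: has_derivD; last exact: has_derivMl.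
  apply: has_derivB; first exact: has_derivM (has_deriv_id z) d3.
  apply: has_derivM d2; apply: has_derivD (has_deriv_cst _ _).
  apply: has_derivD (has_deriv_cst _ _); exact/has_derivMl/has_deriv_id.
have h0 : h = fun=> 0 by apply/funext.
have := has_derivE dh; rewrite h0 (has_derivE (has_deriv_cst 0 z)) => /esym H.
rewrite -[RHS]oppr0 -H -[k.+1%:R]natr1.
move: (sbessel k.+3 _ _) (sbessel k.+2 _ _) (sbessel k.+1 _ _) => a b c; ring.
Qed.

(** At [z = 0] the equation degenerates to a relation between two consecutive ranks with positive
    coefficients. From rank 0 to rank 1 it reads [0 = 0] when [nu = -1/2], so rank 1 is computed
    directly. *)
Lemma sbessel0_gt0 k nu : - (1 / 2) <= nu -> 0 < sbessel k nu 0.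
Proof.
move=> nu0; have b0 := bessel_norm_gt0 0 nu0.
case: k => [|k]; first by rewrite /= mulr_gt0 ?expR_gt0.
elim: k => [|k IH]; first by rewrite /= mul0r subr0 mulr_gt0 ?expR_gt0.
have := sbessel_ode k.+1 0 nu0; rewrite mul0r mulr0 sub0r add0r => /eqP.
rewrite addrC subr_eq0 => /eqP H.
have k0 : (0 : R) < k.+1%:R by rewrite ltr0n.
have a0 : 0 < 2 * nu + 1 + k.+1%:R by lra.
by rewrite -(pmulr_rgt0 _ a0) -H mulr_gt0//; lra.
Qed.

(* (e^{2z} f_{k+1}^nu)' = (2 nu + 1) e^{2z} f_k^{nu+1} *)
Lemma sbessel_ge0 k nu z : - (1 / 2) <= nu -> 0 <= z -> 0 <= sbessel k nu z.
Proof.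
elim: k nu z => [|k IH] nu z nu0 z0.
  by rewrite /= mulr_ge0 ?expR_ge0// ltW// bessel_norm_gt0.
have H : sbessel k.+1 nu 0 * expR (2 * 0) <= sbessel k.+1 nu z * expR (2 * z).
  apply: (@has_deriv_ge0_le _ (fun z => sbessel k.+1 nu z * expR (2 * z))
    (fun z => - sbessel k.+2 nu z * expR (2 * z)
              + sbessel k.+1 nu z * (expR (2 * z) * (2 * 1)))) => // u uz.
    apply: has_derivM; first exact: has_deriv_sbessel.
    exact/has_deriv_expR/has_derivMl/has_deriv_id.
  rewrite sbesselSS.
  have -> : forall a b c e : R, - (2 * a - b * c) * e + a * (e * (2 * 1)) = b * c * e.
    by move=> *; ring.
  rewrite !mulr_ge0 ?expR_ge0//; first lra.
  by apply: IH; [lra|case/andP: uz].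
rewrite -(pmulr_lge0 _ (expR_gt0 (2 * z))).
by apply: le_trans H; rewrite mulr_ge0 ?expR_ge0// ltW// sbessel0_gt0.
Qed.

Lemma sbessel_decay k nu : - (1 / 2) <= nu -> exists2 C, 0 < C &
  forall z, 0 <= z -> sbessel k nu z <= C * (1 + z) `^ (- (nu + 1 / 2 + k%:R)).
Proof.
move=> nu0; set p := nu + 1 / 2 + k%:R.
have k0 := ler0n R k.
have p0 : 0 <= p by rewrite /p; lra.
(* All but the last [1] come from the coefficient of rank [k + 1] in [sbessel_ode]. The extra [1]
   gives [c >= 1], hence a positive base and [1 + z <= c + 2 z]. *)
set c := 2 * nu + 1 + k%:R + 1.
have c1 : 1 <= c by rewrite /c; lra.
have cz z : 0 <= z -> 0 < c + 2 * z by lra.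
exists (c `^ p * sbessel k nu 0) => [|z z0].
  by rewrite mulr_gt0 ?sbessel0_gt0// powR_gt0//; lra.
(* This product decreases: since [2 p = 2 nu + 1 + 2 k], the equation makes its derivative
   [-(c + 2 z)^(p-1) (z f_(k+2) + f_(k+1))], a nonpositive quantity. *)
have H : (c + 2 * z) `^ p * sbessel k nu z <= (c + 2 * 0) `^ p * sbessel k nu 0.
  apply: (@has_deriv_le0_ge _ (fun z => (c + 2 * z) `^ p * sbessel k nu z)
    (fun z => (p * (c + 2 * z) `^ (p - 1) * (0 + 2 * 1)) * sbessel k nu z
      + (c + 2 * z) `^ p * - sbessel k.+1 nu z)) => // u /andP[u0 _].
    apply: has_derivM; last exact: has_deriv_sbessel.
    apply: has_deriv_powR; first exact: cz.
    apply: has_derivD (has_deriv_cst _ _) _; exact/has_derivMl/has_deriv_id.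
  have -> : (c + 2 * u) `^ p = (c + 2 * u) `^ (p - 1) * (c + 2 * u).
    by rewrite -{3}[c + 2 * u]powRr1 ?ltW ?cz// -gt0_powRD ?cz// subrK.
  have P0 : 0 <= (c + 2 * u) `^ (p - 1) by exact: powR_ge0.
  have := sbessel_ode k u nu0.
  have := sbessel_ge0 k nu0 u0; have := sbessel_ge0 k.+1 nu0 u0.
  have := mulr_ge0 u0 (sbessel_ge0 k.+2 nu0 u0).
  set f0 := sbessel k nu u; set f1 := sbessel k.+1 nu u; set f2 := sbessel k.+2 nu u.
  set P := _ `^ _ => f2_0 f1_0 f0_0 ode.
  have -> : p * P * (0 + 2 * 1) * f0 + P * (c + 2 * u) * - f1 =
     - P * ((c + 2 * u) * f1 - 2 * p * f0) by ring.
  rewrite mulNr oppr_le0 mulr_ge0//.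
  rewrite /c /p; move: ode; lra.
rewrite mulr0 addr0 in H.
have P0 : 0 < (c + 2 * z) `^ p by rewrite powR_gt0// cz.
rewrite powRN ler_pdivlMr ?powR_gt0//; last lra.
apply: le_trans H; rewrite mulrC ler_wpM2r ?sbessel_ge0//.
by apply: ge0_ler_powR; rewrite ?nnegrE//; lra.
Qed.

End scaled_bessel.

Arguments sbessel : simpl never.

Section bessel_profile.
Variable R : realType.
Implicit Types (alpha z : R) (e : bool).

(* [prof k alpha e] is the k-th derivative of
   [z^e * e^-z I_(alpha+e)(z) / z^(alpha+e)] for k <= 2. *)
Definition prof (k : nat) alpha e z : R :=
  let f j := sbessel j (alpha + e%:R) z in
  if e then
    match k with 0 => z * f 0 | 1 => f 0 - z * f 1 | _ => z * f 2 - 2 * f 1 end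
  else match k with 0 => f 0 | 1 => - f 1 | _ => f 2 end.

Lemma has_deriv_prof0 alpha e z : - (1 / 2) <= alpha ->
  has_deriv (prof 0 alpha e) z (prof 1 alpha e z).
Proof.
move=> a0; have a1 : - (1 / 2) <= alpha + e%:R by case: e; rewrite ?addr0//=; lra.
rewrite /prof; case: e a1 => a1; last exact: (has_deriv_sbessel 0 z a1).
apply: has_deriv_eq; first exact: has_derivM (has_deriv_id z) (has_deriv_sbessel 0 z a1).
by rewrite mul1r mulrN.
Qed.

Lemma has_deriv_prof1 alpha e z : - (1 / 2) <= alpha ->
  has_deriv (prof 1 alpha e) z (prof 2 alpha e z).
Proof.
move=> a0; have a1 : - (1 / 2) <= alpha + e%:R by case: e; rewrite ?addr0//=; lra.
rewrite /prof; case: e a1 => a1.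
  apply: has_deriv_eq.
    apply: has_derivB (has_deriv_sbessel 0 z a1) _.
    exact: has_derivM (has_deriv_id z) (has_deriv_sbessel 1 z a1).
  by move: (sbessel 1 _ _) (sbessel 2 _ _) => a b; ring.
apply: has_deriv_eq; first exact: has_derivN (has_deriv_sbessel 1 z a1).
by rewrite opprK.
Qed.

(** For [e = 1] the order is [alpha + 1], which decays one power faster, and the factor [z] uses
    this power up: the exponent is the same for both parities. *)
Lemma prof_decay k alpha e : (k <= 2)%N -> - (1 / 2) <= alpha ->
  exists2 C, 0 < C & forall z, 0 <= z ->
    `|prof k alpha e z| <= C * (1 + z) `^ (- (alpha + 1 / 2 + k%:R)).
Proof.
move=> k2 a0; have a1 : - (1 / 2) <= alpha + e%:R by case: e; rewrite ?addr0//=; lra.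
set nu := alpha + e%:R in a1 *.
have [C0 C00 H0] := sbessel_decay 0 a1.
have [C1 C10 H1] := sbessel_decay 1 a1.
have [C2 C20 H2] := sbessel_decay 2 a1.
have pos j z : 0 <= z -> 0 <= sbessel j nu z by exact: sbessel_ge0.
have E (z c : R) : 0 <= z -> (1 + z) `^ (- (c + 1)) * (1 + z) = (1 + z) `^ (- c).
  move=> z0; have z1 : 0 < 1 + z by lra.
  by rewrite -{2}[1 + z]powRr1 ?ltW// -gt0_powRD//; congr (_ `^ _); ring.
have M (z c C f : R) : 0 <= z -> 0 <= f -> f <= C * (1 + z) `^ (- (c + 1)) ->
    z * f <= C * (1 + z) `^ (- c).
  move=> z0 f0 H; rewrite -(E z c z0) mulrA.
  by rewrite (@le_trans _ _ (f * (1 + z)))//; [rewrite mulrC ler_wpM2l//; lra|rewrite ler_wpM2r//; lra].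
exists (C0 + 2 * C1 + C2) => [|z z0]; first lra.
have [p0 p1 p2] := And3 (pos 0%N _ z0) (pos 1%N _ z0) (pos 2%N _ z0).
rewrite /prof; cbv zeta; rewrite -/nu; move: H0 H1 H2 => /(_ _ z0) H0 /(_ _ z0) H1 /(_ _ z0) H2.
have key (D P X : R) : 0 <= P -> X <= D * P -> D <= C0 + 2 * C1 + C2 ->
    X <= (C0 + 2 * C1 + C2) * P.
  by move=> P0 XD DC; apply: (le_trans XD); rewrite ler_wpM2r.
have pw c : 0 <= (1 + z) `^ c by exact: powR_ge0.
move: H0 H1 H2 p0 p1 p2; move: (sbessel 0 nu z) (sbessel 1 nu z) (sbessel 2 nu z).
rewrite /nu => f0 f1 f2 {pos} H0 H1 H2 p0 p1 p2; move: {a1} nu => _.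
case: e H0 H1 H2 p0 p1 p2 => /= H0 H1 H2 p0 p1 p2.
- have h0 : alpha + 1 + 1 / 2 + 0 = alpha + 1 / 2 + 0 + 1 by ring.
  have h1 : alpha + 1 + 1 / 2 + 1 = alpha + 1 / 2 + 1 + 1 by ring.
  have h2 : alpha + 1 + 1 / 2 + 2 = alpha + 1 / 2 + 2 + 1 by ring.
  have h01 : alpha + 1 + 1 / 2 + 0 = alpha + 1 / 2 + 1 by ring.
  have h12 : alpha + 1 + 1 / 2 + 1 = alpha + 1 / 2 + 2 by ring.
  case: k k2 => [|[|[|//]]] _.
  + rewrite ger0_norm; last by rewrite mulr_ge0.
    rewrite h0 in H0; apply: (key C0) => //; [exact: M|lra].
  + have := H0; rewrite h01 => H0'.
    have := H1; rewrite h1 => /(M _ _ _ _ z0 p1) H1'.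
    apply: (key (C0 + C1)) => //; last lra.
    rewrite (le_trans (ler_normB _ _))// mulrDl ger0_norm// ger0_norm ?mulr_ge0//.
    exact: lerD.
  + have := H2; rewrite h2 => /(M _ _ _ _ z0 p2) H2'.
    have := H1; rewrite h12 => H1'.
    apply: (key (C2 + 2 * C1)) => //; last lra.
    rewrite (le_trans (ler_normB _ _))// (ger0_norm (mulr_ge0 z0 p2)).
    rewrite ger0_norm; last lra.
    by move: H2' H1'; move: (_ `^ _) => P H2' H1'; lra.
- have aE : alpha + 0 = alpha by rewrite addr0.
  rewrite !aE in H0 H1 H2.
  case: k k2 => [|[|[|//]]] _ /=.
  + by rewrite ger0_norm//; apply: (key C0) => //; lra.
  + by rewrite normrN ger0_norm//; apply: (key C1) => //; lra.
  + by rewrite ger0_norm//; apply: (key C2) => //; lra.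
Qed.

Lemma BesselI_prof alpha e z : - (1 / 2) <= alpha -> 0 < z ->
  BesselI (alpha + e%:R) z = z `^ alpha * expR z * prof 0 alpha e z.
Proof.
move=> a0 z0; have a1 : - (1 / 2) <= alpha + e%:R by case: e; rewrite ?addr0//=; lra.
have e0 : expR z != 0 by rewrite expR_eq0.
rewrite BesselI_norm// gt0_powRD// /prof.
have sE nu : sbessel 0 nu z = expR (- z) * bessel_norm nu z by [].
case: e a1 => a1; rewrite sE expRN.
  by rewrite mulr1n powRr1 ?ltW//; move: (bessel_norm _ _) (_ `^ _) => a b; field.
by rewrite mulr0n addr0 powRr0; move: (bessel_norm _ _) (_ `^ _) => a b; field.
Qed.

End bessel_profile.

(** * The one-dimensional heat kernel *)

Section diff_at.
Variable R : realType.
Implicit Types (f g : R -> R) (x : R).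

(** Used for the dependence on [t], where only continuity, hence measurability of the integrands, is
    wanted; the value of the derivative is left unnamed. *)
Definition diff_at f x := exists l, has_deriv f x l.

Lemma diff_at_continuous f x : diff_at f x -> {for x, continuous f}.
Proof. by case=> l /has_deriv_continuous. Qed.

Lemma diff_at_cst c x : diff_at (fun=> c) x.
Proof. by exists 0; exact: has_deriv_cst. Qed.

Lemma diff_at_id x : diff_at (fun y => y) x.
Proof. by exists 1; exact: has_deriv_id. Qed.

Lemma diff_atD f g x : diff_at f x -> diff_at g x -> diff_at (fun y => f y + g y) x.
Proof. by move=> [a fa] [b gb]; exists (a + b); exact: has_derivD. Qed.

Lemma diff_atN f x : diff_at f x -> diff_at (fun y => - f y) x.
Proof. by move=> [a fa]; exists (- a); exact: has_derivN. Qed.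

Lemma diff_atM f g x : diff_at f x -> diff_at g x -> diff_at (fun y => f y * g y) x.
Proof. by move=> [a fa] [b gb]; exists (a * g x + f x * b); exact: has_derivM. Qed.

Lemma diff_atV f x : f x != 0 -> diff_at f x -> diff_at (fun y => (f y)^-1) x.
Proof. by move=> f0 [a fa]; exists (- (f x) ^- 2 * a); exact: has_derivV. Qed.

Lemma diff_atX n f x : diff_at f x -> diff_at (fun y => f y ^+ n) x.
Proof. by move=> [a fa]; exists (n%:R * f x ^+ n.-1 * a); exact: has_derivX. Qed.

Lemma diff_at_comp f g x : (forall y, diff_at f y) -> diff_at g x -> diff_at (fun y => f (g y)) x.
Proof.
by move=> sf [b gb]; have [a fa] := sf (g x); exists (a * b); exact: has_deriv_comp.
Qed.

Lemma diff_at_expR f x : diff_at f x -> diff_at (fun y => expR (f y)) x.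
Proof. by move=> [a fa]; exists (expR (f x) * a); exact: has_deriv_expR. Qed.

Lemma diff_at_ln f x : 0 < f x -> diff_at f x -> diff_at (fun y => ln (f y)) x.
Proof. by move=> f0 [a fa]; exists ((f x)^-1 * a); exact: has_deriv_ln. Qed.

Lemma diff_at_prof k (alpha : R) e z : - (1 / 2) <= alpha -> diff_at (prof k alpha e) z.
Proof.
move=> a0; have a1 : - (1 / 2) <= alpha + e%:R by case: e; rewrite ?addr0//=; lra.
have s j y : diff_at (sbessel j (alpha + e%:R)) y.
  by exists (- sbessel j.+1 (alpha + e%:R) y); exact: has_deriv_sbessel.
rewrite /prof; case: e a1 s => a1 s; case: k => [|[|k]].
- by apply: diff_atM => //; exact: diff_at_id.
- by apply: diff_atD => //; apply/diff_atN/diff_atM => //; exact: diff_at_id.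
- apply: diff_atD; first by apply: diff_atM => //; exact: diff_at_id.
  by apply/diff_atN/diff_atM => //; exact: diff_at_cst.
- exact: (s 0%N z).
- exact/diff_atN/(s 1%N z).
- exact: (s 2%N z).
Qed.

End diff_at.

Section hyperbolic.
Variable R : realType.
Implicit Types t : R.

Definition sh2 t : R := sinh (2 * t).
Definition ch2 t : R := cosh (2 * t).
Definition tnh t : R := sinh t / cosh t.

Lemma cosh_gt0 t : 0 < cosh t.
Proof. by rewrite /cosh divr_gt0 ?addr_gt0 ?expR_gt0. Qed.

Lemma sinh_gt0 t : 0 < t -> 0 < sinh t.
Proof. by move=> t0; rewrite /sinh divr_gt0// subr_gt0 ltr_expR; lra. Qed.

Lemma sh2_gt0 t : 0 < t -> 0 < sh2 t.
Proof. by move=> t0; apply: sinh_gt0; lra. Qed.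

Lemma tnh_gt0 t : 0 < t -> 0 < tnh t.
Proof. by move=> t0; rewrite divr_gt0 ?sinh_gt0 ?cosh_gt0. Qed.

Lemma cosh_sqr t : cosh t ^+ 2 = 1 + sinh t ^+ 2.
Proof.
rewrite /cosh /sinh expRN; have e0 : expR t != 0 by rewrite expR_eq0.
by move: e0; move: (expR t) => a a0; field.
Qed.

Lemma sh2E t : sh2 t = 2 * sinh t * cosh t.
Proof.
rewrite /sh2 /cosh /sinh mulr_natl mulr2n opprD !expRD expRN.
have e0 : expR t != 0 by rewrite expR_eq0.
by move: e0; move: (expR t) => a a0; field.
Qed.

Lemma ch2E t : ch2 t = 1 + 2 * sinh t ^+ 2.
Proof.
rewrite /ch2 /cosh /sinh mulr_natl mulr2n opprD !expRD expRN.
have e0 : expR t != 0 by rewrite expR_eq0.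
by move: e0; move: (expR t) => a a0; field.
Qed.

Lemma tnh_lt1 t : tnh t < 1.
Proof.
rewrite /tnh ltr_pdivrMr ?cosh_gt0// mul1r /sinh /cosh.
by have := expR_gt0 (- t); lra.
Qed.

Lemma onem_tnh_sqr t : 1 - tnh t ^+ 2 = (cosh t ^+ 2)^-1.
Proof.
have c0 : cosh t != 0 by rewrite gt_eqF// cosh_gt0.
have := cosh_sqr t; rewrite /tnh; move: c0; move: (cosh t) (sinh t) => c s c0 H.
rewrite expr_div_n; have -> : s ^+ 2 = c ^+ 2 - 1 by rewrite H; ring.
by field.
Qed.

(** With this and [ch2_tnh] the kernel depends on [t] through rational functions of [tau = tanh t]
    in [(0, 1)], and the estimates become polynomial inequalities. *)
Lemma sh2_tnh t : sh2 t = 2 * tnh t / (1 - tnh t ^+ 2).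
Proof.
rewrite onem_tnh_sqr sh2E invrK /tnh.
have c0 : cosh t != 0 by rewrite gt_eqF// cosh_gt0.
by move: c0; move: (cosh t) (sinh t) => c s c0; field.
Qed.

Lemma ch2_tnh t : ch2 t = (1 + tnh t ^+ 2) / (1 - tnh t ^+ 2).
Proof.
rewrite onem_tnh_sqr ch2E invrK /tnh.
have c0 : cosh t != 0 by rewrite gt_eqF// cosh_gt0.
have := cosh_sqr t; move: c0; move: (cosh t) (sinh t) => c s c0 H.
rewrite expr_div_n; have -> : s ^+ 2 = c ^+ 2 - 1 by rewrite H; ring.
by field.
Qed.

(** Equivalent to [e^(2t) >= 1 + 2t]. It allows [tau] to be replaced by [t] at the price of powers
    of [1 + t]. *)
Lemma tnh_lb t : 0 < t -> t / (1 + t) <= tnh t.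
Proof.
move=> t0; rewrite /tnh ler_pdivlMr ?cosh_gt0// mulrAC ler_pdivrMr; last lra.
rewrite /cosh /sinh expRN.
have e0 := expR_gt0 t; have := expR_ge1Dx (2 * t).
rewrite mulr_natl mulr2n expRD => h.
rewrite -(ler_pM2l e0); have e1 : expR t != 0 by rewrite gt_eqF.
move: e1 h; move: (expR t) => a a1 h.
have -> : a * (t * ((a + a^-1) / 2)) = t * (a * a + 1) / 2 by field.
have -> : a * ((a - a^-1) / 2 * (1 + t)) = (1 + t) * (a * a - 1) / 2 by field.
move: h; move: (a * a) => b h.
by rewrite ler_pM2r ?invr_gt0//; lra.
Qed.

Lemma cosh_sqr_ge t : expR (2 * t) / 4 <= cosh t ^+ 2.
Proof.
rewrite /cosh mulr_natl mulr2n expRD.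
have e0 := expR_gt0 t; have e1 := expR_gt0 (- t).
move: e0 e1; move: (expR t) (expR (- t)) => a b a0 b0.
have ab := mulr_gt0 a0 b0; have bb := mulr_gt0 b0 b0.
by rewrite expr2; lra.
Qed.

Lemma has_deriv_sh2 t : has_deriv sh2 t (2 * ch2 t).
Proof.
rewrite /sh2 /sinh /ch2 /cosh.
apply: has_deriv_eq.
  apply: has_derivM (has_deriv_cst _ t).
  apply: has_derivB; apply: has_deriv_expR.
    apply: has_derivMl; exact: has_deriv_id.
  apply: has_derivN; apply: has_derivMl; exact: has_deriv_id.
by move: (expR _) (expR _) => a b; field.
Qed.

Lemma has_deriv_ch2 t : has_deriv ch2 t (2 * sh2 t).
Proof.
rewrite /sh2 /sinh /ch2 /cosh.
apply: has_deriv_eq.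
  apply: has_derivM (has_deriv_cst _ t).
  apply: has_derivD; apply: has_deriv_expR.
    apply: has_derivMl; exact: has_deriv_id.
  apply: has_derivN; apply: has_derivMl; exact: has_deriv_id.
by move: (expR _) (expR _) => a b; field.
Qed.

Lemma ch2_sqr t : ch2 t ^+ 2 = 1 + sh2 t ^+ 2.
Proof. exact: cosh_sqr. Qed.

End hyperbolic.

Section kernel1.
Variable R : realType.
Variables (alpha : R) (e : bool).
Hypothesis alpha_ge : - (1 / 2) <= alpha.
Implicit Types t x y : R.

Definition kexp t x y : R :=
  - (1 / 2) * (ch2 t / sh2 t) * (x ^+ 2 + y ^+ 2) + x * y / sh2 t - (alpha + 1) * ln (sh2 t).
Definition kexp_x t x y : R := - (ch2 t / sh2 t) * x + y / sh2 t.
Definition kexp_t t x y : R :=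
  (x ^+ 2 + y ^+ 2) / sh2 t ^+ 2 - 2 * ch2 t * (x * y) / sh2 t ^+ 2
  - (alpha + 1) * (2 * ch2 t / sh2 t).
Definition kexp_tx t x y : R :=
  2 * x / sh2 t ^+ 2 - 2 * ch2 t * y / sh2 t ^+ 2.
Definition karg t x y : R := x * y / sh2 t.
Definition karg_t t x y : R := - 2 * ch2 t * (x * y) / sh2 t ^+ 2.
Definition karg_tx t y : R := - 2 * ch2 t * y / sh2 t ^+ 2.

Let ph k t x y := prof k alpha e (karg t x y).

(* The one-dimensional factor of [Gker]. The growth [e^z] of [I_nu(z)], which [prof]
   divides out, is the term [x * y / sh2 t] of [kexp]. *)
Definition kern t x y : R := 1 / 2 * expR (kexp t x y) * ph 0 t x y.
Definition kern_x t x y : R := 1 / 2 * expR (kexp t x y) *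
  (kexp_x t x y * ph 0 t x y + y / sh2 t * ph 1 t x y).
Definition kern_t t x y : R := 1 / 2 * expR (kexp t x y) *
  (kexp_t t x y * ph 0 t x y + karg_t t x y * ph 1 t x y).
Definition kern_tx t x y : R := 1 / 2 * expR (kexp t x y) *
  (kexp_x t x y * (kexp_t t x y * ph 0 t x y + karg_t t x y * ph 1 t x y)
   + kexp_tx t x y * ph 0 t x y + kexp_t t x y * (y / sh2 t * ph 1 t x y)
   + karg_tx t y * ph 1 t x y + karg_t t x y * (y / sh2 t * ph 2 t x y)).

Lemma kernC t x y : kern t x y = kern t y x.
Proof. by rewrite /kern /kexp /ph /karg (mulrC x y) (addrC (x ^+ 2)). Qed.

Lemma has_deriv_kexp_x t x y : has_deriv (fun x => kexp t x y) x (kexp_x t x y).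
Proof.
rewrite /kexp; apply: has_deriv_eq.
  apply: has_derivB (has_deriv_cst _ _); apply: has_derivD.
    apply: has_derivMl; apply: has_derivD (has_deriv_cst _ _).
    apply: has_derivX; exact: has_deriv_id.
  apply: has_derivM (has_deriv_cst _ _); apply: has_derivM (has_deriv_cst _ _).
  exact: has_deriv_id.
rewrite /kexp_x /=; move: (ch2 t / sh2 t) (sh2 t)^-1 => a b; by field.
Qed.

Lemma has_deriv_karg_x t x y : has_deriv (fun x => karg t x y) x (y / sh2 t).
Proof.
rewrite /karg; apply: has_deriv_eq.
  apply: has_derivM (has_deriv_cst _ _); apply: has_derivM (has_deriv_cst _ _).
  exact: has_deriv_id.
by move: (sh2 t)^-1 => a; ring.
Qed.

Lemma has_deriv_ph0_x t x y : has_deriv (fun x => ph 0 t x y) x (ph 1 t x y * (y / sh2 t)).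
Proof. by apply: has_deriv_comp (has_deriv_karg_x t x y); exact: has_deriv_prof0. Qed.

Lemma has_deriv_ph1_x t x y : has_deriv (fun x => ph 1 t x y) x (ph 2 t x y * (y / sh2 t)).
Proof. by apply: has_deriv_comp (has_deriv_karg_x t x y); exact: has_deriv_prof1. Qed.

Lemma has_deriv_kern_x t x y : has_deriv (fun x => kern t x y) x (kern_x t x y).
Proof.
rewrite /kern; apply: has_deriv_eq.
  apply: has_derivM (has_deriv_ph0_x t x y).
  exact/has_derivMl/has_deriv_expR/has_deriv_kexp_x.
rewrite /kern_x.
move: (ph 0 _ _ _) (ph 1 _ _ _) (expR _) (sh2 t)^-1 (kexp_x _ _ _) => *; ring.
Qed.

Lemma has_deriv_kexp_tx t x y : has_deriv (fun x => kexp_t t x y) x (kexp_tx t x y).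
Proof.
rewrite /kexp_t; apply: has_deriv_eq.
  apply: has_derivB (has_deriv_cst _ _); apply: has_derivB.
    apply: has_derivM (has_deriv_cst _ _); apply: has_derivD (has_deriv_cst _ _).
    apply: has_derivX; exact: has_deriv_id.
  apply: has_derivM (has_deriv_cst _ _); apply: has_derivMl.
  apply: has_derivM (has_deriv_cst _ _); exact: has_deriv_id.
rewrite /kexp_tx /=; move: (ch2 t) (sh2 t ^+ 2)^-1 => a b; ring.
Qed.

Lemma has_deriv_karg_tx t x y : has_deriv (fun x => karg_t t x y) x (karg_tx t y).
Proof.
rewrite /karg_t; apply: has_deriv_eq.
  apply: has_derivM (has_deriv_cst _ _); apply: has_derivMl.
  apply: has_derivM (has_deriv_cst _ _); exact: has_deriv_id.
rewrite /karg_tx /=; move: (ch2 t) (sh2 t ^+ 2)^-1 => a b; ring.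
Qed.

Lemma has_deriv_kern_tx t x y : has_deriv (fun x => kern_t t x y) x (kern_tx t x y).
Proof.
rewrite /kern_t; apply: has_deriv_eq.
  apply: has_derivM.
    exact/has_derivMl/has_deriv_expR/has_deriv_kexp_x.
  apply: has_derivD.
    apply: has_derivM (has_deriv_ph0_x t x y); exact: has_deriv_kexp_tx.
  apply: has_derivM (has_deriv_ph1_x t x y); exact: has_deriv_karg_tx.
rewrite /kern_tx.
move: (ph 0 _ _ _) (ph 1 _ _ _) (ph 2 _ _ _) (expR _) (sh2 t)^-1.
move: (kexp_x _ _ _) (kexp_t _ _ _) (kexp_tx _ _ _) (karg_t _ _ _) (karg_tx _ _) => *; ring.
Qed.

Lemma has_deriv_kern_t t x y : 0 < t -> has_deriv (fun t => kern t x y) t (kern_t t x y).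
Proof.
move=> t0; have S0 := sh2_gt0 t0; have S1 : sh2 t != 0 by rewrite gt_eqF.
have dS := has_deriv_sh2 t; have dC := has_deriv_ch2 t.
have dSV := has_derivV S1 dS.
have dz : has_deriv (fun t => karg t x y) t (karg_t t x y).
  apply: has_deriv_eq; first exact: has_derivMl dSV.
  by rewrite /karg_t; move: (ch2 t) S1; move: (sh2 t) => a b a0; field.
have dB : has_deriv (fun t => kexp t x y) t (kexp_t t x y).
  apply: has_deriv_eq.
    apply: has_derivB; last exact/has_derivMl/(has_deriv_ln S0 dS).
    apply: has_derivD; last exact: has_derivMl dSV.
    apply: has_derivM (has_deriv_cst _ _); apply: has_derivMl; exact: has_derivM dC dSV.
  have := ch2_sqr t; rewrite /kexp_t; move: S1; move: (sh2 t) (ch2 t) => S C S1 CS.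
  have -> : - (1 / 2) * (2 * S * S^-1 + C * (- S ^- 2 * (2 * C))) = (C ^+ 2 - S ^+ 2) / S ^+ 2.
    by field.
  by rewrite CS; field.
apply: has_deriv_eq.
  apply: has_derivM.
    exact/has_derivMl/has_deriv_expR/dB.
  apply: (has_deriv_comp _ dz); exact: has_deriv_prof0.
rewrite /kern_t /ph.
move: (prof 0 _ _ _) (prof 1 _ _ _) (expR _) (kexp_t _ _ _) (karg_t _ _ _) => *; ring.
Qed.

Lemma diff_at_sh2 t : diff_at (@sh2 R) t.
Proof. by exists (2 * ch2 t); exact: has_deriv_sh2. Qed.

Lemma diff_at_ch2 t : diff_at (@ch2 R) t.
Proof. by exists (2 * sh2 t); exact: has_deriv_ch2. Qed.

Lemma diff_at_sh2V t : 0 < t -> diff_at (fun t => (sh2 t)^-1 : R) t.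
Proof.
by move=> t0; apply: diff_atV (diff_at_sh2 t); rewrite gt_eqF// sh2_gt0.
Qed.

Lemma diff_at_sh2V2 t : 0 < t -> diff_at (fun t => (sh2 t ^+ 2)^-1 : R) t.
Proof.
move=> t0; apply: diff_atV; last exact/diff_atX/diff_at_sh2.
by rewrite expf_neq0// gt_eqF// sh2_gt0.
Qed.

Lemma diff_at_kern t x y : 0 < t ->
  [/\ diff_at (fun t => kern t x y) t, diff_at (fun t => kern_x t x y) t,
      diff_at (fun t => kern_t t x y) t & diff_at (fun t => kern_tx t x y) t].
Proof.
move=> t0.
have sS := diff_at_sh2 t; have sC := diff_at_ch2 t.
have sV := diff_at_sh2V t0; have sV2 := diff_at_sh2V2 t0.
have c0 (c : R) := diff_at_cst c t.
have sln : diff_at (fun t => ln (sh2 t) : R) t by apply: diff_at_ln sS; exact: sh2_gt0.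
have sz : diff_at (fun t => karg t x y) t by exact: diff_atM.
have sp k : diff_at (fun t => ph k t x y) t.
  apply: (diff_at_comp _ sz) => z; exact: diff_at_prof.
have s_ : diff_at (fun t => ch2 t / sh2 t : R) t by exact: diff_atM.
have sB : diff_at (fun t => kexp t x y) t.
  apply: diff_atD; last exact/diff_atN/diff_atM.
  by apply: diff_atD; [do 2 apply: diff_atM => //|exact: diff_atM].
have sE : diff_at (fun t => 1 / 2 * expR (kexp t x y)) t.
  by apply: diff_atM => //; exact: diff_at_expR.
have sBx : diff_at (fun t => kexp_x t x y) t.
  by apply: diff_atD; [apply: diff_atM => //; exact: diff_atN|exact: diff_atM].
have s2 : diff_at (fun t => 2 * ch2 t : R) t by exact: diff_atM.
have sN2 : diff_at (fun t => - 2 * ch2 t : R) t by exact: diff_atM.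
have sBt : diff_at (fun t => kexp_t t x y) t.
  apply: diff_atD; last by apply/diff_atN/diff_atM => //; exact: diff_atM.
  apply: diff_atD; first exact: diff_atM.
  by apply/diff_atN/diff_atM => //; exact: diff_atM.
have sBtx : diff_at (fun t => kexp_tx t x y) t.
  apply: diff_atD; first exact: diff_atM.
  by apply/diff_atN/diff_atM => //; exact: diff_atM.
have szt : diff_at (fun t => karg_t t x y) t by apply: diff_atM => //; exact: diff_atM.
have sztx : diff_at (fun t => karg_tx t y) t by apply: diff_atM => //; exact: diff_atM.
have sy : diff_at (fun t => y / sh2 t) t by exact: diff_atM.
have syp k : diff_at (fun t => y / sh2 t * ph k t x y) t by exact: diff_atM.
have st : diff_at (fun t => kexp_t t x y * ph 0 t x y + karg_t t x y * ph 1 t x y) t.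
  by apply: diff_atD; exact: diff_atM.
split.
- exact: diff_atM.
- by apply: diff_atM => //; apply: diff_atD => //; exact: diff_atM.
- exact: diff_atM.
- apply: diff_atM => //; apply: diff_atD; last exact: diff_atM.
  apply: diff_atD; last exact: diff_atM.
  apply: diff_atD; last exact: diff_atM.
  by apply: diff_atD; exact: diff_atM.
Qed.

End kernel1.

Section abs_bounds.
Variable R : realDomainType.
Implicit Types a b A B : R.

Lemma absM_le a b A B : `|a| <= A -> `|b| <= B -> `|a * b| <= A * B.
Proof. by move=> aA bB; rewrite normrM ler_pM. Qed.

Lemma absD_le a b A B : `|a| <= A -> `|b| <= B -> `|a + b| <= A + B.
Proof. by move=> aA bB; apply: le_trans (ler_normD _ _) _; exact: lerD. Qed.

Lemma absB_le a b A B : `|a| <= A -> `|b| <= B -> `|a - b| <= A + B.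
Proof. by move=> aA bB; apply: le_trans (ler_normB _ _) _; exact: lerD. Qed.

Lemma sqr_le_abs a b : 0 <= b -> a ^+ 2 <= b ^+ 2 -> `|a| <= b.
Proof.
by move=> b0 ab; rewrite -(ler_pXn2r (ltn0Sn 1)) ?nnegrE// real_normK ?num_real.
Qed.

Lemma sqr_le_sqr a b : 0 <= b -> a ^+ 2 <= b ^+ 2 -> a <= b.
Proof. by move=> b0 /(sqr_le_abs b0); apply: le_trans; exact: ler_norm. Qed.

End abs_bounds.

(** * Pointwise bounds for the one-dimensional kernel and its derivatives *)

Section kernel1_bounds.
Variable R : realType.
Variables (alpha : R) (e : bool).
Hypothesis alpha_ge : - (1 / 2) <= alpha.
Implicit Types t x y Q : R.

Let beta := alpha + 1 / 2.

Definition maj t x y : R := expR (kexp alpha t x y) * (1 + karg t x y) `^ (- beta).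

Section fixed_point.
Variables (t x y p : R).
Hypotheses (t0 : 0 < t) (x0 : 0 < x) (y0 : 0 < y).
Let T := tnh t.
(** [p] is any upper bound, so the single [1 + Qf t x y] of dimension [d] serves all coordinates.
    Since [p >= 1], square roots are dropped: [|x - y| <= v p] and [v x, v y <= p], with
    [v = sqrt tau] and [u = 1 / v] below. *)
Hypothesis Qp : (x - y) ^+ 2 / T + T * (x ^+ 2 + y ^+ 2) + 1 <= p.
Let v := Num.sqrt T.
Let x0' : 0 <= x. Proof. exact: ltW. Qed.
Let y0' : 0 <= y. Proof. exact: ltW. Qed.
Let S := sh2 t.
Let w := (1 + karg t x y) `^ (- beta).

Let T0 : 0 < T. Proof. exact: tnh_gt0. Qed.
Let T0' : 0 <= T. Proof. exact: ltW. Qed.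
Let T1 : T < 1. Proof. exact: tnh_lt1. Qed.
Let v0 : 0 < v. Proof. by rewrite sqrtr_gt0. Qed.
Let v0' : 0 <= v. Proof. exact: ltW. Qed.
Let vv : v ^+ 2 = T. Proof. by rewrite sqr_sqrtr// ltW. Qed.
Let v1 : v <= 1.
Proof. by apply: sqr_le_sqr => //; rewrite vv expr1n ltW. Qed.
Let T2 : 0 < 1 - T ^+ 2. Proof. by rewrite subr_gt0 expr_lt1// ltW. Qed.
Let T2' : T ^+ 2 <= 1. Proof. by rewrite -subr_ge0 ltW. Qed.
Let SE : S = 2 * T / (1 - T ^+ 2). Proof. exact: sh2_tnh. Qed.
Let S0 : 0 < S. Proof. exact: sh2_gt0. Qed.
Let S0' : 0 <= S. Proof. exact: ltW. Qed.
Let S1 : S != 0. Proof. by rewrite gt_eqF. Qed.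
Let SV0 : 0 <= S^-1. Proof. by rewrite invr_ge0. Qed.
Let T2w : 0 <= 1 - T ^+ 2. Proof. exact: ltW. Qed.
Let TN : T != 0. Proof. by rewrite gt_eqF. Qed.
Let T2N : 1 - T ^+ 2 != 0. Proof. by rewrite gt_eqF. Qed.
Let S2T : 2 * T <= S.
Proof.
rewrite SE ler_pdivlMr// ler_piMr//; first by rewrite mulr_ge0.
by rewrite gerBl sqr_ge0.
Qed.
Let r_ge0 : 0 <= (x - y) ^+ 2 / T. Proof. by rewrite divr_ge0 ?sqr_ge0// ltW. Qed.
Let xx_ge0 : 0 <= T * x ^+ 2. Proof. by rewrite mulr_ge0 ?sqr_ge0// ltW. Qed.
Let yy_ge0 : 0 <= T * y ^+ 2. Proof. by rewrite mulr_ge0 ?sqr_ge0// ltW. Qed.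
Let Qp' : (x - y) ^+ 2 / T + T * x ^+ 2 + T * y ^+ 2 + 1 <= p.
Proof. by have := Qp; rewrite mulrDr addrA. Qed.
Let p1 : 1 <= p. Proof. by have := Qp'; have := r_ge0; have := xx_ge0; have := yy_ge0; lra. Qed.
Let p0 : 0 < p. Proof. by have := p1; lra. Qed.
Let p0' : 0 <= p. Proof. exact: ltW. Qed.
Let pp : p <= p ^+ 2. Proof. by rewrite expr2 ler_peMl ?(ltW p0). Qed.

Let rp2 : (x - y) ^+ 2 <= T * p.
Proof. by rewrite mulrC -ler_pdivrMr//; have := Qp'; have := xx_ge0; have := yy_ge0; lra. Qed.
Let rp : `|x - y| <= v * p.
Proof.
apply: sqr_le_abs; first by rewrite mulr_ge0 ?ltW.
by rewrite exprMn vv; apply: (le_trans rp2); rewrite ler_pM2l.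
Qed.
Let yp : v * y <= p.
Proof.
apply: sqr_le_sqr; first exact: ltW.
by rewrite exprMn vv (le_trans _ pp)//; have := Qp'; have := r_ge0; have := xx_ge0; have := yy_ge0; lra.
Qed.
Let xp : v * x <= p.
Proof.
apply: sqr_le_sqr; first exact: ltW.
by rewrite exprMn vv (le_trans _ pp)//; have := Qp'; have := r_ge0; have := xx_ge0; have := yy_ge0; lra.
Qed.
Let u := v^-1.
Let u1 : 1 <= u. Proof. by rewrite /u invf_ge1//. Qed.
Let u0 : 0 < u. Proof. by rewrite invr_gt0. Qed.
Let u0' : 0 <= u. Proof. exact: ltW. Qed.
Let vu : v * u = 1. Proof. by rewrite /u mulfV// gt_eqF. Qed.
Let TV : T^-1 = u ^+ 2. Proof. by rewrite -vv exprVn. Qed.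
Let yu : y <= p * u.
Proof. by rewrite -ler_pdivrMr// invrK mulrC. Qed.

Let SV : S^-1 = (1 - T ^+ 2) / (2 * T).
Proof. by rewrite SE invf_div. Qed.
Let SVle : S^-1 <= u ^+ 2 / 2.
Proof.
rewrite -TV -invfM mulrC; move: S2T T0 S0; move: S T => s a sa a0 s0.
by rewrite lef_pV2// posrE mulr_gt0.
Qed.
Let CS : ch2 t / S = (1 + T ^+ 2) / (2 * T).
Proof.
rewrite SE ch2_tnh -/T; have h1 : 1 - T ^+ 2 != 0 by rewrite gt_eqF.
have h2 : T != 0 by rewrite gt_eqF.
by field; rewrite h1 h2.
Qed.
Let CSle : `|ch2 t / S| <= u ^+ 2.
Proof.
have h : 0 <= (1 + T ^+ 2) / (2 * T).
  by apply: divr_ge0; [rewrite addr_ge0// sqr_ge0|rewrite mulr_ge0].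
rewrite CS ger0_norm// ler_pdivrMr; last exact: mulr_gt0.
by rewrite -TV mulrCA mulVf//; have := T2'; lra.
Qed.

Let ku : 0 <= u ^+ 2. Proof. exact: sqr_ge0. Qed.

Lemma kexp_x_le : `|kexp_x t x y| <= 2 * p * u.
Proof.
(* [(ch2 t - 1) / sh2 t = tanh t]: the singular factor [1 / S] now multiplies only [x - y], which is
   at most [v p]. *)
have -> : kexp_x t x y = - ((x - y) / S + T * x).
  rewrite /kexp_x -/S CS; have h2 : T != 0 by rewrite gt_eqF.
  by rewrite mulrBl SV; field.
rewrite normrN; have -> : 2 * p * u = p * u + p * u by ring.
apply: absD_le.
  apply: le_trans (_ : v * p * (u ^+ 2 / 2) <= _).
    by apply: absM_le; [exact: rp|rewrite ger0_norm].
  have -> : v * p * (u ^+ 2 / 2) = (v * u) * (p * u / 2) by ring.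
  by rewrite vu; have := mulr_gt0 p0 u0; lra.
rewrite ger0_norm; last by rewrite mulr_ge0.
rewrite -vv expr2 -mulrA (@le_trans _ _ (1 * p))//; last by rewrite mul1r ler_peMr// ltW.
by apply: ler_pM => //; rewrite ?mulr_ge0.
Qed.

Let ch2m1 : 2 * (ch2 t - 1) / S ^+ 2 = 1 - T ^+ 2.
Proof.
rewrite -exprVn SV ch2_tnh -/T; have h1 : 1 - T ^+ 2 != 0 by rewrite gt_eqF.
have h2 : T != 0 by rewrite gt_eqF.
by field; rewrite h1 h2.
Qed.

Let S2V : `|S ^- 2| <= u ^+ 4 / 4.
Proof.
have -> : u ^+ 4 / 4 = (u ^+ 2 / 2) * (u ^+ 2 / 2) by field.
by rewrite -exprVn expr2; apply: absM_le; rewrite ger0_norm.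
Qed.

Lemma kexp_t_le : `|kexp_t alpha t x y| <= (2 + 2 * (alpha + 1)) * (p * u ^+ 2).
Proof.
(* The same regrouping: [x^2 + y^2 - 2 C x y = (x - y)^2 - 2 (C - 1) x y], and [ch2m1] evaluates
   [2 (C - 1) / S^2]. *)
have -> : kexp_t alpha t x y = (x - y) ^+ 2 * S ^- 2 - (1 - T ^+ 2) * (x * y)
   - 2 * (alpha + 1) * (ch2 t / S).
  rewrite /kexp_t -/S -ch2m1; move: (ch2 t) => c; field; exact: S1.
have ppu : u ^+ 2 <= p * u ^+ 2 by rewrite ler_peMl.
have a1 : 0 <= alpha + 1 by have := alpha_ge; lra.
have -> : (2 + 2 * (alpha + 1)) * (p * u ^+ 2) = p * u ^+ 2 + p * u ^+ 2
  + 2 * (alpha + 1) * (p * u ^+ 2) by ring.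
apply: absB_le; last first.
  apply: absM_le; last exact: le_trans ppu.
  by rewrite ger0_norm// mulr_ge0.
apply: absB_le.
  apply: le_trans (_ : (T * p) * (u ^+ 4 / 4) <= _).
    by apply: absM_le => //; rewrite ger0_norm ?sqr_ge0.
  rewrite -vv; have -> : v ^+ 2 * p * (u ^+ 4 / 4) = (v * u) ^+ 2 * (p * u ^+ 2) / 4 by field.
  by rewrite vu expr1n mul1r; have := mulr_ge0 (ltW p0) ku; lra.
rewrite ger0_norm; last by rewrite !mulr_ge0.
rewrite (@le_trans _ _ (1 * (x * y)))//.
  by rewrite ler_wpM2r ?mulr_ge0 ?ltW// ltrBlDr ltrDl exprn_gt0.
rewrite mul1r -TV ler_pdivlMr// mulrC.
have := sqr_ge0 (x - y).
have -> : (x - y) ^+ 2 = x ^+ 2 + y ^+ 2 - 2 * (x * y) by ring.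
move=> h; have := mulr_ge0 T0' h; rewrite mulrBr mulrDr => h'.
have h2 : T * (2 * (x * y)) = 2 * (T * (x * y)) by ring.
have := Qp'; have := r_ge0; have := xx_ge0; have := yy_ge0; move: h'; rewrite h2.
by have := mulr_ge0 T0' (mulr_ge0 x0' y0'); lra.
Qed.

Lemma kexp_tx_le : `|kexp_tx t x y| <= 2 * (p * u ^+ 3).
Proof.
have -> : kexp_tx t x y = 2 * (x - y) * S ^- 2 - (1 - T ^+ 2) * y.
  rewrite /kexp_tx -/S -ch2m1; move: (ch2 t) => c; field; exact: S1.
have -> : 2 * (p * u ^+ 3) = p * u ^+ 3 + p * u ^+ 3 by ring.
apply: absB_le.
  apply: le_trans (_ : (2 * (v * p)) * (u ^+ 4 / 4) <= _).
    apply: absM_le; last exact: S2V.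
    by apply: absM_le => //; rewrite ger0_norm.
  have -> : 2 * (v * p) * (u ^+ 4 / 4) = (v * u) * (p * u ^+ 3) / 2 by field.
  have h : 0 <= p * u ^+ 3 by rewrite mulr_ge0// exprn_ge0.
  by rewrite vu mul1r; lra.
rewrite ger0_norm; last by rewrite !mulr_ge0.
rewrite (@le_trans _ _ (1 * y))//.
  by rewrite ler_wpM2r ?mulr_ge0 ?ltW// ltrBlDr ltrDl exprn_gt0.
rewrite mul1r (le_trans yu)// ler_pM2l// exprS ler_peMr//.
by rewrite exprn_ege1.
Qed.

(** If [y^2] is not controlled by [x y], then it is controlled by [(x - y)^2 <= tau p]. The factor
    [2 / (1 - tau^2) = 2 cosh^2 t] is kept because it later supplies the exponential decay in
    [t]. *)
Lemma tnh_xy_le_cosh : 2 / (1 - T ^+ 2) * (T + y ^+ 2) <= 4 * p * (S + x * y).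
Proof.
have xy0 : 0 < x * y by rewrite mulr_gt0.
have xy0' := ltW xy0.
have key : T + y ^+ 2 <= 4 * (T + x * y * (1 - T ^+ 2) / 2) * p.
  have h : (T + x * y * (1 - T ^+ 2) / 2) * p >=
     T + (x - y) ^+ 2 + T ^+ 2 * y ^+ 2 + x * y * (1 - T ^+ 2) / 2.
    rewrite mulrDl; apply: lerD; last by rewrite ler_peMr// divr_ge0// mulr_ge0.
    apply: le_trans (_ : T * ((x - y) ^+ 2 / T + T * y ^+ 2 + 1) <= _).
      have -> : T * ((x - y) ^+ 2 / T + T * y ^+ 2 + 1) =
        T + (x - y) ^+ 2 + T ^+ 2 * y ^+ 2 by move: T TN => a a0; field.
      by [].
    by rewrite ler_pM2l//; have := Qp'; have := xx_ge0; lra.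
  have h2 : y ^+ 2 <= 2 * (x * y) + (x - y) ^+ 2.
    have -> : (x - y) ^+ 2 = x ^+ 2 - 2 * (x * y) + y ^+ 2 by ring.
    by have := sqr_ge0 x; lra.
  have h3 := ler_wpM2l (ltW T2) h2.
  have h4 : 0 <= T ^+ 2 * (x - y) ^+ 2 by rewrite mulr_ge0 ?sqr_ge0.
  have h5 : 0 <= T ^+ 2 * y ^+ 2 by rewrite mulr_ge0 ?sqr_ge0.
  rewrite -mulrA; move: h h3 h4 h5 (sqr_ge0 (x - y)).
  by move: (T ^+ 2) (y ^+ 2) ((x - y) ^+ 2) (x * y) (_ * p) T0 => *; nra.
have SS : S + x * y = 2 / (1 - T ^+ 2) * (T + x * y * (1 - T ^+ 2) / 2).
  by rewrite SE; have h1 : 1 - T ^+ 2 != 0 by [rewrite gt_eqF]; field.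
rewrite SS; move: key; set Z := T + x * y * (1 - T ^+ 2) / 2 => key.
have -> : 4 * p * (2 / (1 - T ^+ 2) * Z) = 2 / (1 - T ^+ 2) * (4 * Z * p) by ring.
by rewrite ler_wpM2l// divr_ge0.
Qed.

Lemma tnh_xy_le : T + y ^+ 2 <= 2 * p * (S + x * y).
Proof.
have h : 2 * (T + y ^+ 2) <= 4 * p * (S + x * y).
  apply: le_trans tnh_xy_le_cosh; apply: ler_wpM2r; first by rewrite addr_ge0// sqr_ge0.
  by rewrite ler_pdivlMr//; have := sqr_ge0 T; lra.
by lra.
Qed.

Let Sxy : 0 < S + x * y. Proof. by rewrite addr_gt0// mulr_gt0. Qed.
Let kargE : 1 + karg t x y = (S + x * y) / S.
Proof. by rewrite /karg mulrDl mulfV// gt_eqF. Qed.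
Let karg0 : 0 <= karg t x y.
Proof. by rewrite /karg divr_ge0// mulr_ge0. Qed.
Let z1 : 0 < 1 + karg t x y. Proof. by have := karg0; lra. Qed.
Let w0 : 0 <= w. Proof. exact: powR_ge0. Qed.

(** The left side is [y / (S + x y)]; [2 v y <= tau + y^2] and [tnh_xy_le] bound it. This is where
    the extra decay of the derivatives of the profile offsets [y / S]. *)
Lemma yS_le : y / S / (1 + karg t x y) <= p * u.
Proof.
have h1 : S + x * y != 0 by rewrite gt_eqF.
have -> : y / S / (1 + karg t x y) = y / (S + x * y).
  by rewrite kargE; move: S1 h1; move: S => s s1 h1; field; rewrite h1 s1.
rewrite ler_pdivrMr//.
have h : 2 * v * y <= T + y ^+ 2.
  rewrite -vv; have := sqr_ge0 (v - y).
  have -> : (v - y) ^+ 2 = v ^+ 2 + y ^+ 2 - 2 * v * y by ring.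
  by lra.
have := le_trans h tnh_xy_le => h2.
rewrite -(ler_pM2l v0) mulrA mulrCA vu mulr1; lra.
Qed.

Variable C : R.
Hypothesis C0 : 0 < C.
Let C0' : 0 <= C. Proof. exact: ltW. Qed.
Hypothesis phC : forall k, (k <= 2)%N -> forall z, 0 <= z ->
    `|prof k alpha e z| <= C * (1 + z) `^ (- (beta + k%:R)).

Let wS c : (1 + karg t x y) `^ (- (c + 1)) = (1 + karg t x y) `^ (- c) / (1 + karg t x y).
Proof. by rewrite opprD gt0_powRD// powR_inv1// ltW. Qed.

Let ph0 : `|prof 0 alpha e (karg t x y)| <= C * w.
Proof. by have := @phC 0%N isT _ karg0; rewrite addr0. Qed.
Let ph1 : `|prof 1 alpha e (karg t x y)| <= C * w / (1 + karg t x y).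
Proof. by have := @phC 1%N isT _ karg0; rewrite wS mulrA. Qed.
Let ph2 : `|prof 2 alpha e (karg t x y)| <= C * w / (1 + karg t x y) / (1 + karg t x y).
Proof.
have := @phC 2 isT _ karg0; have -> : beta + 2 = beta + 1 + 1 by ring.
by rewrite !wS !mulrA.
Qed.
Let Cw0 : 0 <= C * w. Proof. by rewrite mulr_ge0. Qed.
Let puu : 0 <= p * u. Proof. by rewrite mulr_ge0. Qed.

Lemma yph1_le : `|y / S * prof 1 alpha e (karg t x y)| <= C * w * (p * u).
Proof.
apply: le_trans (_ : y / S * (C * w / (1 + karg t x y)) <= _).
  by apply: absM_le => //; rewrite ger0_norm// divr_ge0.
have -> : y / S * (C * w / (1 + karg t x y)) = C * w * (y / S / (1 + karg t x y)) by ring.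
by apply: ler_wpM2l => //; exact: yS_le.
Qed.

Let zdiv : karg t x y / (1 + karg t x y) <= 1.
Proof. by rewrite ler_pdivrMr// mul1r; lra. Qed.

Let ktE : karg_t t x y = - 2 * (ch2 t / S) * karg t x y.
Proof. by rewrite /karg_t /karg -/S; have h : S != 0 by [rewrite gt_eqF]; field. Qed.

(** The logarithmic derivative of [z] in [t] is [-2 coth 2t], and [z / (1 + z) <= 1] removes the
    remaining [z]. *)
Lemma ktph1_le : `|karg_t t x y * prof 1 alpha e (karg t x y)| <= C * w * (2 * u ^+ 2).
Proof.
rewrite ktE.
apply: le_trans (_ : (2 * u ^+ 2 * karg t x y) * (C * w / (1 + karg t x y)) <= _).
  apply: absM_le; last exact: ph1.
  apply: absM_le; last by rewrite ger0_norm.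
  by apply: absM_le; [rewrite normrN ger0_norm|exact: CSle].
have -> : 2 * u ^+ 2 * karg t x y * (C * w / (1 + karg t x y)) =
   C * w * (2 * u ^+ 2) * (karg t x y / (1 + karg t x y)) by ring.
by apply: ler_piMr; [rewrite mulr_ge0// mulr_ge0|exact: zdiv].
Qed.

Lemma ktxph1_le : `|karg_tx t y * prof 1 alpha e (karg t x y)| <= C * w * (2 * p * u ^+ 3).
Proof.
have -> : karg_tx t y = - 2 * (ch2 t / S) * (y / S).
  by rewrite /karg_tx -/S; have h : S != 0 by [rewrite gt_eqF]; field.
rewrite -[X in `|X|]mulrA.
have -> : C * w * (2 * p * u ^+ 3) = 2 * u ^+ 2 * (C * w * (p * u)) by ring.
apply: absM_le; last exact: yph1_le.
by apply: absM_le; [rewrite normrN ger0_norm|exact: CSle].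
Qed.

Lemma ktyph2_le : `|karg_t t x y * (y / S * prof 2 alpha e (karg t x y))| <=
  C * w * (2 * p * u ^+ 3).
Proof.
rewrite ktE.
apply: le_trans (_ : (2 * u ^+ 2 * karg t x y) *
    (y / S * (C * w / (1 + karg t x y) / (1 + karg t x y))) <= _).
  apply: absM_le => //.
    apply: absM_le; last by rewrite ger0_norm.
    by apply: absM_le; [rewrite normrN ger0_norm|exact: CSle].
  by apply: absM_le; [rewrite ger0_norm// divr_ge0|exact: ph2].
have -> : 2 * u ^+ 2 * karg t x y * (y / S * (C * w / (1 + karg t x y) / (1 + karg t x y))) =
   C * w * (2 * u ^+ 2) * ((karg t x y / (1 + karg t x y)) * (y / S / (1 + karg t x y))) by ring.
have -> : C * w * (2 * p * u ^+ 3) = C * w * (2 * u ^+ 2) * (1 * (p * u)) by ring.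
apply: ler_wpM2l; first by rewrite mulr_ge0// mulr_ge0.
have z1' := ltW z1.
apply: ler_pM => //.
- by rewrite divr_ge0.
- by rewrite divr_ge0// divr_ge0.
- exact: yS_le.
Qed.

Let E0 : 0 <= expR (kexp alpha t x y). Proof. exact: expR_ge0. Qed.
Let half a b : `|a| <= b -> `|1 / 2 * expR (kexp alpha t x y) * a| <= expR (kexp alpha t x y) * b.
Proof.
move=> ab; apply: absM_le => //; rewrite ger0_norm; last by rewrite mulr_ge0.
by have := E0; lra.
Qed.

Lemma kern_le : `|kern alpha e t x y| <= C * maj t x y.
Proof. by rewrite /maj mulrCA; apply: half; exact: ph0. Qed.

Lemma kern_x_le : `|kern_x alpha e t x y| <= 3 * C * maj t x y * (p * u).
Proof.
have -> : 3 * C * maj t x y * (p * u) =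
  expR (kexp alpha t x y) * ((2 * p * u) * (C * w) + C * w * (p * u)) by rewrite /maj -/w; ring.
apply: half; apply: absD_le; last exact: yph1_le.
exact: absM_le kexp_x_le ph0.
Qed.

Let st : `|kexp_t alpha t x y * prof 0 alpha e (karg t x y)
   + karg_t t x y * prof 1 alpha e (karg t x y)| <=
  (4 + 2 * (alpha + 1)) * (C * w) * (p * u ^+ 2).
Proof.
apply: le_trans (_ : (2 + 2 * (alpha + 1)) * (p * u ^+ 2) * (C * w) + C * w * (2 * u ^+ 2) <= _).
  apply: absD_le; last exact: ktph1_le.
  exact: absM_le kexp_t_le ph0.
have : u ^+ 2 <= p * u ^+ 2 by rewrite ler_peMl.
by move/(ler_wpM2l Cw0); move: (C * w) (u ^+ 2) => cw uu; lra.
Qed.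

Lemma kern_t_le : `|kern_t alpha e t x y| <=
  (4 + 2 * (alpha + 1)) * C * maj t x y * (p * u ^+ 2).
Proof.
have -> : (4 + 2 * (alpha + 1)) * C * maj t x y * (p * u ^+ 2) =
  expR (kexp alpha t x y) * ((4 + 2 * (alpha + 1)) * (C * w) * (p * u ^+ 2)).
  by rewrite /maj -/w; ring.
exact/half/st.
Qed.

Lemma kern_tx_le : `|kern_tx alpha e t x y| <=
  (16 + 6 * (alpha + 1)) * C * maj t x y * (p * u) * (p * u ^+ 2).
Proof.
have -> : (16 + 6 * (alpha + 1)) * C * maj t x y * (p * u) * (p * u ^+ 2) =
  expR (kexp alpha t x y) * ((16 + 6 * (alpha + 1)) * (C * w) * (p ^+ 2 * u ^+ 3)).
  by rewrite /maj -/w; ring.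
apply: half.
(* One summand per term of [kern_tx]. With [a = alpha + 1] their coefficients are [8 + 4a], [2],
   [2 + 2a], [2] and [2], whose sum is [16 + 6a]. *)
apply: le_trans (_ : (2 * p * u) * ((4 + 2 * (alpha + 1)) * (C * w) * (p * u ^+ 2))
  + 2 * (p * u ^+ 3) * (C * w) + (2 + 2 * (alpha + 1)) * (p * u ^+ 2) * (C * w * (p * u))
  + C * w * (2 * p * u ^+ 3) + C * w * (2 * p * u ^+ 3) <= _).
  apply: absD_le ktyph2_le; apply: absD_le ktxph1_le.
  apply: absD_le; last exact: absM_le kexp_t_le yph1_le.
  apply: absD_le; last exact: absM_le kexp_tx_le ph0.
  exact: absM_le kexp_x_le st.
have : p * u ^+ 3 <= p ^+ 2 * u ^+ 3 by rewrite ler_wpM2r// exprn_ge0.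
by move/(ler_wpM2l Cw0); move: (C * w) (u) => cw uu; lra.
Qed.

End fixed_point.

End kernel1_bounds.

Section majorant.
Variable R : realType.
Implicit Types (alpha t x y p r : R).

Definition gauss t x y : R :=
  - ((x - y) ^+ 2 / (2 * sh2 t)) - tnh t / 2 * (x ^+ 2 + y ^+ 2).

Lemma kexp_gauss alpha t x y : 0 < t ->
  kexp alpha t x y = gauss t x y - (alpha + 1) * ln (sh2 t).
Proof.
move=> t0; rewrite /kexp /gauss; congr (_ - _).
rewrite ch2_tnh sh2_tnh.
have T0 := tnh_gt0 t0; have T1 := tnh_lt1 t.
have h1 : 1 - tnh t ^+ 2 != 0 by rewrite gt_eqF// subr_gt0 expr_lt1// ltW.
have h2 : tnh t != 0 by rewrite gt_eqF.
by move: h1 h2; move: (tnh t) => a h1 h2; field; rewrite h1 h2.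
Qed.

Lemma powRN_le (a b c : R) : 0 < a -> a <= b -> 0 <= c -> b `^ (- c) <= a `^ (- c).
Proof.
move=> a0 ab c0; have b0 := lt_le_trans a0 ab.
rewrite !powRN lef_pV2 ?posrE ?powR_gt0//.
by apply: ge0_ler_powR; rewrite ?nnegrE// ltW.
Qed.

(** Here [1 + z = (S + x y) / S], so of the power [S^-(alpha+1)] only [S^(-1/2)] is left. The two
    powers match the factors [r] and [(r^2 + x^2)^(alpha + 1/2)] of [Vol]. *)
Lemma maj_sh2 alpha t x y : 0 < t -> 0 < x -> 0 < y ->
  maj alpha t x y = expR (gauss t x y) *
    (sh2 t `^ (- (1 / 2)) * (sh2 t + x * y) `^ (- (alpha + 1 / 2))).
Proof.
move=> t0 x0 y0; have S0 := sh2_gt0 t0.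
have Sxy : 0 < sh2 t + x * y by rewrite addr_gt0// mulr_gt0.
rewrite /maj kexp_gauss// expRD -mulrA; congr (_ * _).
have -> : 1 + karg t x y = (sh2 t + x * y) / sh2 t.
  by rewrite /karg mulrDl mulfV// gt_eqF.
rewrite -mulNr -powRE// powRM ?invr_ge0 ?ltW// mulrCA mulrC; congr (_ * _).
rewrite -[(sh2 t)^-1]powR_inv1 ?ltW// -powRrM mulN1r opprK -gt0_powRD//; congr (_ `^ _).
by field.
Qed.

(** [r] is not tied to [|x - y|]: in dimension [d] it is the full distance, common to all
    coordinates. Lower bounds for [S] and [S + x y] each carry [e^(2t)], and the exponents [1/2] and
    [alpha + 1/2] add up to [e^(-2t(alpha+1))]. *)
Lemma maj_le alpha t x y p r : - (1 / 2) <= alpha -> 0 < t -> 0 < x -> 0 < y -> 0 < r ->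
  (x - y) ^+ 2 / tnh t + tnh t * (x ^+ 2 + y ^+ 2) + 1 <= p ->
  r ^+ 2 / tnh t + 1 <= p ->
  maj alpha t x y <= 2 `^ (1 / 2) * 8 `^ (alpha + 1 / 2) *
    (expR (- (2 * t * (alpha + 1))) * expR (gauss t x y) *
     (r * (r ^+ 2 + x ^+ 2) `^ (alpha + 1 / 2))^-1 * (r * (Num.sqrt (tnh t))^-1) *
     p `^ (2 * (alpha + 1 / 2))).
Proof.
move=> a0 t0 x0 y0 r0 Qp rp; set b := alpha + 1 / 2.
have b0 : 0 <= b by rewrite /b; lra.
have T0 := tnh_gt0 t0; have T1 := tnh_lt1 t.
have T2 : 0 < 1 - tnh t ^+ 2 by rewrite subr_gt0 expr_lt1// ltW.
have S0 := sh2_gt0 t0.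
have xy0 : 0 < x * y by rewrite mulr_gt0.
have p0 : 0 < p.
  have : 0 <= r ^+ 2 / tnh t by rewrite divr_ge0 ?sqr_ge0// ltW.
  by lra.
have rx0 : 0 < r ^+ 2 + x ^+ 2 by rewrite addr_gt0// exprn_gt0.
have m_ge : expR (2 * t) / 2 <= 2 / (1 - tnh t ^+ 2).
  by rewrite onem_tnh_sqr invrK; have := cosh_sqr_ge t; lra.
have e0 := @expR_gt0 R (2 * t).
have S_ge : expR (2 * t) * (tnh t / 2) <= sh2 t.
  have -> : expR (2 * t) * (tnh t / 2) = expR (2 * t) / 2 * tnh t by ring.
  rewrite sh2_tnh; have -> : 2 * tnh t / (1 - tnh t ^+ 2) = 2 / (1 - tnh t ^+ 2) * tnh t by ring.
  by rewrite ler_pM2r.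
(* [tau (r^2/tau + 1) >= r^2], so a factor [p] turns the natural length [sqrt tau] into [r]. *)
have rx : r ^+ 2 + x ^+ 2 <= (tnh t + x ^+ 2) * p.
  apply: le_trans (_ : (tnh t + x ^+ 2) * (r ^+ 2 / tnh t + 1) <= _).
    have -> : (tnh t + x ^+ 2) * (r ^+ 2 / tnh t + 1) =
      r ^+ 2 + x ^+ 2 + tnh t + x ^+ 2 * (r ^+ 2 / tnh t).
      by have h2 : tnh t != 0 by [rewrite gt_eqF]; move: h2; move: (tnh t) => a h2; field.
    have : 0 <= x ^+ 2 * (r ^+ 2 / tnh t) by rewrite mulr_ge0 ?sqr_ge0// divr_ge0 ?sqr_ge0// ltW.
    by lra.
  by rewrite ler_pM2l// addr_gt0// exprn_gt0.
have Sxy_ge : expR (2 * t) * ((r ^+ 2 + x ^+ 2) / (8 * p ^+ 2)) <= sh2 t + x * y.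
  have Qp' : (y - x) ^+ 2 / tnh t + tnh t * (y ^+ 2 + x ^+ 2) + 1 <= p.
    by rewrite (addrC (y ^+ 2)) -[in X in X / _ + _ + _]sqrrN opprB.
  (* Applied with the two points exchanged, so that [x^2], the centre of the ball, appears instead
     of [y^2]. *)
  have h := tnh_xy_le_cosh t0 y0 x0 Qp'; rewrite (mulrC y x) in h.
  have h1 : expR (2 * t) / 2 * (tnh t + x ^+ 2) <= 4 * p * (sh2 t + x * y).
    by apply: le_trans h; rewrite ler_pM2r// addr_gt0// exprn_gt0.
  rewrite mulrA ler_pdivrMr; last by rewrite mulr_gt0// exprn_gt0.
  have h2 : expR (2 * t) * (r ^+ 2 + x ^+ 2) <= expR (2 * t) * ((tnh t + x ^+ 2) * p).
    by rewrite ler_pM2l.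
  apply: (le_trans h2).
  have -> : expR (2 * t) * ((tnh t + x ^+ 2) * p) =
    2 * p * (expR (2 * t) / 2 * (tnh t + x ^+ 2)) by field.
  have -> : (sh2 t + x * y) * (8 * p ^+ 2) = 2 * p * (4 * p * (sh2 t + x * y)) by ring.
  by rewrite ler_pM2l// mulr_gt0.
rewrite maj_sh2//; set g := expR (gauss t x y).
have half0 : 0 <= 1 / 2 :> R by lra.
have h1 : sh2 t `^ (- (1 / 2)) <= (expR (2 * t) * (tnh t / 2)) `^ (- (1 / 2)).
  by apply: powRN_le => //; rewrite mulr_gt0// divr_gt0.
have h2 : (sh2 t + x * y) `^ (- b) <= (expR (2 * t) * ((r ^+ 2 + x ^+ 2) / (8 * p ^+ 2))) `^ (- b).
  by apply: powRN_le => //; rewrite mulr_gt0// divr_gt0// mulr_gt0// exprn_gt0.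
apply: le_trans (_ : g * ((expR (2 * t) * (tnh t / 2)) `^ (- (1 / 2)) *
  (expR (2 * t) * ((r ^+ 2 + x ^+ 2) / (8 * p ^+ 2))) `^ (- b)) <= _).
  by rewrite ler_pM2l ?expR_gt0//; apply: ler_pM => //; exact: powR_ge0.
rewrite le_eqVlt; apply/orP; left; apply/eqP.
have pV (z c : R) : 0 < z -> (z^-1) `^ (- c) = z `^ c.
  by move=> z0; rewrite -[z^-1]powR_inv1 ?ltW// -powRrM mulrNN mul1r.
have pM (a1 a2 c : R) : 0 < a1 -> 0 < a2 -> (a1 * a2) `^ c = a1 `^ c * a2 `^ c.
  by move=> ? ?; rewrite powRM// ltW.
have p2 : 0 < p ^+ 2 by rewrite exprn_gt0.
have p8 : 0 < 8 * p ^+ 2 by rewrite mulr_gt0.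
have p8' : 0 < (8 * p ^+ 2)^-1 by rewrite invr_gt0.
rewrite (pM _ (tnh t / 2))//; last by rewrite divr_gt0.
rewrite (pM (tnh t))// (pM _ (_ / (8 * p ^+ 2)))//; last by rewrite divr_gt0.
rewrite (pM _ (8 * p ^+ 2)^-1)// !pV// (pM 8)//.
rewrite -(powR_mulrn 2 (ltW p0)) -powRrM.
rewrite -!expRM.
have -> : expR (- (2 * t * (alpha + 1))) = expR (2 * t * - (1 / 2)) * expR (2 * t * - b).
  by rewrite -expRD; congr expR; rewrite /b; field.
have -> : (Num.sqrt (tnh t))^-1 = tnh t `^ (- (1 / 2)).
  by rewrite powRN; congr (_^-1); rewrite -powR12_sqrt ?ltW//; congr (_ `^ _); field.
have r1 : r != 0 by rewrite gt_eqF.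
rewrite invfM powRN.
have : (r ^+ 2 + x ^+ 2) `^ b != 0 by rewrite gt_eqF// powR_gt0.
move: ((r ^+ 2 + x ^+ 2) `^ b) r1 => X r1 X1.
move: (_ `^ _) (_ `^ _) (_ `^ _) (_ `^ _) (expR _) (expR _) => *.
by field; rewrite X1 r1.
Qed.

End majorant.

(** * The heat kernel in dimension d *)

Section product_rule.
Variables (R : realType) (I : Type).
Implicit Types (s : seq I) (g : I -> R).

Fixpoint dprod s (g g' : I -> R) : R := match s with
  | [::] => 0
  | i :: s' => g' i * (\prod_(j <- s') g j) + g i * dprod s' g g'
  end.

Lemma has_deriv_prod s (g g' : I -> R -> R) t :
  (forall i, has_deriv (g i) t (g' i t)) ->
  has_deriv (fun t => \prod_(i <- s) g i t) t (dprod s (g ^~ t) (g' ^~ t)).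
Proof.
move=> dg; elim: s => [|i s IH] /=.
  rewrite (_ : (fun _ => _) = (fun=> 1)); first exact: has_deriv_cst.
  by apply/funext => u; rewrite big_nil.
rewrite (_ : (fun _ => _) = (fun u => g i u * \prod_(i <- s) g i u)).
  exact: has_derivM.
by apply/funext => u; rewrite big_cons.
Qed.

Lemma diff_at_prod s (g : I -> R -> R) t :
  (forall i, diff_at (g i) t) -> diff_at (fun t => \prod_(i <- s) g i t) t.
Proof.
move=> sg; elim: s => [|i s IH] /=.
  rewrite (_ : (fun _ => _) = (fun=> 1)); first exact: diff_at_cst.
  by apply/funext => u; rewrite big_nil.
rewrite (_ : (fun _ => _) = (fun u => g i u * \prod_(i <- s) g i u)).
  exact: diff_atM.
by apply/funext => u; rewrite big_cons.
Qed.

Lemma diff_at_dprod s (g g' : I -> R -> R) t :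
  (forall i, diff_at (g i) t) -> (forall i, diff_at (g' i) t) ->
  diff_at (fun t => dprod s (g ^~ t) (g' ^~ t)) t.
Proof.
move=> sg sg'; elim: s => [|i s IH] /=; first exact: diff_at_cst.
by apply: diff_atD; apply: diff_atM => //; exact: diff_at_prod.
Qed.

Lemma abs_prod_le s g (m : I -> R) : (forall i, `|g i| <= m i) ->
  `|\prod_(i <- s) g i| <= \prod_(i <- s) m i.
Proof.
move=> gm; elim: s => [|i s IH]; first by rewrite !big_nil normr1.
by rewrite !big_cons; exact: absM_le.
Qed.

Lemma abs_dprod_le s (g g' m : I -> R) (T : R) : 0 <= T ->
  (forall i, `|g i| <= m i) -> (forall i, `|g' i| <= m i * T) ->
  `|dprod s g g'| <= (size s)%:R * T * \prod_(i <- s) m i.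
Proof.
move=> T0 gm gm'; elim: s => [|i s IH] /=; first by rewrite normr0 !mul0r.
rewrite big_cons -natr1.
have -> : ((size s)%:R + 1) * T * (m i * \prod_(j <- s) m j) =
  m i * T * (\prod_(j <- s) m j) + m i * ((size s)%:R * T * \prod_(j <- s) m j) by ring.
apply: absD_le; apply: absM_le => //.
exact: abs_prod_le.
Qed.

End product_rule.

Section kernel_d.
Variables (R : realType) (d : nat) (alpha : 'I_d -> R) (eps : 'I_d -> bool).
Hypothesis alpha_ge : forall i, - (1 / 2) <= alpha i.
Implicit Types (x y : 'I_d -> R) (t a : R) (i j : 'I_d).

Let k i := kern (alpha i) (eps i).

Lemma Gker_prod t x y : 0 < t -> posR x -> posR y ->
  Gker alpha eps t x y = \prod_i k i t (x i) (y i).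
Proof.
move=> t0 x0 y0; have S0 := sh2_gt0 t0.
rewrite /Gker /sqnorm -big_split /= mulr_sumr expR_sum.
have -> : (2 * sinh (2 * t)) ^- d = \prod_(i < d) (2 * sh2 t)^-1.
  by rewrite prodr_const card_ord exprVn.
rewrite -!big_split /=; apply: eq_bigr => i _.
have xy0 : 0 < x i * y i by rewrite mulr_gt0.
rewrite -/(sh2 t) /coth -/(sh2 t) -/(ch2 t) BesselI_prof//; last by rewrite divr_gt0.
rewrite /k /kern /kexp -/(karg t (x i) (y i)).
set z := karg t (x i) (y i); set P := prof 0 _ _ _.
rewrite gt0_powRD//.
have -> : (x i * y i / sh2 t) `^ alpha i = (x i * y i) `^ alpha i * sh2 t `^ (- alpha i).
  rewrite powRM ?invr_ge0 ?ltW//; congr (_ * _).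
  by rewrite -powR_inv1 ?ltW// -powRrM mulN1r.
have -> : (x i * y i) `^ (eps i)%:R = (x i * y i) ^+ eps i.
  by rewrite powR_mulrn// ltW.
have El : expR (- ((alpha i + 1) * ln (sh2 t))) = sh2 t `^ (- alpha i) / sh2 t.
  by rewrite -mulNr -powRE// opprD gt0_powRD// powR_inv1// ltW.
rewrite !expRD El.
have e1 : (x i * y i) ^+ eps i != 0 by rewrite expf_neq0// gt_eqF.
have e2 : (x i * y i) `^ alpha i != 0 by rewrite gt_eqF// powR_gt0.
have e3 : sh2 t != 0 by rewrite gt_eqF.
move: e1 e2 e3; move: (sh2 t) (sh2 t `^ _) ((x i * y i) `^ alpha i) (_ ^+ eps i) (expR _) (expR _).
by move=> s c b a E1 E2 e1 e2 e3; field; rewrite e1 e2 e3.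
Qed.

Lemma update_pos x j a : posR x -> 0 < a -> posR (update x j a).
Proof. by move=> x0 a0 i; rewrite /update; case: ifP. Qed.

Definition rest j : seq 'I_d := [seq i <- index_enum 'I_d | i != j].

(* [Gker] at the point obtained from [x] by replacing its [j]-th coordinate with [a];
   the derivatives of this formula make sense without positivity of [a]. *)
Definition Gcoord j t a x y := k j t a (y j) * \prod_(i <- rest j) k i t (x i) (y i).
Definition Gcoord_x j t a x y := kern_x (alpha j) (eps j) t a (y j) *
  \prod_(i <- rest j) k i t (x i) (y i).
Definition rest_t j t x y := dprod (rest j) (fun i => k i t (x i) (y i))
  (fun i => kern_t (alpha i) (eps i) t (x i) (y i)).
Definition Gcoord_t j t a x y :=
  kern_t (alpha j) (eps j) t a (y j) * \prod_(i <- rest j) k i t (x i) (y i)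
  + k j t a (y j) * rest_t j t x y.
Definition Gcoord_tx j t a x y :=
  kern_tx (alpha j) (eps j) t a (y j) * \prod_(i <- rest j) k i t (x i) (y i)
  + kern_x (alpha j) (eps j) t a (y j) * rest_t j t x y.

Lemma Gker_update j t a x y : 0 < t -> posR x -> posR y -> 0 < a ->
  Gker alpha eps t (update x j a) y = Gcoord j t a x y.
Proof.
move=> t0 x0 y0 a0; rewrite Gker_prod//; last exact: update_pos.
rewrite (bigD1 j)//= /Gcoord /rest big_filter {1}/update eqxx; congr (_ * _).
by apply: eq_bigr => i /negbTE ij; rewrite /update ij.
Qed.

Lemma has_deriv_Gcoord_t j t a x y : 0 < t -> has_deriv (fun t => Gcoord j t a x y) t (Gcoord_t j t a x y).
Proof.
move=> t0; apply: has_derivM; first exact: has_deriv_kern_t.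
apply: (@has_deriv_prod R 'I_d (rest j) (fun i t => k i t (x i) (y i))
  (fun i t => kern_t (alpha i) (eps i) t (x i) (y i))) => i.
exact: has_deriv_kern_t.
Qed.

Lemma dtGker_update j t a x y : 0 < t -> posR x -> posR y -> 0 < a ->
  dtGker alpha eps t (update x j a) y = Gcoord_t j t a x y.
Proof.
move=> t0 x0 y0 a0; apply: has_derivE.
apply: near_has_deriv (has_deriv_Gcoord_t j a x y t0).
near=> s; rewrite Gker_update//; near: s; exact: near_gt0.
Unshelve. all: by end_near. Qed.

Lemma has_deriv_Gcoord_x j t a x y : has_deriv (fun a => Gcoord j t a x y) a (Gcoord_x j t a x y).
Proof.
apply: has_deriv_eq.
  by apply: has_derivM (has_deriv_cst _ _); exact: has_deriv_kern_x.
by rewrite mulr0 addr0.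
Qed.

Lemma has_deriv_Gcoord_tx j t a x y : has_deriv (fun a => Gcoord_t j t a x y) a (Gcoord_tx j t a x y).
Proof.
apply: has_deriv_eq.
  apply: has_derivD; apply: has_derivM (has_deriv_cst _ _).
    exact: has_deriv_kern_tx.
  exact: has_deriv_kern_x.
by rewrite !mulr0 !addr0.
Qed.

Lemma diff_at_Gcoord j t a x y : 0 < t ->
  [/\ diff_at (fun t => Gcoord j t a x y) t, diff_at (fun t => Gcoord_x j t a x y) t,
      diff_at (fun t => Gcoord_t j t a x y) t & diff_at (fun t => Gcoord_tx j t a x y) t].
Proof.
move=> t0.
have [s1 s2 s3 s4] := diff_at_kern (eps j) (alpha_ge j) a (y j) t0.
have sP : diff_at (fun t => \prod_(i <- rest j) k i t (x i) (y i)) t.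
  apply: (@diff_at_prod R 'I_d (rest j) (fun i t => k i t (x i) (y i))) => i.
  by have [] := diff_at_kern (eps i) (alpha_ge i) (x i) (y i) t0.
have sdP : diff_at (fun t => rest_t j t x y) t.
  apply: (@diff_at_dprod R 'I_d (rest j) (fun i t => k i t (x i) (y i))
    (fun i t => kern_t (alpha i) (eps i) t (x i) (y i))) => i.
    by have [] := diff_at_kern (eps i) (alpha_ge i) (x i) (y i) t0.
  by have [] := diff_at_kern (eps i) (alpha_ge i) (x i) (y i) t0.
split.
- exact: diff_atM.
- exact: diff_atM.
- by apply: diff_atD; exact: diff_atM.
- by apply: diff_atD; exact: diff_atM.
Qed.

(** This symmetry reduces every derivative in [y] to one in [x]. *)
Lemma GkerC t x y : 0 < t -> posR x -> posR y ->
  Gker alpha eps t x y = Gker alpha eps t y x.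
Proof. by move=> t0 x0 y0; rewrite !Gker_prod//; apply: eq_bigr => i _; exact: kernC. Qed.

Lemma dtGkerC t x y : 0 < t -> posR x -> posR y ->
  dtGker alpha eps t x y = dtGker alpha eps t y x.
Proof.
move=> t0 x0 y0; rewrite /dtGker !derive1E.
apply: near_eq_derive; near=> s; apply: GkerC => //.
near: s; exact: near_gt0.
Unshelve. all: by end_near. Qed.

End kernel_d.

Ltac nneg := repeat first
  [ assumption | exact: ltW | exact: sqr_ge0 | apply: mulr_ge0 | apply: addr_ge0
  | exact: powR_ge0 | exact: expR_ge0 | apply: exprn_ge0 | rewrite invr_ge0 | exact: sqrtr_ge0 ].

Section time_weight.
Variable R : realType.
Implicit Types (t r p l : R).

(** Write [r tau^(-3/2)] as [r / (sqrt tau (tau + r^2))] times [(tau + r^2) / tau <= p]. The first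
    factor is the weight with [tau] for [t]; going back to [t] costs [(1 + t)^2], absorbed by the
    exponential. *)
Lemma sqrt_tnh_time_weight l : 0 < l -> exists2 C, 0 < C & forall t r p, 0 < t -> 0 < r ->
  r ^+ 2 / tnh t + 1 <= p ->
  expR (- (t * l)) * (r * (Num.sqrt (tnh t))^-1 * (Num.sqrt (tnh t))^-1 ^+ 2) <= C * (p * time_weight r t).
Proof.
move=> l0; have [C C0 CP] := powR_expR_bounded (ler0n R 2) l0.
exists C => // t r p t0 r0 rp.
have T0 := tnh_gt0 t0; have Tt := tnh_lb t0.
set T := tnh t in rp T0 Tt *; set v := Num.sqrt T.
have v0 : 0 < v by rewrite sqrtr_gt0.
have vv : v ^+ 2 = T by rewrite sqr_sqrtr// ltW.
have t1 : 0 < 1 + t by lra.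
have r2 : 0 < r ^+ 2 by rewrite exprn_gt0.
have sq0 : 0 < Num.sqrt t by rewrite sqrtr_gt0.
have vt : Num.sqrt t <= v * (1 + t).
  apply: sqr_le_sqr; first by rewrite mulr_ge0// ltW.
  rewrite (sqr_sqrtr (ltW t0)) exprMn vv.
  move: Tt; rewrite ler_pdivrMr// => Tt.
  by rewrite expr2 mulrA; apply: (le_trans Tt); rewrite ler_peMr//; [nneg|lra].
have Tr : t + r ^+ 2 <= (T + r ^+ 2) * (1 + t).
  move: Tt; rewrite ler_pdivrMr// => Tt.
  by have := mulr_gt0 r2 t0; lra.
have e0 := expR_gt0 (- (t * l)).
have ex : expR (- (t * l)) * (1 + t) ^+ 2 <= C.
  have := CP t (ltW t0); rewrite (powR_mulrn 2) ?(mulrC l); last lra.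
  by move=> H; rewrite mulrC.
have D0 : 0 < v * (T + r ^+ 2) by rewrite mulr_gt0// addr_gt0.
have D1 : 0 < Num.sqrt t * (t + r ^+ 2) by rewrite mulr_gt0// addr_gt0.
have Trp : (T + r ^+ 2) * v^-1 ^+ 2 <= p.
  rewrite exprVn vv; have -> : (T + r ^+ 2) / T = r ^+ 2 / T + 1; last by [].
  by rewrite mulrDl mulfV ?gt_eqF// addrC.
have vi : 0 < v^-1 by rewrite invr_gt0.
apply: le_trans (_ : expR (- (t * l)) * (p * (r / (v * (T + r ^+ 2)))) <= _).
  rewrite ler_pM2l//.
  have -> : r * v^-1 * v^-1 ^+ 2 = (T + r ^+ 2) * v^-1 ^+ 2 * (r / (v * (T + r ^+ 2))).
    have h1 : T + r ^+ 2 != 0 by rewrite gt_eqF// addr_gt0.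
    have h2 : v != 0 by rewrite gt_eqF.
    by move: h1; move: (T + r ^+ 2) => a h1; field; rewrite h1 h2.
  by rewrite ler_wpM2r// ltW// divr_gt0.
have p0 : 0 < p.
  have : 0 < r ^+ 2 / T by rewrite divr_gt0.
  by lra.
rewrite mulrCA mulrC mulrA [leRHS]mulrCA [leRHS]mulrC; apply: ler_wpM2r; first exact: ltW.
rewrite mulrAC /time_weight mulrC; have -> : C * (r / (Num.sqrt t * (t + r ^+ 2))) =
  r * (C / (Num.sqrt t * (t + r ^+ 2))) by ring.
rewrite ler_pM2l// ler_pdivrMr// mulrAC ler_pdivlMr//.
apply: le_trans (_ : expR (- (t * l)) * ((v * (1 + t)) * ((T + r ^+ 2) * (1 + t))) <= _).
  by rewrite ler_pM2l//; apply: ler_pM => //; nneg.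
have -> : expR (- (t * l)) * (v * (1 + t) * ((T + r ^+ 2) * (1 + t))) =
  (expR (- (t * l)) * (1 + t) ^+ 2) * (v * (T + r ^+ 2)) by ring.
by rewrite ler_pM2r.
Qed.

End time_weight.

Section kernel_d_bounds.
Variables (R : realType) (d : nat) (alpha : 'I_d -> R) (eps : 'I_d -> bool).
Hypothesis alpha_ge : forall i, - (1 / 2) <= alpha i.
Implicit Types (x y : 'I_d -> R) (t a r p : R) (i j : 'I_d).

Let beta i := alpha i + 1 / 2.
Let beta0 i : 0 <= beta i. Proof. by rewrite /beta; have := alpha_ge i; lra. Qed.

(* Comparable to [wplus alpha (ballp x r)]; see [wplus_ball_Vol] for the bound that is used. *)
Definition Vol x r : R := \prod_i (r * (r ^+ 2 + x i ^+ 2) `^ (alpha i + 1 / 2)).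

Lemma Vol_gt0 x r : 0 < r -> 0 < Vol x r.
Proof.
move=> r0; apply: prodr_gt0 => i _; rewrite mulr_gt0// powR_gt0//.
by rewrite ltr_wpDr ?sqr_ge0// exprn_gt0.
Qed.

Definition Qf t x y : R :=
  dist x y ^+ 2 / tnh t + tnh t * (sqnorm x + sqnorm y).

Lemma dist_sqr x y : dist x y ^+ 2 = \sum_i (y i - x i) ^+ 2.
Proof.
rewrite /dist /enorm sqr_sqrtr//; apply: sumr_ge0 => i _; exact: sqr_ge0.
Qed.

Lemma sqnorm_ge x i : x i ^+ 2 <= sqnorm x.
Proof.
rewrite /sqnorm (bigD1 i)//= lerDl; apply: sumr_ge0 => j _; exact: sqr_ge0.
Qed.

Lemma sqnorm_ge0 x : 0 <= sqnorm x.
Proof. by apply: sumr_ge0 => j _; exact: sqr_ge0. Qed.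

Lemma dist_ge x y i : (x i - y i) ^+ 2 <= dist x y ^+ 2.
Proof.
by rewrite dist_sqr -sqrrN opprB (bigD1 i)//= lerDl; apply: sumr_ge0 => j _; exact: sqr_ge0.
Qed.

Lemma Qf_ge0 t x y : 0 < t -> 0 <= Qf t x y.
Proof.
move=> t0; have T0 := tnh_gt0 t0.
by have := sqnorm_ge0 x; have := sqnorm_ge0 y => ? ?; rewrite /Qf; nneg.
Qed.

Lemma sum_gauss_le t x y : 0 < t -> \sum_i gauss t (x i) (y i) <= - (8^-1 * Qf t x y).
Proof.
move=> t0; have T0 := tnh_gt0 t0; have T1 := tnh_lt1 t.
have -> : \sum_i gauss t (x i) (y i) =
  - (dist x y ^+ 2 / (2 * sh2 t)) - tnh t / 2 * (sqnorm x + sqnorm y).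
  rewrite /gauss big_split /= !sumrN dist_sqr mulr_suml /sqnorm -big_split mulr_sumr.
  by congr (- _ - _); apply: eq_bigr => i _; rewrite -sqrrN opprB.
have D : dist x y ^+ 2 <= 2 * (sqnorm x + sqnorm y).
  rewrite dist_sqr /sqnorm -big_split /= mulr_sumr; apply: ler_sum => i _.
  have := sqr_ge0 (x i + y i).
  have -> : (x i + y i) ^+ 2 = x i ^+ 2 + 2 * (x i * y i) + y i ^+ 2 by ring.
  have -> : (y i - x i) ^+ 2 = x i ^+ 2 - 2 * (x i * y i) + y i ^+ 2 by ring.
  by lra.
have D0 := sqr_ge0 (dist x y).
rewrite /Qf sh2_tnh; move: D D0; move: (dist x y ^+ 2) (sqnorm x + sqnorm y) => q S D D0.
have h1 : tnh t != 0 by rewrite gt_eqF.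
have T2 : 0 < 1 - tnh t ^+ 2 by rewrite subr_gt0 expr_lt1// ltW.
have h2 : 1 - tnh t ^+ 2 != 0 by rewrite gt_eqF.
have -> : q / (2 * (2 * tnh t / (1 - tnh t ^+ 2))) = (q / tnh t - tnh t * q) / 4.
  by move: h1 h2; move: (tnh t) => a h1 h2; field; rewrite h1 h2.
(* The positive term [tau q / 4] is split in two equal parts: one is at most [q / (8 tau)] by this
   inequality, the other at most [tau S / 4] by [D]. This leaves [-q / (8 tau) - tau S / 4], whence
   the rate [1/8]. *)
have h3 : tnh t * q <= q / tnh t.
  rewrite ler_pdivlMr// mulrAC -expr2 ler_piMl//.
  by rewrite ltW// -subr_gt0.
have h4 := ler_wpM2l (ltW T0) D.
have h5 : tnh t * (2 * S) = 2 * (tnh t * S) by ring.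
have h6 : tnh t / 2 * S = tnh t * S / 2 by ring.
have h7 : 0 <= tnh t * q by nneg.
rewrite h5 in h4; rewrite h6; lra.
Qed.

Definition cmaj (c : 'I_d -> R) t x y i : R := c i * maj (alpha i) t (x i) (y i).

Lemma prod_maj_le (c : 'I_d -> R) : (forall i, 0 < c i) ->
  exists2 K, 0 < K & exists2 N : R, 0 <= N &
  forall t x y, 0 < t -> posR x -> posR y -> 0 < dist x y ->
  \prod_i cmaj c t x y i <= K * (expR (- (t * lambda0 alpha)) * (Vol x (dist x y))^-1 *
    (dist x y * (Num.sqrt (tnh t))^-1) ^+ d * (1 + Qf t x y) `^ N
    * expR (- (8^-1 * Qf t x y))).
Proof.
move=> c0.
exists (\prod_i (c i * (2 `^ (1 / 2) * 8 `^ (alpha i + 1 / 2)))).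
  by apply: prodr_gt0 => i _; rewrite mulr_gt0// mulr_gt0 ?powR_gt0.
(* The total power of [p] produced by [maj_le] over all coordinates. *)
exists (\sum_i 2 * (alpha i + 1 / 2)).
  by apply: sumr_ge0 => i _; rewrite mulr_ge0// beta0.
move=> t x y t0 x0 y0 r0; set r := dist x y in r0 *.
have T0 := tnh_gt0 t0; have Q0 := Qf_ge0 x y t0.
have p0 : 0 < 1 + Qf t x y by lra.
have -> : expR (- (t * lambda0 alpha)) = \prod_i expR (- (2 * t * (alpha i + 1))).
  rewrite -expR_sum; congr expR; rewrite sumrN -mulr_sumr big_split /=.
  rewrite sumr_const card_ord /lambda0 -mulr_natr mul1r; congr (- _); ring.
have -> : (1 + Qf t x y) `^ (\sum_i 2 * (alpha i + 1 / 2)) =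
  \prod_i (1 + Qf t x y) `^ (2 * (alpha i + 1 / 2)).
  rewrite powRE// mulr_suml expR_sum; apply: eq_bigr => i _; by rewrite -powRE.
have -> : (r * (Num.sqrt (tnh t))^-1) ^+ d = \prod_(i < d) (r * (Num.sqrt (tnh t))^-1).
  by rewrite prodr_const card_ord.
apply: le_trans (_ : \prod_i (c i * (2 `^ (1 / 2) * 8 `^ (alpha i + 1 / 2))) *
  (\prod_i expR (- (2 * t * (alpha i + 1))) * (Vol x r)^-1 *
   \prod_(i < d) (r / Num.sqrt (tnh t)) *
   \prod_i (1 + Qf t x y) `^ (2 * (alpha i + 1 / 2)) *
    \prod_i expR (gauss t (x i) (y i))) <= _).
  rewrite /Vol -prodfV -!big_split /=; apply: ler_prod => i _; apply/andP; split.
    by have := c0 i => ?; rewrite /cmaj /maj; nneg.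
  rewrite /cmaj.
  have ri : r ^+ 2 / tnh t + 1 <= 1 + Qf t x y.
    rewrite addrC lerD2l lerDl mulr_ge0 ?addr_ge0 ?sqnorm_ge0//; exact: ltW.
  have Qi : (x i - y i) ^+ 2 / tnh t + tnh t * (x i ^+ 2 + y i ^+ 2) + 1 <= 1 + Qf t x y.
    rewrite addrC lerD2l; apply: lerD.
      by rewrite ler_pM2r ?invr_gt0// dist_ge.
    by rewrite ler_pM2l//; apply: lerD; exact: sqnorm_ge.
  apply: le_trans (ler_wpM2l (ltW (c0 i)) (maj_le (alpha_ge i) t0 (x0 i) (y0 i) r0 Qi ri)) _.
  rewrite le_eqVlt; apply/orP; left; apply/eqP.
  move: (_ `^ _) (_ `^ _) (_ `^ _) (expR _) (expR _) => *.
  by move: (_^-1) (_^-1) => *; ring.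
have -> : \prod_i expR (gauss t (x i) (y i)) = expR (\sum_i gauss t (x i) (y i)).
  by rewrite expR_sum.
apply: ler_wpM2l.
  by apply: prodr_ge0 => i _; rewrite mulr_ge0 ?ltW// mulr_gt0 ?powR_gt0.
apply: ler_wpM2l; last by rewrite ler_expR; exact: sum_gauss_le.
have h1 : 0 <= \prod_i expR (- (2 * t * (alpha i + 1))).
  by apply: prodr_ge0 => i _; exact: expR_ge0.
have h2 : 0 <= (Vol x r)^-1 by rewrite invr_ge0 ltW// Vol_gt0.
have h3 : 0 <= \prod_(i < d) (r / Num.sqrt (tnh t)).
  by apply: prodr_ge0 => i _; rewrite divr_ge0 ?sqrtr_ge0// ltW.
have h4 : 0 <= \prod_i (1 + Qf t x y) `^ (2 * (alpha i + 1 / 2)).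
  by apply: prodr_ge0 => i _; exact: powR_ge0.
by rewrite !mulr_ge0.
Qed.

(** In fact [lambda0 >= d]. Positivity is what lets [e^(-t lambda0)] absorb powers of [1 + t]. *)
Lemma lambda0_gt0 : (0 < d)%N -> 0 < lambda0 alpha.
Proof.
move=> d0; rewrite /lambda0.
have : \sum_(i < d) (- (1 / 2)) <= \sum_(i < d) alpha i by apply: ler_sum => i _.
rewrite sumr_const card_ord -mulr_natr => h.
have : (0 : R) < d%:R by rewrite ltr0n.
by lra.
Qed.

(* [X] and [T] are the costs of a derivative in [x] and in [t]. *)
Lemma weighted_maj_le (c : 'I_d -> R) : (0 < d)%N -> (forall i, 0 < c i) ->
  exists2 C, 0 < C & forall t x y, 0 < t -> posR x -> posR y -> 0 < dist x y ->
  let M := \prod_i cmaj c t x y i in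
  let p := 1 + Qf t x y in
  let X := p * (Num.sqrt (tnh t))^-1 in
  let T := p * (Num.sqrt (tnh t))^-1 ^+ 2 in
  let r := dist x y in
  [/\ M <= C / Vol x r * expR (- (t * lambda0 alpha)),
      M * X <= C / (r * Vol x r) * expR (- (t * lambda0 alpha)),
      M * T <= C / Vol x r * time_weight r t &
      M * X * T <= C / (r * Vol x r) * time_weight r t].
Proof.
move=> d0 c0; have [K K0 [N N0 KP]] := prod_maj_le c0.
have l0 := lambda0_gt0 d0.
have [C1 C10 C1P] := sqrt_tnh_time_weight l0.
(* Powers of [p] to be absorbed: [N] from the majorants, [d] from [(r v)^d], and at most 5 from the
   derivatives and from trading further factors [r v] for [p]. *)
pose N' : R := N + d%:R + 5.
have N'0 : 0 <= N' by rewrite /N'; have := ler0n R d; lra.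
have c8 : (0 : R) < 8^-1 by rewrite invr_gt0.
have [C2 C20 C2P] := powR_expR_bounded N'0 c8.
exists (K * C2 + K * C2 * C1) => [|t x y t0 x0 y0 r0 /=].
  by rewrite addr_gt0 ?mulr_gt0.
have {KP} := KP t x y t0 x0 y0 r0.
set M := \prod_i _; set r := dist x y in r0 *; set q := Qf t x y.
have q0 : 0 <= q by exact: Qf_ge0.
set p := 1 + q; have p1 : 1 <= p by rewrite /p; lra.
have p0 : 0 < p by lra.
have T0 := tnh_gt0 t0; set v := (Num.sqrt (tnh t))^-1.
have v0 : 0 < v by rewrite invr_gt0 sqrtr_gt0.
have vv : v ^+ 2 = (tnh t)^-1 by rewrite exprVn sqr_sqrtr// ltW.
have rq : r ^+ 2 / tnh t + 1 <= p.
  rewrite /p addrC lerD2l /q /Qf lerDl mulr_ge0 ?addr_ge0 ?sqnorm_ge0//; exact: ltW.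
have rv0 : 0 < r * v by rewrite mulr_gt0.
have rvp : r * v <= p.
  apply: sqr_le_sqr; first exact: ltW.
  rewrite exprMn vv (@le_trans _ _ p)//; first lra.
  by rewrite expr2 ler_peMl// ltW.
set e := expR (- (t * lambda0 alpha)); have e0 : 0 < e by exact: expR_gt0.
set V := Vol x r; have V0 : 0 < V by exact: Vol_gt0.
set E := expR (- (8^-1 * q)) => KP.
have E0 : 0 < E by exact: expR_gt0.
(* One factor [r * v] is kept: it provides the weight in [t], or the factor [1 / r]. *)
have rvd : (r * v) ^+ d <= (r * v) * p ^+ d.
  case: d d0 => // n _; rewrite exprS ler_pM2l//.
  apply: le_trans (_ : p ^+ n <= _); last by rewrite ler_weXn2l.
  by rewrite lerXn2r// nnegrE ltW.
have pN k : (k <= 5)%N -> p ^+ d * p `^ N * p ^+ k * E <= C2.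
  move=> k5; apply: le_trans (C2P q q0); rewrite ler_pM2r//.
  rewrite -(powR_mulrn d (ltW p0)) -(powR_mulrn k (ltW p0)) -!gt0_powRD//.
  apply: ler_powR => //; rewrite /N'.
  have : (k%:R : R) <= 5%:R by rewrite ler_nat.
  lra.
have ME : M <= K / V * e * (r * v) * (p ^+ d * p `^ N * E).
  apply: (le_trans KP).
  have -> : K / V * e * (r * v) * (p ^+ d * p `^ N * E) =
    K * (e * V^-1 * ((r * v) * p ^+ d) * p `^ N * E) by ring.
  rewrite ler_pM2l//; apply: ler_wpM2r; first exact: ltW.
  apply: ler_wpM2r; first exact: powR_ge0.
  by rewrite ler_pM2l// mulr_gt0// invr_gt0.
have KV : 0 < K / V * e by rewrite mulr_gt0// divr_gt0.
have CC : K * C2 <= K * C2 + K * C2 * C1 by rewrite lerDl !mulr_ge0// ltW.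
have CC1 : K * C2 * C1 <= K * C2 + K * C2 * C1 by rewrite lerDr mulr_ge0// ltW.
have pk k : 0 <= p ^+ k by rewrite exprn_ge0// ltW.
have PE : 0 <= p ^+ d * p `^ N * E by rewrite mulr_ge0 ?mulr_ge0 ?powR_ge0// ltW.
have Vi : 0 < V^-1 by rewrite invr_gt0.
have ri : 0 < r^-1 by rewrite invr_gt0.
have o0 : 0 < time_weight r t by exact: time_weight_gt0.
have omP := C1P t r p t0 r0 rq.
split.
- apply: (le_trans ME); apply: le_trans (_ : K / V * e * C2 <= _); last first.
    have -> : K / V * e * C2 = (K * C2) * (V^-1 * e) by ring.
    rewrite -[leRHS]mulrA; apply: ler_wpM2r CC; by rewrite mulr_ge0// ltW.
  rewrite -mulrA ler_pM2l//; apply: le_trans (pN 1%N isT).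
  have -> : p ^+ d * p `^ N * p ^+ 1 * E = p * (p ^+ d * p `^ N * E) by ring.
  exact: ler_wpM2r.
- have pv0 : 0 <= p * v by rewrite mulr_ge0// ltW.
  apply: (le_trans (ler_wpM2r pv0 ME)).
  apply: le_trans (_ : K / (r * V) * e * C2 <= _); last first.
    have -> : K / (r * V) * e * C2 = (K * C2) * ((r * V)^-1 * e) by ring.
    rewrite -[leRHS]mulrA; apply: ler_wpM2r CC.
    by rewrite mulr_ge0 ?invr_ge0 ?mulr_ge0// ltW.
  have r1 : r != 0 by rewrite gt_eqF.
  (* The [v] of the derivative is [(r v) / r]: this produces the factor [1 / r], and
     [(r v)^2 <= p^2]. *)
  have -> : K / V * e * (r * v) * (p ^+ d * p `^ N * E) * (p * v) =
     K / (r * V) * e * ((r * v) ^+ 2 * p * (p ^+ d * p `^ N * E)).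
    rewrite invfM; move: (V^-1) (p `^ N) r1 => a b r1; by field.
  apply: ler_wpM2l.
    by rewrite mulr_ge0 ?divr_ge0 ?mulr_ge0// ltW.
  apply: le_trans (pN 3%N isT).
  have -> : p ^+ d * p `^ N * p ^+ 3 * E = p ^+ 2 * p * (p ^+ d * p `^ N * E) by ring.
  apply: ler_wpM2r => //; apply: ler_wpM2r; first exact: ltW.
  by rewrite lerXn2r// nnegrE ltW.
- have pv0 : 0 <= p * v ^+ 2 by rewrite mulr_ge0 ?exprn_ge0// ltW.
  apply: (le_trans (ler_wpM2r pv0 ME)).
  apply: le_trans (_ : K / V * C1 * time_weight r t * C2 <= _); last first.
    have -> : K / V * C1 * time_weight r t * C2 = (K * C2 * C1) * (V^-1 * time_weight r t) by ring.
    rewrite -[leRHS]mulrA; apply: ler_wpM2r CC1; by rewrite mulr_ge0// ltW.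
  have -> : K / V * e * (r * v) * (p ^+ d * p `^ N * E) * (p * v ^+ 2) =
    (e * (r * v * v ^+ 2)) * (K / V * (p * (p ^+ d * p `^ N * E))) by ring.
  apply: le_trans (_ : C1 * (p * time_weight r t) * (K / V * (p * (p ^+ d * p `^ N * E))) <= _).
    by apply: ler_wpM2r; [nneg|].
  have -> : C1 * (p * time_weight r t) * (K / V * (p * (p ^+ d * p `^ N * E))) =
    K / V * C1 * time_weight r t * (p ^+ d * p `^ N * p ^+ 2 * E) by ring.
  by apply: ler_wpM2l (pN 2%N isT); nneg.
- have pv0 : 0 <= p * v ^+ 2 by rewrite mulr_ge0 ?exprn_ge0// ltW.
  have pv1 : 0 <= p * v by rewrite mulr_ge0// ltW.
  apply: (le_trans (ler_wpM2r pv0 (ler_wpM2r pv1 ME))).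
  apply: le_trans (_ : K / (r * V) * C1 * time_weight r t * C2 <= _); last first.
    have -> : K / (r * V) * C1 * time_weight r t * C2 = (K * C2 * C1) * ((r * V)^-1 * time_weight r t) by ring.
    rewrite -[leRHS]mulrA; apply: ler_wpM2r CC1; nneg.
  have r1 : r != 0 by rewrite gt_eqF.
  have -> : K / V * e * (r * v) * (p ^+ d * p `^ N * E) * (p * v) * (p * v ^+ 2) =
    (e * (r * v * v ^+ 2)) * (K / (r * V) * ((r * v) * p ^+ 2 * (p ^+ d * p `^ N * E))).
    rewrite invfM; move: (V^-1) (p `^ N) r1 => a b r1; by field.
  have Kr : 0 <= K / (r * V) by rewrite divr_ge0 ?mulr_ge0// ltW.
  apply: le_trans (_ : C1 * (p * time_weight r t) *
     (K / (r * V) * ((r * v) * p ^+ 2 * (p ^+ d * p `^ N * E))) <= _).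
    by apply: ler_wpM2r; [nneg|].
  have -> : C1 * (p * time_weight r t) * (K / (r * V) * ((r * v) * p ^+ 2 * (p ^+ d * p `^ N * E))) =
    K / (r * V) * C1 * time_weight r t * ((r * v) * (p ^+ 3 * (p ^+ d * p `^ N * E))) by ring.
  apply: ler_wpM2l; first by nneg.
  apply: le_trans (pN 4%N isT).
  have -> : p ^+ d * p `^ N * p ^+ 4 * E = p * (p ^+ 3 * (p ^+ d * p `^ N * E)) by ring.
  by apply: ler_wpM2r; [nneg|].
Qed.

End kernel_d_bounds.

Section kernel_d_estimates.
Variables (R : realType) (d : nat) (alpha : 'I_d -> R) (eps : 'I_d -> bool).
Hypothesis alpha_ge : forall i, - (1 / 2) <= alpha i.
Implicit Types (x y : 'I_d -> R) (t : R) (i j : 'I_d).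

Lemma update_id x j : update x j (x j) = x.
Proof. by apply/funext => i; rewrite /update; case: eqP => // ->. Qed.

Lemma kernel_estimates : exists2 C, 0 < C & forall j t x y,
  0 < t -> posR x -> posR y -> 0 < dist x y ->
  let r := dist x y in
  [/\ `|Gcoord alpha eps j t (x j) x y| <= C / Vol alpha x r * expR (- (t * lambda0 alpha)),
      `|Gcoord_x alpha eps j t (x j) x y| <= C / (r * Vol alpha x r) * expR (- (t * lambda0 alpha)),
      `|Gcoord_t alpha eps j t (x j) x y| <= C / Vol alpha x r * time_weight r t &
      `|Gcoord_tx alpha eps j t (x j) x y| <= C / (r * Vol alpha x r) * time_weight r t].
Proof.
have [d0|d0] := posnP d.
  by exists 1 => // j; have := ltn_ord j; rewrite [X in (_ < X)%N]d0.
have h i : {C : R | 0 < C /\ forall k, (k <= 2)%N -> forall z, 0 <= z ->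
    `|prof k (alpha i) (eps i) z| <= C * (1 + z) `^ (- (alpha i + 1 / 2 + k%:R))}.
  apply: cid.
  have [C0 C00 H0] := @prof_decay R 0 (alpha i) (eps i) isT (alpha_ge i).
  have [C1 C10 H1] := @prof_decay R 1 (alpha i) (eps i) isT (alpha_ge i).
  have [C2 C20 H2] := @prof_decay R 2 (alpha i) (eps i) isT (alpha_ge i).
  exists (C0 + C1 + C2); split=> [|k]; first lra.
  case: k => [|[|[|//]]] _ z z0.
  - apply: (le_trans (H0 z z0)); apply: ler_wpM2r; [exact: powR_ge0|lra].
  - apply: (le_trans (H1 z z0)); apply: ler_wpM2r; [exact: powR_ge0|lra].
  - apply: (le_trans (H2 z z0)); apply: ler_wpM2r; [exact: powR_ge0|lra].
(* The constant of [kern_tx_le], which exceeds those of the other three bounds: one majorant then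
   serves the kernel and all its derivatives. *)
pose c i := (16 + 6 * (alpha i + 1)) * projT1 (h i).
have c0 i : 0 < c i.
  rewrite /c; case: (h i) => C [C0 _] /=; rewrite mulr_gt0//.
  by have := alpha_ge i; lra.
have [C C0 CP] := weighted_maj_le alpha_ge d0 c0.
have d1 : (1 : R) <= d%:R by rewrite ler1n.
exists (C * d%:R) => [|j t x y t0 x0 y0 r0 /=]; first by rewrite mulr_gt0// ltr0n.
have := CP t x y t0 x0 y0 r0; cbv zeta.
set M := \prod_i _; set r := dist x y in r0 *; set p := 1 + Qf t x y.
set u := (Num.sqrt (tnh t))^-1; move=> [B1 B2 B3 B4].
have T0 := tnh_gt0 t0; have Q0 := Qf_ge0 x y t0.
have u0 : 0 < u by rewrite invr_gt0 sqrtr_gt0.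
have p1 : 1 <= p by rewrite /p; lra.
have p0 : 0 < p by lra.
have pu : 0 <= p * u by nneg.
have puu : 0 <= p * u ^+ 2 by nneg.
pose m i := cmaj alpha c t x y i.
have bnd i : [/\ `|kern (alpha i) (eps i) t (x i) (y i)| <= m i,
  `|kern_x (alpha i) (eps i) t (x i) (y i)| <= m i * (p * u),
  `|kern_t (alpha i) (eps i) t (x i) (y i)| <= m i * (p * u ^+ 2) &
  `|kern_tx (alpha i) (eps i) t (x i) (y i)| <= m i * (p * u) * (p * u ^+ 2)].
  have a0 := alpha_ge i; have x0i := x0 i; have y0i := y0 i.
  have Qi : (x i - y i) ^+ 2 / tnh t + tnh t * (x i ^+ 2 + y i ^+ 2) + 1 <= p.
    rewrite /p addrC lerD2l; apply: lerD.
      by rewrite ler_pM2r ?invr_gt0// dist_ge.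
    by rewrite ler_pM2l//; apply: lerD; exact: sqnorm_ge.
  rewrite /m /cmaj /c; case: (h i) => D [D0 DP] /=.
  have mj0 : 0 <= maj (alpha i) t (x i) (y i) by rewrite /maj; nneg.
  have Dm : 0 <= D * maj (alpha i) t (x i) (y i) by nneg.
  set w := maj _ _ _ _ in mj0 Dm *.
  split.
  - apply: (le_trans (kern_le t0 x0i y0i DP)); rewrite -/w -mulrA ler_peMl//; lra.
  - apply: (le_trans (kern_x_le t0 x0i y0i Qi D0 DP)); rewrite -/w; apply: ler_wpM2r => //.
    by rewrite -!mulrA; apply: ler_wpM2r => //; lra.
  - apply: (le_trans (kern_t_le a0 t0 x0i y0i Qi D0 DP)); rewrite -/w; apply: ler_wpM2r => //.
    by rewrite -!mulrA; apply: ler_wpM2r => //; lra.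
  - exact: (kern_tx_le a0 t0 x0i y0i Qi D0 DP).
have bk i : `|kern (alpha i) (eps i) t (x i) (y i)| <= m i by have [] := bnd i.
have bt i : `|kern_t (alpha i) (eps i) t (x i) (y i)| <= m i * (p * u ^+ 2) by have [] := bnd i.
have [_ bx _ btx] := bnd j.
set s := rest j.
pose P := \prod_(i <- s) m i.
have m0 i : 0 <= m i by exact: le_trans (bk i).
have MP : M = m j * P by rewrite /M (bigD1 j)//= /P /s /rest big_filter.
have P0 : 0 <= P by rewrite /P; apply: prodr_ge0.
have bP := abs_prod_le s bk.
have bdP := abs_dprod_le s puu bk bt.
have ds : (size s)%:R + 1 <= d%:R :> R.
  rewrite natr1 ler_nat /s /rest size_filter.
  rewrite -[X in (_ <= X)%N](size_enum_ord d).
  have -> : size (enum 'I_d) = size (index_enum 'I_d).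
    apply/perm_size/uniq_perm; rewrite ?enum_uniq ?index_enum_uniq// => i.
    by rewrite mem_enum mem_index_enum.
  rewrite -(count_predC (fun i => i != j)) -addn1 leq_add2l -has_count.
  by apply/hasP; exists j; rewrite ?mem_index_enum//= eqxx.
have s0 : (0 : R) <= (size s)%:R by rewrite ler0n.
have Vr : 0 < Vol alpha x r by exact: Vol_gt0.
have o0 : 0 < time_weight r t by exact: time_weight_gt0.
have up A B : 0 <= B -> A <= C * B -> A <= C * d%:R * B.
  by move=> B0 AB; apply: (le_trans AB); apply: ler_wpM2r => //; rewrite ler_peMr// ltW.
split.
- rewrite -mulrA; apply: up; first by nneg.
  rewrite mulrA; apply: le_trans B1; rewrite MP; exact: absM_le.
- rewrite -mulrA; apply: up; first by nneg.
  rewrite mulrA; apply: le_trans B2; rewrite MP mulrAC; exact: absM_le.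
- have -> : C * d%:R / Vol alpha x r * time_weight r t = d%:R * (C / Vol alpha x r * time_weight r t).
    by move: (time_weight r t) => o; ring.
  apply: le_trans (_ : d%:R * (M * (p * u ^+ 2)) <= _); last by rewrite ler_wpM2l.
  apply: le_trans (_ : ((size s)%:R + 1) * (M * (p * u ^+ 2)) <= _); last first.
    by apply: ler_wpM2r => //; rewrite mulr_ge0// MP mulr_ge0.
  have -> : ((size s)%:R + 1) * (M * (p * u ^+ 2)) =
    m j * (p * u ^+ 2) * P + m j * ((size s)%:R * (p * u ^+ 2) * P) by rewrite MP; ring.
  by apply: absD_le; apply: absM_le.
- have -> : C * d%:R / (r * Vol alpha x r) * time_weight r t = d%:R * (C / (r * Vol alpha x r) * time_weight r t).
    by move: (time_weight r t) => o; ring.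
  apply: le_trans (_ : d%:R * (M * (p * u) * (p * u ^+ 2)) <= _); last by rewrite ler_wpM2l.
  apply: le_trans (_ : ((size s)%:R + 1) * (M * (p * u) * (p * u ^+ 2)) <= _); last first.
    by apply: ler_wpM2r => //; rewrite mulr_ge0// MP mulr_ge0// mulr_ge0.
  have -> : ((size s)%:R + 1) * (M * (p * u) * (p * u ^+ 2)) =
    m j * (p * u) * (p * u ^+ 2) * P + m j * (p * u) * ((size s)%:R * (p * u ^+ 2) * P).
    by rewrite MP; ring.
  by apply: absD_le; apply: absM_le.
Qed.

End kernel_d_estimates.

(** * From kernel bounds to standard estimates *)

Section ball_measure.
Variables (R : realType) (d : nat).
Local Notation mu := (@lebesgue_measure R).
Implicit Types (x y : 'I_d -> R) (i j : 'I_d).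

(** The integral of a nonnegative function is a supremum over the simple functions below it, hence
    monotone for arbitrary functions. The sections of a ball and their iterated integrals can thus
    be compared with boxes directly. *)
Lemma ge0_le_integral_nonmeasurable (f g : R -> \bar R) :
  (forall t, 0 <= f t)%E -> (forall t, f t <= g t)%E ->
  (\int[mu]_(t in [set: R]) f t <= \int[mu]_(t in [set: R]) g t)%E.
Proof.
move=> f0 fg; rewrite !ge0_integralTE//; last by move=> t; exact: le_trans (fg t).
apply: ge_ereal_sup => _ [h hf <-].
apply: ereal_sup_ubound; exists h => //= t; exact: le_trans (fg t).
Qed.

Lemma iter_integral_ge0 (s : seq 'I_d) (f : ('I_d -> R) -> \bar R) x :
  (forall y, 0 <= f y)%E -> (0 <= iter_integral s f x)%E.
Proof.
by move=> f0; elim: s x => [|i s IH] x //=; apply: integral_ge0 => t _.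
Qed.

Lemma le_iter_integral (s : seq 'I_d) (f g : ('I_d -> R) -> \bar R) x :
  (forall y, 0 <= f y)%E -> (forall y, f y <= g y)%E ->
  (iter_integral s f x <= iter_integral s g x)%E.
Proof.
move=> f0 fg; elim: s x => [|i s IH] x //=.
apply: ge0_le_integral_nonmeasurable => t; last exact: IH.
exact: iter_integral_ge0.
Qed.

(** Stated for a partial list [s] so that induction applies: integrated coordinates contribute [J],
    the others are still evaluated at [x]. *)
Lemma iter_integral_prod (s : seq 'I_d) (k : 'I_d -> R -> R) (J : 'I_d -> R) x :
  uniq s -> (forall i u, 0 <= k i u) -> (forall i, measurable_fun setT (k i)) ->
  (forall i, \int[mu]_(u in [set: R]) (k i u)%:E = (J i)%:E)%E ->
  iter_integral s (fun y => (\prod_i k i (y i))%:E) x =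
  ((\prod_(i <- s) J i) * \prod_(i | i \notin s) k i (x i))%:E.
Proof.
move=> + k0 mk kJ; elim: s x => [|i s IH] x /=.
  by move=> _; rewrite big_nil mul1r.
move=> /andP[iNs us].
set A := (\prod_(j <- s) J j) * \prod_(j | j \notin i :: s) k j (x j).
transitivity (\int[mu]_(t in [set: R]) (A%:E * (k i t)%:E))%E.
  apply: eq_integral => t _; rewrite IH// -EFinM; congr (_%:E).
  rewrite (bigD1 i)//= /A {1}/update eqxx.
  rewrite [X in _ * (_ * X) = _](_ : _ = \prod_(j | j \notin i :: s) k j (x j)); first by ring.
  apply: eq_big => [j|j /andP[_ /negbTE ji]]; last by rewrite /update ji.
  by rewrite in_cons negb_or andbC.
have J0 j : 0 <= J j.
  by rewrite -lee_fin -kJ; apply: integral_ge0 => u _; rewrite lee_fin.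
rewrite ge0_integralZl//.
- by rewrite kJ -EFinM big_cons; congr (_%:E); rewrite /A; ring.
- by apply/measurable_EFinP; have := mk i.
- by move=> u _; rewrite lee_fin.
- by rewrite lee_fin /A mulr_ge0// prodr_ge0.
Qed.

Definition boxfun (c a b : 'I_d -> R) i (u : R) : R := c i * \1_(`[a i, b i]) u.

Lemma integral_boxfun c a b : (forall i, 0 <= c i) -> (forall i, a i <= b i) ->
  integral_Rd (fun y => (\prod_i boxfun c a b i (y i))%:E) =
  (\prod_i (c i * (b i - a i)))%:E.
Proof.
move=> c0 ab; rewrite /integral_Rd.
rewrite (@iter_integral_prod _ _ (fun i => c i * (b i - a i))) ?enum_uniq//.
- rewrite [X in _ * X]big_pred0 ?mulr1; last by move=> i; rewrite mem_enum.
  by rewrite big_enum.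
- by move=> i u; rewrite /boxfun mulr_ge0// indicE ler0n.
- move=> i; apply: measurable_funM; first exact: measurable_cst.
  exact: measurable_indic.
- move=> i; rewrite /boxfun.
  under eq_integral do rewrite EFinM.
  rewrite ge0_integralZl//; last 2 first.
  + by apply/measurable_EFinP; apply: measurable_indic.
  + by rewrite lee_fin.
  rewrite integral_indic// setIT EFinM; congr (_ * _)%E.
  transitivity (mu `[a i, b i]%classic); first by [].
  rewrite lebesgue_measure_itv /= lte_fin.
  case: ifP => //; move/negbT; rewrite -leNgt => ba.
  have -> : a i = b i by apply/eqP; rewrite eq_le ab ba.
  by rewrite subrr.
Qed.

Variable alpha : 'I_d -> R.
Hypothesis alpha_ge : forall i, - (1 / 2) <= alpha i.

Let wfun (A : set ('I_d -> R)) y : \bar R := 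
  if `[< A y >] then (\prod_(j < d) powR `|y j| (2 * alpha j + 1))%:E else 0%E.

Let wfun_ge0 A y : (0 <= wfun A y)%E.
Proof.
by rewrite /wfun; case: ifP => // _; rewrite lee_fin; apply: prodr_ge0 => i _; exact: powR_ge0.
Qed.

Let a21 i : 0 <= 2 * alpha i + 1. Proof. by have := alpha_ge i; lra. Qed.

Lemma dist_ge_abs x y i : `|x i - y i| <= dist x y.
Proof. by apply: sqr_le_abs; [exact: sqrtr_ge0|exact: dist_ge]. Qed.

(** The ball lies in the box of half-side [r] about [x], where [|y_i| <= x_i + r]; the weight is
    monotone because [2 alpha_i + 1 >= 0]. *)
Lemma wplus_ball_le x r : posR x -> 0 < r ->
  (wplus alpha (ballp x r) <= (\prod_i ((x i + r) `^ (2 * alpha i + 1) * (2 * r)))%:E)%E.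
Proof.
move=> x0 r0.
have := @integral_boxfun (fun i => (x i + r) `^ (2 * alpha i + 1)) (fun i => x i - r) (fun i => x i + r).
move=> /(_ _ _) H.
have -> : \prod_i ((x i + r) `^ (2 * alpha i + 1) * (2 * r)) =
   \prod_i ((x i + r) `^ (2 * alpha i + 1) * (x i + r - (x i - r))).
  by apply: eq_bigr => i _; congr (_ * _); ring.
rewrite -H; last 2 first.
- by move=> i; exact: powR_ge0.
- by move=> i; lra.
apply: le_iter_integral => y; first exact: wfun_ge0.
case: ifPn => [/asboolP[y0 yr]|_]; rewrite lee_fin; last first.
  by apply: prodr_ge0 => i _; rewrite mulr_ge0 ?powR_ge0// indicE ler0n.
apply: ler_prod => i _; rewrite powR_ge0/= /boxfun.
have := le_lt_trans (dist_ge_abs x y i) yr; rewrite ltr_norml => /andP[h1 h2].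
rewrite indicE mem_set ?mulr1; last by rewrite /= in_itv/=; apply/andP; split; lra.
have := y0 i => yi0; have := x0 i => xi0.
by apply: ge0_ler_powR; rewrite ?nnegrE ?normr_ge0// ?ger0_norm ?ltW//; lra.
Qed.

Lemma wplus_ball_gt0 x r : posR x -> 0 < r -> (0 < wplus alpha (ballp x r))%E.
Proof.
(* The box with lower corner [x] and side [e] stays in the positive orthant, and lies in the ball
   because [d e^2 < r^2]. *)
move=> x0 r0; pose e := r / d.+1%:R.
have e0 : 0 < e by rewrite divr_gt0.
have := @integral_boxfun (fun i => x i `^ (2 * alpha i + 1)) (fun i => x i) (fun i => x i + e).
move=> /(_ _ _) H.
apply: (@lt_le_trans _ _ (\prod_i (x i `^ (2 * alpha i + 1) * (x i + e - x i)))%:E).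
  rewrite lte_fin; apply: prodr_gt0 => i _; apply: mulr_gt0; first exact: powR_gt0 (x0 i).
  by rewrite addrC addKr.
rewrite -H; last 2 first.
- by move=> i; exact: powR_ge0.
- by move=> i; lra.
apply: le_iter_integral => y.
  by rewrite lee_fin; apply: prodr_ge0 => i _; rewrite mulr_ge0 ?powR_ge0// indicE ler0n.
have [yb|] := pselect (forall i, y i \in `[x i, x i + e]); last first.
  move=> /existsNP[i yi]; rewrite (bigD1 i)//= /boxfun indicE memNset ?mulr0 ?mul0r.
    exact: wfun_ge0.
  by rewrite /=; exact/negP/negP.
have yxi i : 0 <= y i - x i <= e by have := yb i; rewrite in_itv/= => /andP[? ?]; lra.
have y0 : posR y by move=> i; have := yxi i; have := x0 i; lra.
rewrite asboolT; last first.
  split=> //; rewrite /dist /enorm -(ltr_pXn2r (ltn0Sn 1)) ?nnegrE ?sqrtr_ge0 ?(ltW r0)//.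
  rewrite sqr_sqrtr; last by apply: sumr_ge0 => i _; exact: sqr_ge0.
  apply: (@le_lt_trans _ _ (\sum_(i < d) e ^+ 2)).
    by apply: ler_sum => i _; have /andP[h1 h2] := yxi i; rewrite lerXn2r// nnegrE// ltW.
  rewrite sumr_const card_ord -mulr_natl /e expr_div_n mulrA ltr_pdivrMr ?exprn_gt0//.
  rewrite mulrC ltr_pM2l ?exprn_gt0// -natrX ltr_nat.
  by rewrite expnS expn1 (leq_trans (ltnSn d))// leq_pmulr.
rewrite lee_fin; apply: ler_prod => i _.
have /andP[h1 h2] := yxi i; have := x0 i => xi; have := y0 i => yi.
rewrite /boxfun mulr_ge0 ?powR_ge0 ?indicE ?ler0n//=.
rewrite mem_set ?mulr1; last exact: yb.
by apply: ge0_ler_powR; rewrite ?nnegrE ?normr_ge0 ?(gtr0_norm yi)//; [exact: ltW|lra].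
Qed.

(** Turns bounds in [1 / Vol] into bounds in the measure of the ball. Strict positivity matters
    since division by [0] yields [0]. The constant comes from [(x_i + r)^2 <= 2 (x_i^2 + r^2)]. *)
Lemma wplus_ball_Vol : exists2 C, 0 < C & forall x r, posR x -> 0 < r ->
  0 < fine (wplus alpha (ballp x r)) <= C * Vol alpha x r.
Proof.
exists (\prod_i (2 * 2 `^ (alpha i + 1 / 2))).
  by apply: prodr_gt0 => i _; rewrite mulr_gt0// powR_gt0.
move=> x r x0 r0.
have gt0 := wplus_ball_gt0 x0 r0; have le := wplus_ball_le x0 r0.
have fn : wplus alpha (ballp x r) \is a fin_num.
  rewrite ge0_fin_numE ?(ltW gt0)//; exact: le_lt_trans le (ltry _).
rewrite fine_gt0 ?gt0/=; last exact: le_lt_trans le (ltry _).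
rewrite -lee_fin fineK//; apply: (le_trans le); rewrite lee_fin.
rewrite /Vol -big_split /=; apply: ler_prod => i _; have xi := x0 i.
rewrite mulr_ge0 ?powR_ge0 ?mulr_ge0 ?(ltW r0)//=.
have -> : 2 * 2 `^ (alpha i + 1 / 2) * (r * (r ^+ 2 + x i ^+ 2) `^ (alpha i + 1 / 2)) =
  2 `^ (alpha i + 1 / 2) * (r ^+ 2 + x i ^+ 2) `^ (alpha i + 1 / 2) * (2 * r) by ring.
apply: ler_wpM2r; first by rewrite mulr_ge0// ltW.
have -> : 2 * alpha i + 1 = 2 * (alpha i + 1 / 2) by field.
have q0 : 0 <= r ^+ 2 + x i ^+ 2 by rewrite addr_ge0// sqr_ge0.
have xr0 : 0 <= x i + r by lra.
rewrite powRrM (powR_mulrn 2 xr0) -powRM//.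
apply: ge0_ler_powR; rewrite ?nnegrE ?sqr_ge0 ?mulr_ge0//; first by have := alpha_ge i; lra.
have := sqr_ge0 (x i - r).
have -> : (x i - r) ^+ 2 = x i ^+ 2 - 2 * (x i * r) + r ^+ 2 by ring.
have -> : (x i + r) ^+ 2 = x i ^+ 2 + 2 * (x i * r) + r ^+ 2 by ring.
by lra.
Qed.

End ball_measure.

Section volume.
Variables (R : realType) (d : nat) (alpha : 'I_d -> R).
Hypothesis alpha_ge : forall i, - (1 / 2) <= alpha i.
Implicit Types (x y : 'I_d -> R) (r : R) (j : 'I_d).

Let beta0 i : 0 <= alpha i + 1 / 2. Proof. by have := alpha_ge i; lra. Qed.

Lemma distC x y : dist x y = dist y x.
Proof.
by rewrite /dist /enorm /sqnorm; congr Num.sqrt; apply: eq_bigr => i _; rewrite -sqrrN opprB.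
Qed.

Lemma dist_gt0 x y : x <> y -> 0 < dist x y.
Proof.
move=> xy; rewrite lt_neqAle sqrtr_ge0 andbT eq_sym; apply/eqP => d0; apply: xy.
apply/funext => i; apply/eqP; rewrite -subr_eq0 -normr_le0 -d0; exact: dist_ge_abs.
Qed.

Lemma le_Vol x y r s : 0 < r -> r <= s -> (forall i, x i ^+ 2 <= y i ^+ 2) ->
  Vol alpha x r <= Vol alpha y s.
Proof.
move=> r0 rs xy; apply: ler_prod => i _; rewrite mulr_ge0 ?powR_ge0 ?(ltW r0)//=.
apply: ler_pM => //; [exact: ltW|exact: powR_ge0|].
have r2 : r ^+ 2 <= s ^+ 2 by rewrite lerXn2r// nnegrE; lra.
by apply: ge0_ler_powR; rewrite ?nnegrE; [exact: beta0|nneg|nneg|exact: lerD r2 (xy i)].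
Qed.

(** From [x_i^2 <= 2 (x_i - y_i)^2 + 2 y_i^2] follows [r^2 + x_i^2 <= 3 (r^2 + y_i^2)]. Bounds
    obtained by exchanging the points are thereby recentred at [x]. *)
Lemma VolC : exists2 C, 0 < C & forall x y, 0 < dist x y ->
  Vol alpha x (dist x y) <= C * Vol alpha y (dist x y).
Proof.
exists (\prod_i 3 `^ (alpha i + 1 / 2)); first by apply: prodr_gt0 => i _; rewrite powR_gt0.
move=> x y; set r := dist x y => r0; rewrite /Vol -big_split /=.
apply: ler_prod => i _; rewrite mulr_ge0 ?powR_ge0 ?(ltW r0)//=.
rewrite mulrCA ler_pM2l// -powRM// ?addr_ge0 ?sqr_ge0//.
apply: ge0_ler_powR; rewrite ?nnegrE; [exact: beta0|nneg|nneg|].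
have := dist_ge x y i; rewrite -/r => h.
have := sqr_ge0 (y i); have := sqr_ge0 (x i - 2 * y i).
have -> : (x i - 2 * y i) ^+ 2 = x i ^+ 2 - 4 * (x i * y i) + 4 * y i ^+ 2 by ring.
move: h; have -> : (x i - y i) ^+ 2 = x i ^+ 2 - 2 * (x i * y i) + y i ^+ 2 by ring.
by lra.
Qed.

Lemma dist_update_near x y j a : 0 < dist x y -> `|a - x j| <= dist x y / 4 ->
  dist x y / 2 <= dist (update x j a) y <= 2 * dist x y.
Proof.
set r := dist x y => r0 ar.
have E : dist (update x j a) y ^+ 2 = r ^+ 2 + ((y j - a) ^+ 2 - (y j - x j) ^+ 2).
  rewrite /r !dist_sqr (bigD1 j)//= [in RHS](bigD1 j)//= {1}/update eqxx.
  rewrite (eq_bigr (fun i => (y i - x i) ^+ 2)); first by ring.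
  by move=> i /negbTE ij; rewrite /update ij.
have b : `|y j - x j| <= r by rewrite distrC; exact: dist_ge_abs.
have D : `|(y j - a) ^+ 2 - (y j - x j) ^+ 2| <= r ^+ 2 * (9 / 16).
  have -> : (y j - a) ^+ 2 - (y j - x j) ^+ 2 = (a - x j) * ((a - x j) - 2 * (y j - x j)) by ring.
  (* Moving one coordinate by at most [r / 4] changes the squared distance by at most [9/16 r^2], so
     it stays between [r^2 / 4] and [4 r^2]. *)
  have -> : r ^+ 2 * (9 / 16) = (r / 4) * (r / 4 + 2 * r) by field.
  apply: absM_le => //; apply: absB_le => //; apply: absM_le => //; by rewrite ger0_norm.
have r2 := exprn_gt0 2 r0.
have dd : 0 <= dist (update x j a) y by exact: sqrtr_ge0.
move: D; rewrite ler_norml => /andP[D1 D2].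
apply/andP; split; apply: sqr_le_sqr => //; rewrite ?E; nneg.
  by rewrite expr_div_n; lra.
by rewrite exprMn; lra.
Qed.

End volume.

Section real_estimates.
Variables (R : realType) (d : nat) (alpha : 'I_d -> R).
Hypothesis alpha_ge : forall i, - (1 / 2) <= alpha i.
Implicit Types (x y : 'I_d -> R) (K : ('I_d -> R) -> ('I_d -> R) -> R) (j : 'I_d).

(** Real-valued, coordinatewise and in terms of [Vol]: a form stable under negation and difference,
    so real and imaginary parts and the four measures can be treated one at a time. *)
Definition real_estimates K := exists2 C, 0 < C &
  forall x y, posR x -> posR y -> x <> y ->
  `|K x y| <= C / Vol alpha x (dist x y) /\
  forall j, [/\ derivable (fun s => K (update x j s) y) (x j) 1,
     derivable (fun s => K x (update y j s)) (y j) 1,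
     `|dx K j x y| <= C / (dist x y * Vol alpha x (dist x y)) &
     `|dy K j x y| <= C / (dist x y * Vol alpha x (dist x y))].

Lemma real_estimatesN K : real_estimates K -> real_estimates (fun x y => - K x y).
Proof.
move=> [C C0 KC]; exists C => // x y x0 y0 xy; have [k1 k2] := KC x y x0 y0 xy.
split=> [|j]; first by rewrite normrN.
have [dv1 dv2 b1 b2] := k2 j.
split.
- exact: derivableN.
- exact: derivableN.
- by rewrite /dx derive1E (deriveN dv1) normrN -derive1E.
- by rewrite /dy derive1E (deriveN dv2) normrN -derive1E.
Qed.

Lemma real_estimatesB K L : real_estimates K -> real_estimates L ->
  real_estimates (fun x y => K x y - L x y).
Proof.
move=> [C C0 KC] [C' C'0 LC]; exists (C + C') => [|x y x0 y0 xy]; first exact: addr_gt0.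
have [k1 k2] := KC x y x0 y0 xy; have [l1 l2] := LC x y x0 y0 xy.
split=> [|j]; first by rewrite mulrDl; exact: absB_le.
have [dv1 dv2 b1 b2] := k2 j; have [dv3 dv4 b3 b4] := l2 j.
split.
- exact: derivableB.
- exact: derivableB.
- by rewrite /dx derive1E (deriveB dv1 dv3) -!derive1E mulrDl; exact: absB_le.
- by rewrite /dy derive1E (deriveB dv2 dv4) -!derive1E mulrDl; exact: absB_le.
Qed.

Lemma sqrt_sum_sqr_le (n : nat) (f : 'I_n -> R) (B : R) : 0 <= B ->
  (forall i, f i <= B ^+ 2) -> Num.sqrt (\sum_i f i) <= n.+1%:R * B.
Proof.
move=> B0 fB; have nB : 0 <= n.+1%:R * B by rewrite mulr_ge0.
have -> : n.+1%:R * B = Num.sqrt ((n.+1%:R * B) ^+ 2) by rewrite sqrtr_sqr ger0_norm.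
rewrite ler_wsqrtr// exprMn.
apply: le_trans (_ : \sum_(i < n) B ^+ 2 <= _); first exact: ler_sum.
have -> : \sum_(i < n) B ^+ 2 = n%:R * B ^+ 2 by rewrite sumr_const card_ord mulr_natl.
apply: ler_wpM2r; first exact: sqr_ge0.
by rewrite -natrX ler_nat (leq_trans (leqnSn n))// leq_pmulr.
Qed.

Lemma standard_of_real_estimates Kre Kim : real_estimates Kre -> real_estimates Kim ->
  standard_estimates alpha Kre Kim.
Proof.
move=> [C C0 HC] [D D0 HD]; have [W W0 HW] := wplus_ball_Vol alpha_ge.
pose M := (C + D) * W.
have M0 : 0 < M by rewrite mulr_gt0// addr_gt0.
(* Each coordinate contributes four squares to the gradient, at most [(2 B)^2] together; [d + 1] is
   a crude bound for [sqrt d]. *)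
exists (4 * d.+1%:R * M) => x y x0 y0 xy.
have r0 := dist_gt0 xy; set r := dist x y in r0 *.
have V0 : 0 < Vol alpha x r by exact: Vol_gt0.
have [a1 a2] := HC x y x0 y0 xy; have [b1 b2] := HD x y x0 y0 xy.
have /andP[w0 wV] := HW x r x0 r0; set w := fine _ in w0 wV *.
have up E : 0 < E -> E <= C + D -> E / Vol alpha x r <= M / w.
  move=> E0 EM; rewrite ler_pdivrMr// mulrAC ler_pdivlMr// /M -mulrA.
  by apply: ler_pM => //; nneg.
have CM : C <= C + D by lra.
have DM : D <= C + D by lra.
have up' E : 0 < E -> E <= C + D -> E / (r * Vol alpha x r) <= M / (r * w).
  move=> E0 EM; rewrite !invfM mulrCA [leRHS]mulrCA ler_pM2l ?invr_gt0//; exact: up.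
have d1 : (1 : R) <= d.+1%:R by rewrite ler1n.
have sq (a B : R) : `|a| <= B -> a ^+ 2 <= B ^+ 2.
  by move=> aB; rewrite -real_normK ?num_real// lerXn2r// nnegrE//; exact: le_trans aB.
have B0 : 0 <= M / w by nneg.
have B0' : 0 <= M / (r * w) by nneg.
split.
- apply: le_trans (_ : 2 * (M / w) <= _).
    have B2 : 0 <= 2 * (M / w) by nneg.
    rewrite -[leRHS](ger0_norm B2) -sqrtr_sqr ler_wsqrtr//.
    have := sq _ _ (le_trans a1 (up _ C0 CM)); have := sq _ _ (le_trans b1 (up _ D0 DM)).
    by rewrite exprMn; have := sqr_ge0 (M / w); lra.
  have -> : 4 * d.+1%:R * M / w = 4 * d.+1%:R * (M / w) by rewrite mulrA.
  by apply: ler_wpM2r => //; lra.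
- move=> j; have [h1 h2 _ _] := a2 j; have [h3 h4 _ _] := b2 j.
  by split; [exact: h1|exact: h3|exact: h2|exact: h4].
- apply: le_trans (_ : d.+1%:R * (2 * (M / (r * w))) <= _).
    apply: sqrt_sum_sqr_le => [|j]; first by nneg.
    have [_ _ c1 c2] := a2 j; have [_ _ c3 c4] := b2 j.
    have := sq _ _ (le_trans c1 (up' _ C0 CM)); have := sq _ _ (le_trans c2 (up' _ C0 CM)).
    have := sq _ _ (le_trans c3 (up' _ D0 DM)); have := sq _ _ (le_trans c4 (up' _ D0 DM)).
    by rewrite exprMn; lra.
  have -> : 4 * d.+1%:R * M / (r * w) = d.+1%:R * (4 * (M / (r * w))) by ring.
  by apply: ler_wpM2l => //; lra.
Qed.

End real_estimates.

(** * Kernels given by an integral over a parameter, for both parts at once *)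

Section integral_kernel.
Context {disp : measure_display} {T : measurableType disp} {R : realType}
  (mu : {measure set T -> \bar R}) (D : set T).
Variables (d : nat) (alpha : 'I_d -> R).
Hypothesis mD : measurable D.
Hypothesis alpha_ge : forall i, - (1 / 2) <= alpha i.
Implicit Types (x y : 'I_d -> R) (j : 'I_d) (t : T).

Variables (N : T -> ('I_d -> R) -> ('I_d -> R) -> R)
  (Nx : 'I_d -> T -> ('I_d -> R) -> ('I_d -> R) -> R) (w : R -> T -> R).
Variables (C A W : R).
Hypotheses (C0 : 0 < C) (A0 : 0 < A) (W0 : 0 < W).
Hypothesis NC : forall t x y, D t -> posR x -> posR y -> N t x y = N t y x.
Hypothesis mN : forall x y, posR x -> posR y -> measurable_fun D (fun t => N t x y).
Hypothesis mNx : forall j x y, posR x -> posR y -> measurable_fun D (fun t => Nx j t x y).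
Hypothesis dN : forall j t x y, D t -> posR x -> posR y ->
  has_deriv (fun s => N t (update x j s) y) (x j) (Nx j t x y).
Hypothesis N_le : forall t x y, D t -> posR x -> posR y -> 0 < dist x y ->
  `|N t x y| <= C / Vol alpha x (dist x y) * w (dist x y) t.
Hypothesis Nx_le : forall j t x y, D t -> posR x -> posR y -> 0 < dist x y ->
  `|Nx j t x y| <= C / (dist x y * Vol alpha x (dist x y)) * w (dist x y) t.
Hypothesis w_ge0 : forall r t, 0 < r -> D t -> 0 <= w r t.
Hypothesis iw : forall r, 0 < r -> mu.-integrable D (EFin \o w r).
Hypothesis w_int : forall r, 0 < r -> \int[mu]_(t in D) w r t <= W.
(** Moving [x] changes the distance and with it the weight, whereas domination under the integral
    needs one function for all nearby points. *)
Hypothesis w_near : forall r s t, 0 < r -> r / 2 <= s <= 2 * r -> D t -> w s t <= A * w r t.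

Let bounded_integrable (f : T -> R) (B r : R) : 0 < r -> 0 <= B -> measurable_fun D f ->
  (forall t, D t -> `|f t| <= B * w r t) ->
  mu.-integrable D (EFin \o f) /\ `|\int[mu]_(t in D) f t| <= B * W.
Proof.
move=> r0 B0 mf fB; have iwr := iw r0.
have iBw : mu.-integrable D (EFin \o (fun t => B * w r t)).
  by have := integrableZl mD B iwr.
have fi : mu.-integrable D (EFin \o f).
  apply: le_integrable iBw => //; first exact/measurable_EFinP.
  move=> t Dt; rewrite lee_fin; apply: (le_trans (fB t Dt)); exact: ler_norm.
split=> //.
apply: (le_trans (le_normr_Rintegral mD fi)).
apply: (@le_trans _ _ (\int[mu]_(t in D) (B * w r t))).
  apply: le_Rintegral => //; exact: integrable_norm.
by rewrite RintegralZl// ler_wpM2l// w_int.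
Qed.

Lemma integrable_kernel x y : posR x -> posR y -> x <> y ->
  mu.-integrable D (fun t => (N t x y)%:E).
Proof.
move=> x0 y0 xy; have r0 := dist_gt0 xy.
have V0 : 0 < Vol alpha x (dist x y) by exact: Vol_gt0.
have B0 : 0 <= C / Vol alpha x (dist x y) by nneg.
have [] // := bounded_integrable r0 B0 (mN x0 y0).
by move=> t Dt; exact: N_le.
Qed.

Let K x y := \int[mu]_(t in D) N t x y.

Let update_update x j s : update (update x j s) j = update x j.
Proof. by apply/funext => u; apply/funext => i; rewrite /update; case: eqP. Qed.

Let update_at x j s : update x j s j = s.
Proof. by rewrite /update eqxx. Qed.

Let K_x x y j : posR x -> posR y -> x <> y ->
  derivable (fun s => K (update x j s) y) (x j) 1 /\
  dx K j x y = \int[mu]_(t in D) Nx j t x y.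
Proof.
move=> x0 y0 xy; have r0 := dist_gt0 xy; set r := dist x y in r0 *.
(* Within [rho] the moved coordinate stays positive and the distance to [y] stays between [r / 2]
   and [2 r]. *)
pose rho := Num.min (x j) r / 4.
have xj := x0 j.
have rho0 : 0 < rho by rewrite divr_gt0// lt_min xj r0.
have rho_x : rho <= x j / 4 by rewrite ler_pM2r ?invr_gt0// ge_min lexx.
have rho_r : rho <= r / 4 by rewrite ler_pM2r ?invr_gt0// ge_min lexx orbT.
pose I : set R := `]x j - rho, x j + rho[%classic.
have Ia : I (x j) by rewrite /I /= in_itv/=; apply/andP; split; lra.
have Is s : I s -> 0 < s /\ r / 2 <= dist (update x j s) y <= 2 * r.
  rewrite /I /= in_itv/= => /andP[s1 s2]; split; first lra.
  by apply: dist_update_near => //; rewrite -/r ler_norml; apply/andP; split; lra.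
have rr0 : 0 < r / 2 by lra.
have Iy s : I s -> update x j s <> y.
  move=> /Is[_ /andP[h _]] E; move: h; rewrite E.
  have -> : dist y y = 0.
    rewrite /dist /enorm /sqnorm big1 ?sqrtr0// => i _; by rewrite subrr expr0n.
  by lra.
have Ip s : I s -> posR (update x j s) by move=> /Is[s0 _]; exact: update_pos.
pose f s t := N t (update x j s) y.
have intf s : I s -> mu.-integrable D (EFin \o f s).
  by move=> Is'; apply: integrable_kernel; [exact: Ip| |exact: Iy].
have derf s t : I s -> D t -> has_deriv (f ^~ t) s (Nx j t (update x j s) y).
  by move=> Is' Dt; have := dN j Dt (Ip s Is') y0; rewrite update_update update_at.
(* [Vol] at the origin with radius [r / 2] is below [Vol] at all nearby points, so [c] does not
   depend on [s]. It serves domination only; the final size comes from [Nx_le] at [x] itself. *)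
pose c : R := C / (r / 2 * Vol alpha (fun=> 0) (r / 2)) * A.
have V0 : 0 < Vol alpha (fun=> 0) (r / 2) by exact: Vol_gt0.
have c0 : 0 <= c by rewrite /c; nneg.
pose G t := c * `|w r t|.
have G_ge0 t : 0 <= G t by rewrite /G mulr_ge0.
have intG : mu.-integrable D (EFin \o G).
  by have := integrableZl mD c (integrable_norm (iw r0)).
have G_ub s t : I s -> D t -> `|partial1of2 f s t| <= G t.
  move=> Is' Dt; rewrite /partial1of2 (has_derivE (derf s t Is' Dt)).
  have [s0 rs] := Is s Is'; have /andP[rs1 rs2] := rs.
  have ru0 : 0 < dist (update x j s) y by lra.
  apply: (le_trans (Nx_le j Dt (Ip s Is') y0 ru0)).
  have wr := w_near r0 rs Dt; have wr0 := w_ge0 r0 Dt.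
  rewrite /G /c ger0_norm// -[leRHS]mulrA.
  have Vu : 0 < Vol alpha (update x j s) (dist (update x j s) y) by exact: Vol_gt0.
  apply: ler_pM => //; first by nneg.
    exact: w_ge0.
  rewrite ler_pM2l// lef_pV2 ?posrE ?mulr_gt0//; apply: ler_pM => //; try exact: ltW.
  by apply: le_Vol => // i; rewrite expr0n sqr_ge0.
have dK := @derivable_under_integral R _ T mu f D mD (x j) _ _ Ia intf
  (fun s t Is' Dt => has_deriv_derivable (derf s t Is' Dt)) G G_ge0 intG G_ub.
have dE := @differentiation_under_integral R _ T mu f D mD (x j) _ _ Ia intf
  (fun s t Is' Dt => has_deriv_derivable (derf s t Is' Dt)) G G_ge0 intG G_ub.
split; first exact: dK.
rewrite /dx; transitivity (\int[mu]_(t in D) (partial1of2 f (x j) t)); first exact: dE.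
apply: eq_Rintegral => t; rewrite inE => Dt.
by rewrite /partial1of2 (has_derivE (derf (x j) t Ia Dt)) update_id.
Qed.

Lemma integral_kernel_estimates : real_estimates alpha K.
Proof.
have [C' C'0 VC] := VolC alpha_ge.
have KC x y : posR x -> posR y -> K x y = K y x.
  by move=> x0 y0; apply: eq_Rintegral => t; rewrite inE => Dt; exact: NC.
have Kx_le x y j : posR x -> posR y -> x <> y ->
    `|dx K j x y| <= C / (dist x y * Vol alpha x (dist x y)) * W.
  move=> x0 y0 xy; have r0 := dist_gt0 xy; have [_ ->] := K_x j x0 y0 xy.
  have V0 : 0 < Vol alpha x (dist x y) by exact: Vol_gt0.
  have B0 : 0 <= C / (dist x y * Vol alpha x (dist x y)) by nneg.
  have [] // := bounded_integrable r0 B0 (mNx j x0 y0).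
  by move=> t Dt; exact: Nx_le.
exists (C * W * (1 + C')) => [|x y x0 y0 xy]; first by rewrite !mulr_gt0// addr_gt0.
have r0 := dist_gt0 xy; set r := dist x y in r0 *.
have V0 : 0 < Vol alpha x r by exact: Vol_gt0.
have Vy0 : 0 < Vol alpha y r by exact: Vol_gt0.
have CW : C * W <= C * W * (1 + C').
  by rewrite ler_peMr//; [nneg|lra].
split.
  have B0 : 0 <= C / Vol alpha x r by nneg.
  have [_ kle] := bounded_integrable r0 B0 (mN x0 y0)
    (fun t Dt => N_le Dt x0 y0 r0).
  apply: (le_trans kle); rewrite mulrAC; apply: ler_wpM2r => //; nneg.
move=> j; have [dv1 _] := K_x j x0 y0 xy.
have yx : y <> x by move=> E; apply: xy.
have [dv2 _] := K_x j y0 x0 yx.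
(* Symmetry is available at positive points only, which suffices for a derivative because positivity
   is an open condition. *)
have E : \forall s \near y j, K (update y j s) x = K x (update y j s).
  near=> s; apply: KC => //; apply: update_pos => //.
  by near: s; exact: near_gt0 (y0 j).
have h2 : has_deriv (fun s => K (update y j s) x) (y j) (dx K j y x).
  by apply: has_deriv_derive1; apply: derivableP; exact: dv2.
have h3 := near_has_deriv E h2.
split.
- exact: dv1.
- exact: has_deriv_derivable h3.
- apply: (le_trans (Kx_le x y j x0 y0 xy)); rewrite -/r mulrAC; apply: ler_wpM2r => //; nneg.
- rewrite /dy (has_derivE h3).
  apply: (le_trans (Kx_le y x j y0 x0 yx)); rewrite -[dist y x]distC -/r mulrAC.
  have ry := VC x y r0; rewrite -/r in ry.
  rewrite ler_pdivrMr ?mulr_gt0// mulrAC ler_pdivlMr ?mulr_gt0//.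
  have -> : C * W * (1 + C') * (r * Vol alpha y r) = (C * W * r) * ((1 + C') * Vol alpha y r) by ring.
  have -> : C * W * (r * Vol alpha x r) = (C * W * r) * Vol alpha x r by ring.
  apply: ler_wpM2l; first by nneg.
  by rewrite mulrDl mul1r; lra.
Unshelve. all: by end_near. Qed.

End integral_kernel.

Section heat_kernel_integrals.
Variables (R : realType) (d : nat) (alpha : 'I_d -> R) (eps : 'I_d -> bool).
Hypothesis alpha_ge : forall i, - (1 / 2) <= alpha i.
Hypothesis d0 : (0 < d)%N.
Local Notation mu := (@lebesgue_measure R).
Implicit Types (x y : 'I_d -> R) (t r s : R) (j : 'I_d).

Lemma time_weight_near r s t : 0 < r -> r / 2 <= s <= 2 * r -> 0 < t -> time_weight s t <= 8 * time_weight r t.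
Proof.
move=> r0 /andP[rs sr] t0; rewrite /time_weight.
have s0 : 0 < s by lra.
have sq0 : 0 < Num.sqrt t by rewrite sqrtr_gt0.
have r2 : 0 < r ^+ 2 by rewrite exprn_gt0.
have s2 : 0 < s ^+ 2 by rewrite exprn_gt0.
have h1 : 0 < t + s ^+ 2 by lra.
have h2 : 0 < t + r ^+ 2 by lra.
rewrite ler_pdivrMr ?mulr_gt0// mulrA mulrAC ler_pdivlMr ?mulr_gt0//.
rewrite mulrCA [leRHS]mulrCA ler_pM2l//.
(* The factor 8 is [2 * 4]: [s <= 2 r] in the numerator and [r^2 <= 4 s^2] in the denominator. *)
have rs2 : r ^+ 2 <= 4 * s ^+ 2.
  have -> : 4 * s ^+ 2 = (2 * s) ^+ 2 by ring.
  by rewrite lerXn2r// ?nnegrE; lra.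
have A1 : s * t <= 2 * r * t by rewrite ler_pM2r.
have A2 : s * r ^+ 2 <= 2 * r * r ^+ 2 by rewrite ler_pM2r.
have A3 : 2 * r * r ^+ 2 <= 2 * r * (4 * s ^+ 2) by rewrite ler_pM2l//; lra.
have A4 : 0 <= r * t by nneg.
have -> : 8 * r * (t + s ^+ 2) = 8 * (r * t) + 2 * r * (4 * s ^+ 2) by ring.
rewrite mulrDr; apply: lerD; last exact: le_trans A3.
by apply: (le_trans A1); rewrite -mulrA; lra.
Qed.

Lemma Gker_coord j t x y : 0 < t -> posR x -> posR y ->
  Gker alpha eps t x y = Gcoord alpha eps j t (x j) x y.
Proof. by move=> t0 x0 y0; rewrite -{1}(update_id x j) Gker_update. Qed.

Lemma dtGker_coord j t x y : 0 < t -> posR x -> posR y ->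
  dtGker alpha eps t x y = Gcoord_t alpha eps j t (x j) x y.
Proof. by move=> t0 x0 y0; rewrite -{1}(update_id x j) dtGker_update. Qed.

Lemma has_deriv_Gker j t x y : 0 < t -> posR x -> posR y ->
  has_deriv (fun s => Gker alpha eps t (update x j s) y) (x j) (Gcoord_x alpha eps j t (x j) x y).
Proof.
move=> t0 x0 y0; apply: near_has_deriv (has_deriv_Gcoord_x eps alpha_ge j t (x j) x y).
near=> s; rewrite Gker_update//; near: s; exact: near_gt0.
Unshelve. all: by end_near. Qed.

Lemma has_deriv_dtGker j t x y : 0 < t -> posR x -> posR y ->
  has_deriv (fun s => dtGker alpha eps t (update x j s) y) (x j)
    (Gcoord_tx alpha eps j t (x j) x y).
Proof.
move=> t0 x0 y0; apply: near_has_deriv (has_deriv_Gcoord_tx eps alpha_ge j t (x j) x y).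
near=> s; rewrite dtGker_update//; near: s; exact: near_gt0.
Unshelve. all: by end_near. Qed.

Lemma measurable_eq_pos (f g : R -> R) : (forall t, 0 < t -> f t = g t) ->
  (forall t, 0 < t -> {for t, continuous f}) ->
  measurable_fun (`]0, +oo[ : set R) g.
Proof.
move=> fg cf; apply: eq_measurable_fun (continuous_pos_measurable cf).
by move=> t; rewrite inE /= in_itv/= andbT => /fg.
Qed.

Lemma measurable_kernel j x y :
  [/\ measurable_fun (`]0, +oo[ : set R) (fun t => Gcoord_x alpha eps j t (x j) x y),
      measurable_fun (`]0, +oo[ : set R) (fun t => Gcoord_tx alpha eps j t (x j) x y),
      (posR x -> posR y ->
        measurable_fun (`]0, +oo[ : set R) (fun t => Gker alpha eps t x y)) &
      (posR x -> posR y ->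
        measurable_fun (`]0, +oo[ : set R) (fun t => dtGker alpha eps t x y))].
Proof.
have sm t (t0 : 0 < t) := diff_at_Gcoord eps alpha_ge j (x j) x y t0.
split.
- apply: continuous_pos_measurable => t t0; apply: diff_at_continuous.
  by have [] := sm t t0.
- apply: continuous_pos_measurable => t t0; apply: diff_at_continuous.
  by have [] := sm t t0.
- move=> x0 y0; apply: (measurable_eq_pos (f := fun t => Gcoord alpha eps j t (x j) x y)) => t t0.
    by rewrite (Gker_coord j).
  by apply: diff_at_continuous; have [] := sm t t0.
- move=> x0 y0; apply: (measurable_eq_pos (f := fun t => Gcoord_t alpha eps j t (x j) x y)) => t t0.
    by rewrite (dtGker_coord j).
  by apply: diff_at_continuous; have [] := sm t t0.
Qed.

(** [kernel_estimates] is phrased relative to a coordinate; for bounds without a derivative in [x]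
    any one serves. *)
Let j0 : 'I_d := Ordinal d0.

Lemma time_derivative_kernel (eta : R -> R) :
  measurable_fun (`]0, +oo[ : set R) eta ->
  (exists M : R, forall t, 0 < t -> `|eta t| <= M) ->
  (forall x y, posR x -> posR y -> x <> y ->
    mu.-integrable `]0, +oo[ (fun t => (dtGker alpha eps t x y * eta t)%:E)) /\
  real_estimates alpha
    (fun x y => \int[mu]_(t in `]0, +oo[) (dtGker alpha eps t x y * eta t)).
Proof.
move=> meta [M etaM]; have [C C0 CP] := kernel_estimates eps alpha_ge.
pose M' := `|M| + 1.
have M'0 : 0 < M' by rewrite /M'; have := normr_ge0 M; lra.
have etaM' t : 0 < t -> `|eta t| <= M'.
  by move=> t0; apply: (le_trans (etaM t t0)); rewrite /M'; have := ler_norm M; lra.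
have Dt0 t : (`]0, +oo[%classic : set R) t -> 0 < t by rewrite /= in_itv/= andbT.
pose N t x y := dtGker alpha eps t x y * eta t.
pose Nx j t x y := Gcoord_tx alpha eps j t (x j) x y * eta t.
have CM0 : 0 < C * M' by rewrite mulr_gt0.
have pi2 : 0 < 2 * pi :> R by rewrite mulr_gt0// pi_gt0.
have NC t x y : (`]0, +oo[%classic : set R) t -> posR x -> posR y -> N t x y = N t y x.
  by move=> /Dt0 t0 x0 y0; rewrite /N dtGkerC.
have mN x y : posR x -> posR y ->
    measurable_fun (T := measurableTypeR R) (U := R) `]0, +oo[ (fun t => N t x y).
  move=> x0 y0; have [_ _ _ h] := measurable_kernel j0 x y.
  exact: (measurable_funM (h x0 y0) meta).
have mNx j x y : posR x -> posR y ->
    measurable_fun (T := measurableTypeR R) (U := R) `]0, +oo[ (fun t => Nx j t x y).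
  move=> x0 y0; have [_ h _ _] := measurable_kernel j x y.
  exact: (measurable_funM h meta).
have dN j t x y : (`]0, +oo[%classic : set R) t -> posR x -> posR y ->
    has_deriv (fun s => N t (update x j s) y) (x j) (Nx j t x y).
  move=> /Dt0 t0 x0 y0; apply: has_deriv_eq.
    by apply: has_derivM (has_deriv_cst _ _); exact: has_deriv_dtGker.
  by rewrite mulr0 addr0.
have N_le t x y : (`]0, +oo[%classic : set R) t -> posR x -> posR y -> 0 < dist x y ->
    `|N t x y| <= C * M' / Vol alpha x (dist x y) * time_weight (dist x y) t.
  move=> /Dt0 t0 x0 y0 r0; have [_ _ h _] := CP j0 t x y t0 x0 y0 r0.
  rewrite /N (dtGker_coord j0)//.
  rewrite [leRHS](_ : _ = (C / Vol alpha x (dist x y) * time_weight (dist x y) t) * M').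
    exact: absM_le h (etaM' t t0).
  by move: (time_weight _ _) => o; ring.
have Nx_le j t x y : (`]0, +oo[%classic : set R) t -> posR x -> posR y -> 0 < dist x y ->
    `|Nx j t x y| <= C * M' / (dist x y * Vol alpha x (dist x y)) * time_weight (dist x y) t.
  move=> /Dt0 t0 x0 y0 r0; have [_ _ _ h] := CP j t x y t0 x0 y0 r0.
  rewrite [leRHS](_ : _ = (C / (dist x y * Vol alpha x (dist x y)) * time_weight (dist x y) t) * M').
    exact: absM_le h (etaM' t t0).
  by move: (time_weight _ _) (_^-1) => o v; ring.
have w0 r t : 0 < r -> (`]0, +oo[%classic : set R) t -> 0 <= time_weight r t.
  by move=> r0 /Dt0 t0; rewrite ltW// time_weight_gt0.
have wn r s t : 0 < r -> r / 2 <= s <= 2 * r -> (`]0, +oo[%classic : set R) t ->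
    time_weight s t <= 8 * time_weight r t.
  by move=> r0 rs /Dt0; exact: time_weight_near.
have eight : 0 < 8 :> R by [].
split.
- move=> x y x0 y0 xy.
  exact: (@integrable_kernel _ (measurableTypeR R) R mu `]0, +oo[%classic d alpha
    (@measurable_pos_itv R) N (@time_weight R) (C * M') _ CM0 mN N_le (@integrable_time_weight R)
    (@Rintegral_time_weight_le R) x y x0 y0 xy).
- exact: (@integral_kernel_estimates _ (measurableTypeR R) R mu `]0, +oo[%classic d alpha
    (@measurable_pos_itv R) alpha_ge N Nx (@time_weight R) (C * M') 8 _ CM0 eight pi2 NC mN mNx dN N_le Nx_le
    w0 (@integrable_time_weight R) (@Rintegral_time_weight_le R) wn).
Qed.

Lemma measure_kernel (m : {measure set R -> \bar R}) :
  (\int[m]_(t in (`]0%R, +oo[ : set R)) (expR (- (t * lambda0 alpha)))%:E < +oo)%E ->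
  (forall x y, posR x -> posR y -> x <> y ->
    m.-integrable `]0, +oo[ (fun t => (Gker alpha eps t x y)%:E)) /\
  real_estimates alpha (fun x y => \int[m]_(t in `]0, +oo[) Gker alpha eps t x y).
Proof.
move=> m_fin; have [C C0 CP] := kernel_estimates eps alpha_ge.
have Dt0 t : (`]0, +oo[%classic : set R) t -> 0 < t by rewrite /= in_itv/= andbT.
pose e t := expR (- (t * lambda0 alpha)).
(* The weight of part (b) does not depend on [r], so the comparison constant is 1, and its integral
   is finite by hypothesis. *)
pose w (r t : R) := e t.
have me : measurable_fun (`]0, +oo[ : set R) e.
  apply: continuous_pos_measurable => t t0; apply: diff_at_continuous.
  apply: diff_at_expR; apply: diff_atN; apply: diff_atM; [exact: diff_at_id|exact: diff_at_cst].
have ie : m.-integrable `]0, +oo[ (EFin \o e).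
  apply/integrableP; split; first exact/measurable_EFinP.
  rewrite (eq_integral (fun t => (e t)%:E)) // => t _.
  by rewrite /= ger0_norm// expR_ge0.
pose W := `|\int[m]_(t in `]0, +oo[) e t| + 1.
have W0 : 0 < W by rewrite /W; have := normr_ge0 (\int[m]_(t in `]0, +oo[) e t); lra.
have eW r : 0 < r -> \int[m]_(t in `]0, +oo[) w r t <= W.
  by move=> _; rewrite /W; have := ler_norm (\int[m]_(t in `]0, +oo[) e t); rewrite /w; lra.
have iw r : 0 < r -> m.-integrable `]0, +oo[ (EFin \o w r) by [].
pose N t x y := Gker alpha eps t x y.
pose Nx j t x y := Gcoord_x alpha eps j t (x j) x y.
have NC t x y : (`]0, +oo[%classic : set R) t -> posR x -> posR y -> N t x y = N t y x.
  by move=> /Dt0 t0 x0 y0; rewrite /N GkerC.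
have mN x y : posR x -> posR y -> measurable_fun (`]0, +oo[ : set R) (fun t => N t x y).
  by move=> x0 y0; have [_ _ h _] := measurable_kernel j0 x y; exact: h.
have mNx j x y : posR x -> posR y -> measurable_fun (`]0, +oo[ : set R) (fun t => Nx j t x y).
  by move=> x0 y0; have [h _ _ _] := measurable_kernel j x y.
have dN j t x y : (`]0, +oo[%classic : set R) t -> posR x -> posR y ->
    has_deriv (fun s => N t (update x j s) y) (x j) (Nx j t x y).
  by move=> /Dt0 t0 x0 y0; exact: has_deriv_Gker.
have N_le t x y : (`]0, +oo[%classic : set R) t -> posR x -> posR y -> 0 < dist x y ->
    `|N t x y| <= C / Vol alpha x (dist x y) * w (dist x y) t.
  move=> /Dt0 t0 x0 y0 r0; have [h _ _ _] := CP j0 t x y t0 x0 y0 r0.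
  by rewrite /N (Gker_coord j0).
have Nx_le j t x y : (`]0, +oo[%classic : set R) t -> posR x -> posR y -> 0 < dist x y ->
    `|Nx j t x y| <= C / (dist x y * Vol alpha x (dist x y)) * w (dist x y) t.
  by move=> /Dt0 t0 x0 y0 r0; have [_ h _ _] := CP j t x y t0 x0 y0 r0.
have w0 r t : 0 < r -> (`]0, +oo[%classic : set R) t -> 0 <= w r t.
  by move=> _ _; exact: expR_ge0.
have wn r s t : 0 < r -> r / 2 <= s <= 2 * r -> (`]0, +oo[%classic : set R) t ->
    w s t <= 1 * w r t.
  by move=> _ _ _; rewrite mul1r.
have m0 : measurable (`]0, +oo[%classic : set R) by exact: measurable_itv.
split.
- move=> x y x0 y0 xy.
  exact: (@integrable_kernel _ R R m `]0, +oo[%classic d alpha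
    m0 N w C W C0 mN N_le iw eW x y x0 y0 xy).
- exact: (@integral_kernel_estimates _ R R m `]0, +oo[%classic d alpha
    m0 alpha_ge N Nx w C 1 W C0 ltr01 W0 NC mN mNx dN N_le Nx_le w0 iw eW wn).
Qed.

End heat_kernel_integrals.

Theorem mainTheorem4 (R : realType) (d : nat) (alpha : 'I_d -> R)
    (eps : 'I_d -> bool) :
  (forall i, - (1 / 2) <= alpha i) ->
  (* (a) eta = eta_re + i eta_im bounded measurable on (0,oo);
     K(x,y) = - int_0^oo d/dt G_t(x,y) eta(t) dt *)
  (forall eta_re eta_im : R -> R,
     measurable_fun (`]0, +oo[ : set R) eta_re ->
     measurable_fun (`]0, +oo[ : set R) eta_im ->
     (exists M : R, forall t, 0 < t -> `|eta_re t| <= M /\ `|eta_im t| <= M) ->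
     (forall x y, posR x -> posR y -> x <> y ->
        (@lebesgue_measure R).-integrable `]0, +oo[
           (fun t => (dtGker alpha eps t x y * eta_re t)%:E) /\
        (@lebesgue_measure R).-integrable `]0, +oo[
           (fun t => (dtGker alpha eps t x y * eta_im t)%:E)) /\
     standard_estimates alpha
       (fun x y => - \int[@lebesgue_measure R]_(t in `]0, +oo[)
                       (dtGker alpha eps t x y * eta_re t))
       (fun x y => - \int[@lebesgue_measure R]_(t in `]0, +oo[)
                       (dtGker alpha eps t x y * eta_im t))) /\
  (* (b) mu = (mu1 - mu2) + i (mu3 - mu4) with mu_k positive Borel measures
     satisfying int_0^oo e^(-t lambda_0) d mu_k(t) < oo;
     K(x,y) = int_0^oo G_t(x,y) d mu(t) *)
  (forall mu1 mu2 mu3 mu4 : {measure set R -> \bar R},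
     (forall mu : {measure set R -> \bar R}, [\/ mu = mu1, mu = mu2, mu = mu3 | mu = mu4] ->
        (\int[mu]_(t in (`]0%R, +oo[ : set R)) (expR (- (t * lambda0 alpha)))%:E
           < +oo)%E) ->
     (forall x y, posR x -> posR y -> x <> y ->
        forall mu : {measure set R -> \bar R}, [\/ mu = mu1, mu = mu2, mu = mu3 | mu = mu4] ->
        mu.-integrable `]0, +oo[ (fun t => (Gker alpha eps t x y)%:E)) /\
     standard_estimates alpha
       (fun x y => \int[mu1]_(t in `]0, +oo[) Gker alpha eps t x y
                   - \int[mu2]_(t in `]0, +oo[) Gker alpha eps t x y)
       (fun x y => \int[mu3]_(t in `]0, +oo[) Gker alpha eps t x y
                   - \int[mu4]_(t in `]0, +oo[) Gker alpha eps t x y)).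
Proof.
move=> alpha_ge.
(* In dimension [0] there is a single point, so every statement about [x <> y] is vacuous. *)
have [d0|d0] := posnP d.
  have xx (x y : 'I_d -> R) : x = y.
    by apply/funext => i; have := ltn_ord i; rewrite [X in (_ < X)%N]d0.
  have vac Kre Kim : standard_estimates alpha Kre Kim.
    by exists 0 => x y _ _ xy; exfalso; apply: xy; exact: xx.
  by split; intros; (split; last exact: vac) => x y _ _ xy; exfalso; apply: xy; exact: xx.
split.
- move=> eta_re eta_im mre mim [M etaM].
  have [ire ere] : _ /\ _ := time_derivative_kernel eps alpha_ge d0 mre
    (ex_intro _ M (fun t t0 => (etaM t t0).1)).
  have [iim eim] : _ /\ _ := time_derivative_kernel eps alpha_ge d0 mim
    (ex_intro _ M (fun t t0 => (etaM t t0).2)).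
  split; last by apply: standard_of_real_estimates; [|exact: real_estimatesN..].
  by move=> x y x0 y0 xy; split; [exact: ire|exact: iim].
- move=> mu1 mu2 mu3 mu4 fin.
  have k (m : {measure set R -> \bar R}) : [\/ m = mu1, m = mu2, m = mu3 | m = mu4] -> _ :=
    fun h => measure_kernel eps alpha_ge d0 (fin m h).
  have [_ e1] := k mu1 (Or41 _ _ _ erefl).
  have [_ e2] := k mu2 (Or42 _ _ _ erefl).
  have [_ e3] := k mu3 (Or43 _ _ _ erefl).
  have [_ e4] := k mu4 (Or44 _ _ _ erefl).
  split; last by apply: standard_of_real_estimates; [|exact: real_estimatesB..].
  by move=> x y x0 y0 xy m /k[h _]; exact: h.
Qed.
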